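(* There is no $Q$-polynomial association scheme whose Krein array is any of the following. Three classes (29 arrays): $\{12,\frac{338}{35},\frac{39}{25};1,\frac{312}{175},\frac{39}{5}\}$, $\{24,20,\frac{36}{11};1,\frac{30}{11},24\}$, $\{17,16,10;1,2,8\}$, $\{19,\frac{128}{9},10;1,\frac{16}{9},10\}$, $\{20,\frac{378}{25},12;1,\frac{42}{25},9\}$, $\{33,20,\frac{63}{5};1,\frac{12}{5},15\}$, $\{35,\frac{243}{10},\frac{27}{2};1,\frac{27}{10},\frac{45}{2}\}$, $\{23,\frac{432}{25},15;1,\frac{48}{25},9\}$, $\{26,\frac{486}{25},18;1,\frac{54}{25},9\}$, $\{37,24,14;1,2,12\}$, $\{28,\frac{2523}{130},\frac{4263}{338};1,\frac{1218}{845},\frac{203}{26}\}$, $\{83,54,21;1,6,63\}$, $\{49,48,\frac{644}{75};1,\frac{196}{75},42\}$, $\{40,\frac{5043}{203},\frac{123}{7};1,\frac{615}{406},\frac{164}{7}\}$, $\{104,70,25;1,7,80\}$, $\{35,\frac{2187}{86},\frac{45}{2};1,\frac{135}{86},\frac{27}{2}\}$, $\{69,42,7;1,2,63\}$, $\{45,\frac{4761}{148},\frac{115}{4};1,\frac{345}{148},\frac{69}{4}\}$, $\{29,22,25;1,2,5\}$, $\{195,160,28;1,20,168\}$, $\{65,64,\frac{676}{25};1,\frac{104}{25},26\}$, $\{114,\frac{4761}{65},\frac{58121}{1521};1,\frac{11799}{1690},\frac{6118}{117}\}$, $\{36,\frac{45}{2},\frac{45}{2};1,\frac32,\frac{15}{2}\}$,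 $\{126,90,10;1,6,105\}$, $\{47,\frac{135}{4},33;1,\frac94,15\}$, $\{95,63,12;1,3,84\}$, $\{48,30,29;1,\frac32,20\}$, $\{49,48,26;1,2,24\}$, $\{203,160,34;1,16,170\}$. Four classes (92 arrays): $\{12,11,\frac{256}{25},\frac{36}{11};1,\frac{44}{25},\frac{96}{11},12\}$, $\{21,20,\frac{196}{11},\frac{49}{5};1,\frac{35}{11},\frac{56}{5},21\}$, $\{45,44,36,5;1,9,40,45\}$, $\{17,16,\frac{136}{9},9;1,\frac{17}{9},8,17\}$, $\{28,27,25,8;1,3,20,28\}$, $\{36,35,\frac{405}{13},\frac{72}{7};1,\frac{63}{13},\frac{180}{7},36\}$, $\{19,18,\frac{152}{9},11;1,\frac{19}{9},8,19\}$, $\{21,20,\frac{56}{3},13;1,\frac73,8,21\}$, $\{66,65,\frac{847}{15},\frac{88}{13};1,\frac{143}{15},\frac{770}{13},66\}$, $\{78,77,65,8;1,13,70,78\}$, $\{23,22,\frac{184}{9},15;1,\frac{23}{9},8,23\}$, $\{25,24,\frac{200}{9},17;1,\frac{25}{9},8,25\}$, $\{27,26,24,19;1,3,8,27\}$, $\{36,35,33,16;1,3,20,36\}$, $\{38,37,\frac{12635}{351},\frac{76}{37};1,\frac{703}{351},\frac{1330}{37},38\}$, $\{45,44,\frac{1296}{31},\frac{135}{11};1,\frac{99}{31},\frac{360}{11},45\}$, $\{29,28,\frac{232}{9},21;1,\frac{29}{9},8,29\}$, $\{55,54,\frac{352}{7},15;1,\frac{33}{7},40,55\}$, $\{21,20,\frac{364}{19},\frac{81}{5};1,\frac{35}{19},\frac{24}{5},21\}$,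 $\{49,48,\frac{686}{15},\frac{77}{5};1,\frac{49}{15},\frac{168}{5},49\}$, $\{50,49,\frac{4800}{103},\frac{110}{7};1,\frac{350}{103},\frac{240}{7},50\}$, $\{27,26,\frac{3240}{133},\frac{279}{13};1,\frac{351}{133},\frac{72}{13},27\}$, $\{36,35,\frac{4617}{137},\frac{144}{7};1,\frac{315}{137},\frac{108}{7},36\}$, $\{85,84,\frac{1156}{15},\frac{187}{7};1,\frac{119}{15},\frac{408}{7},85\}$, $\{121,120,\frac{5324}{49},\frac{77}{5};1,\frac{605}{49},\frac{528}{5},121\}$, $\{66,65,\frac{2541}{41},\frac{44}{3};1,\frac{165}{41},\frac{154}{3},66\}$, $\{78,77,\frac{507}{7},\frac{52}{3};1,\frac{39}{7},\frac{182}{3},78\}$, $\{25,24,\frac{250}{11},\frac{185}{9};1,\frac{25}{11},\frac{40}{9},25\}$, $\{53,52,\frac{11236}{225},\frac{265}{13};1,\frac{689}{225},\frac{424}{13},53\}$, $\{153,152,136,9;1,17,144,153\}$, $\{171,170,\frac{11552}{77},\frac{171}{17};1,\frac{1615}{77},\frac{2736}{17},171\}$, $\{54,53,\frac{567}{11},12;1,\frac{27}{11},42,54\}$, $\{65,64,\frac{182}{3},25;1,\frac{13}{3},40,65\}$, $\{106,105,\frac{2809}{29},\frac{212}{9};1,\frac{265}{29},\frac{742}{9},106\}$, $\{184,183,161,16;1,23,168,184\}$, $\{50,49,\frac{625}{13},\frac{100}{9};1,\frac{25}{13},\frac{350}{9},50\}$, $\{126,125,\frac{343}{3},28;1,\frac{35}{3},98,126\}$,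 $\{77,76,\frac{3872}{53},\frac{231}{19};1,\frac{209}{53},\frac{1232}{19},77\}$, $\{133,132,\frac{608}{5},21;1,\frac{57}{5},112,133\}$, $\{36,35,\frac{783}{23},24;1,\frac{45}{23},12,36\}$, $\{55,54,\frac{1936}{37},\frac{77}{3};1,\frac{99}{37},\frac{88}{3},55\}$, $\{119,118,\frac{13872}{125},\frac{1309}{59};1,\frac{1003}{125},\frac{5712}{59},119\}$, $\{190,189,\frac{3971}{23},\frac{76}{7};1,\frac{399}{23},\frac{1254}{7},190\}$, $\{210,209,189,12;1,21,198,210\}$, $\{24,23,\frac{2048}{93},\frac{488}{23};1,\frac{184}{93},\frac{64}{23},24\}$, $\{73,72,\frac{10658}{155},\frac{511}{15};1,\frac{657}{155},\frac{584}{15},73\}$, $\{86,85,\frac{12943}{159},\frac{1376}{51};1,\frac{731}{159},\frac{3010}{51},86\}$, $\{75,74,\frac{1200}{17},35;1,\frac{75}{17},40,75\}$, $\{117,116,\frac{6760}{61},\frac{273}{29};1,\frac{377}{61},\frac{3120}{29},117\}$, $\{49,48,\frac{1176}{25},25;1,\frac{49}{25},24,49\}$, $\{261,260,232,21;1,29,240,261\}$, $\{51,50,\frac{1224}{25},27;1,\frac{51}{25},24,51\}$, $\{100,99,\frac{12800}{137},\frac{140}{3};1,\frac{900}{137},\frac{160}{3},100\}$, $\{66,65,\frac{1463}{23},24;1,\frac{55}{23},42,66\}$, $\{78,77,\frac{3211}{43},\frac{312}{11};1,\frac{143}{43},\frac{546}{11},78\}$, $\{53,52,\frac{1272}{25},29;1,\frac{53}{25},24,53\}$,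 $\{106,105,\frac{901}{9},36;1,\frac{53}{9},70,106\}$, $\{91,90,\frac{2704}{31},\frac{65}{3};1,\frac{117}{31},\frac{208}{3},91\}$, $\{105,104,98,49;1,7,56,105\}$, $\{105,104,100,25;1,5,80,105\}$, $\{55,54,\frac{264}{5},31;1,\frac{11}{5},24,55\}$, $\{73,72,\frac{21316}{301},\frac{365}{21};1,\frac{657}{301},\frac{1168}{21},73\}$, $\{85,84,\frac{884}{11},45;1,\frac{51}{11},40,85\}$, $\{91,90,\frac{1664}{19},\frac{119}{5};1,\frac{65}{19},\frac{336}{5},91\}$, $\{147,146,\frac{2352}{17},35;1,\frac{147}{17},112,147\}$, $\{105,104,\frac{4320}{43},\frac{357}{13};1,\frac{195}{43},\frac{1008}{13},105\}$, $\{57,56,\frac{1368}{25},33;1,\frac{57}{25},24,57\}$, $\{59,58,\frac{1416}{25},35;1,\frac{59}{25},24,59\}$, $\{103,102,\frac{84872}{875},\frac{927}{17};1,\frac{5253}{875},\frac{824}{17},103\}$, $\{61,60,\frac{1464}{25},37;1,\frac{61}{25},24,61\}$, $\{66,65,\frac{1089}{17},\frac{88}{3};1,\frac{33}{17},\frac{110}{3},66\}$, $\{78,77,\frac{7605}{101},\frac{104}{3};1,\frac{273}{101},\frac{130}{3},78\}$, $\{134,133,\frac{22445}{177},\frac{2948}{57};1,\frac{1273}{177},\frac{4690}{57},134\}$, $\{63,62,\frac{1512}{25},39;1,\frac{63}{25},24,63\}$, $\{100,99,\frac{19200}{203},\frac{620}{11};1,\frac{1100}{203},\frac{480}{11},100\}$,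 $\{90,89,\frac{1125}{13},40;1,\frac{45}{13},50,90\}$, $\{217,216,\frac{3844}{19},\frac{155}{3};1,\frac{279}{19},\frac{496}{3},217\}$, $\{65,64,\frac{312}{5},41;1,\frac{13}{5},24,65\}$, $\{78,77,\frac{377}{5},36;1,\frac{13}{5},42,78\}$, $\{88,87,\frac{429}{5},16;1,\frac{11}{5},72,88\}$, $\{27,26,\frac{3888}{157},\frac{327}{13};1,\frac{351}{157},\frac{24}{13},27\}$, $\{325,324,300,13;1,25,312,325\}$, $\{232,231,\frac{32799}{151},\frac{464}{11};1,\frac{2233}{151},\frac{2088}{11},232\}$, $\{106,105,\frac{8427}{83},\frac{424}{9};1,\frac{371}{83},\frac{530}{9},106\}$, $\{351,350,\frac{52488}{163},\frac{351}{25};1,\frac{4725}{163},\frac{8424}{25},351\}$, $\{67,66,\frac{1608}{25},43;1,\frac{67}{25},24,67\}$, $\{105,104,\frac{17500}{171},\frac{165}{13};1,\frac{455}{171},\frac{1200}{13},105\}$, $\{153,152,\frac{8092}{55},\frac{459}{19};1,\frac{323}{55},\frac{2448}{19},153\}$, $\{171,170,\frac{2128}{13},27;1,\frac{95}{13},144,171\}$, $\{69,68,\frac{1656}{25},45;1,\frac{69}{25},24,69\}$, $\{161,160,\frac{460}{3},49;1,\frac{23}{3},112,161\}$, $\{126,125,\frac{1323}{11},56;1,\frac{63}{11},70,126\}$. Five classes (11 arrays): $\{21,20,18,\frac{21}{2},\frac{27}{7};1,3,\frac{21}{2},\frac{120}{7},21\}$, $\{25,24,\frac{625}{28},\frac{75}{7},\frac{25}{7};1,\frac{75}{28},\frac{100}{7},\frac{150}{7},25\}$,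 $\{25,24,\frac{625}{27},\frac{50}{3},\frac{25}{9};1,\frac{50}{27},\frac{25}{3},\frac{200}{9},25\}$, $\{22,21,20,\frac{88}{5},\frac{32}{11};1,2,\frac{22}{5},\frac{210}{11},22\}$, $\{61,60,\frac{3721}{66},\frac{305}{11},\frac{61}{11};1,\frac{305}{66},\frac{366}{11},\frac{610}{11},61\}$, $\{113,112,\frac{12769}{120},\frac{791}{15},\frac{113}{15};1,\frac{791}{120},\frac{904}{15},\frac{1582}{15},113\}$, $\{181,180,\frac{32761}{190},\frac{1629}{19},\frac{181}{19};1,\frac{1629}{190},\frac{1810}{19},\frac{3258}{19},181\}$, $\{265,264,\frac{70225}{276},\frac{2915}{23},\frac{265}{23};1,\frac{2915}{276},\frac{3180}{23},\frac{5830}{23},265\}$, $\{121,120,\frac{14641}{125},\frac{484}{5},\frac{121}{25};1,\frac{484}{125},\frac{121}{5},\frac{2904}{25},121\}$, $\{365,364,\frac{133225}{378},\frac{4745}{27},\frac{365}{27};1,\frac{4745}{378},\frac{5110}{27},\frac{9490}{27},365\}$, $\{116,115,112,\frac{696}{7},\frac{144}{29};1,4,\frac{116}{7},\frac{3220}{29},116\}$.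
   Context: A (symmetric) association scheme with $D$ classes is a pair $(X,\{R_i\}_{i=0}^D)$ where $X$ is a finite set and $R_0,\dots,R_D$ are non-empty subsets of $X\times X$ whose adjacency matrices $A_0,\dots,A_D$ satisfy: $A_0=I$, $\sum_i A_i=J$, $A_i^\top=A_i$, and $A_iA_j=\sum_k p_{ij}^kA_k$ for nonnegative integers $p_{ij}^k$. The real span of the $A_i$ is a commutative algebra with a basis of primitive idempotents $E_0=\frac{1}{|X|}J,E_1,\dots,E_D$, closed under the entrywise product $\circ$; the Krein parameters $q_{ij}^k$ are defined by $E_i\circ E_j=\frac1{|X|}\sum_{k=0}^D q_{ij}^kE_k$. An ordering $E_1,\dots,E_D$ of the nontrivial idempotents is $Q$-polynomial if the matrix $(q_{1j}^k)_{k,j=0}^D$ is tridiagonal with all superdiagonal and subdiagonal entries nonzero. For such an ordering put $b_i^*=q_{1,i+1}^i$ and $c_i^*=q_{1,i-1}^i$; the Krein array is $\{b_0^*,b_1^*,\dots,b_{D-1}^*;c_1^*,c_2^*,\dots,c_D^*\}$. A $Q$-polynomial association scheme with a given Krein array is an association scheme admitting a $Q$-polynomial ordering of its idempotents whose Krein array is the given one (the number of classes $D$ is the length of each half of the array). *)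

(* Defs.v *)
From Stdlib Require Import QArith.
From mathcomp Require Import all_boot all_order all_algebra.
From mathcomp Require Import reals ssrZ.

Set Implicit Arguments.
Unset Strict Implicit.
Unset Printing Implicit Defensive.

Import GRing.Theory.
Local Open Scope ring_scope.

(* Matrices with rows and columns indexed by X are #|X| x #|X| matrices, the
   points of X being numbered by enum_val. *)
Definition adjmx (R : realType) (X : finType) (S : {set X * X}) :
    'M[R]_#|X| :=
  \matrix_(x, y) ((enum_val x, enum_val y) \in S)%:R.

Record association_scheme (R : realType) (X : finType) (D : nat)
    (Rel : 'I_D.+1 -> {set X * X}) : Prop := AssociationScheme {
  scheme_neq0 : forall i, Rel i != set0;
  scheme_id : adjmx R (Rel ord0) = 1%:M;
  scheme_sum : \sum_i adjmx R (Rel i) = const_mx 1;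
  scheme_sym : forall i, (adjmx R (Rel i))^T = adjmx R (Rel i);
  scheme_mul : exists p : 'I_D.+1 -> 'I_D.+1 -> 'I_D.+1 -> nat,
    forall i j,
      adjmx R (Rel i) *m adjmx R (Rel j) =
        \sum_k (p i j k)%:R *: adjmx R (Rel k)
}.

Definition bose_mesner (R : realType) (X : finType) (D : nat)
    (Rel : 'I_D.+1 -> {set X * X}) : {vspace 'M[R]_#|X|} :=
  <<[seq adjmx R (Rel i) | i : 'I_D.+1]>>%VS.

Definition primitive_idempotent (R : realType) (n : nat)
    (U : {vspace 'M[R]_n}) (e : 'M[R]_n) : Prop :=
  [/\ e \in U, e != 0, e *m e = e &
      forall f g : 'M[R]_n, f \in U -> g \in U ->
        f *m f = f -> g *m g = g -> f *m g = 0 -> g *m f = 0 ->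
        e = f + g -> f = 0 \/ g = 0].

(* E ranges over the orderings E_0, E_1, ..., E_D of the primitive idempotents
   that start with the trivial one. *)
Definition idempotent_ordering (R : realType) (X : finType) (D : nat)
    (Rel : 'I_D.+1 -> {set X * X}) (E : 'I_D.+1 -> 'M[R]_#|X|) : Prop :=
  [/\ E ord0 = #|X|%:R^-1 *: const_mx 1,
      forall i, primitive_idempotent (bose_mesner R Rel) (E i) &
      basis_of (bose_mesner R Rel) [seq E i | i : 'I_D.+1]].

(* q i j k stands for q_{ij}^k; it is determined by E when E is a basis. *)
Definition krein_parameters (R : realType) (X : finType) (D : nat)
    (E : 'I_D.+1 -> 'M[R]_#|X|) (q : 'I_D.+1 -> 'I_D.+1 -> 'I_D.+1 -> R) :
    Prop :=
  forall i j,
    map2_mx *%R (E i) (E j) = #|X|%:R^-1 *: \sum_k q i j k *: E k.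

(* inord 1 is the index 1 as soon as D >= 1. *)
Definition Q_polynomial (R : realType) (D : nat)
    (q : 'I_D.+1 -> 'I_D.+1 -> 'I_D.+1 -> R) : Prop :=
  forall k j : 'I_D.+1,
    ((k.+1 < j)%N || (j.+1 < k)%N -> q (inord 1) j k = 0) /\
    ((k.+1 == j :> nat) || (j.+1 == k :> nat) -> q (inord 1) j k != 0).

Definition krein_array (R : realType) (D : nat)
    (q : 'I_D.+1 -> 'I_D.+1 -> 'I_D.+1 -> R) : seq R * seq R :=
  ([seq q (inord 1) (inord i.+1) (inord i) | i <- iota 0 D],
   [seq q (inord 1) (inord i.-1) (inord i) | i <- iota 1 D]).

Definition Q_polynomial_scheme_with_array (R : realType) (X : finType)
    (D : nat) (Rel : 'I_D.+1 -> {set X * X}) (a : seq R * seq R) : Prop :=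
  association_scheme R Rel /\
  exists (E : 'I_D.+1 -> 'M[R]_#|X|)
         (q : 'I_D.+1 -> 'I_D.+1 -> 'I_D.+1 -> R),
    [/\ idempotent_ordering Rel E, krein_parameters E q, Q_polynomial q &
        krein_array q = a].

(* The arrays are written in Stdlib's Q, whose numerals are stored in binary:
   numerals of R or rat unfold to unary naturals (up to 133225 here). *)
Definition of_Q (R : realType) (x : Q) : R :=
  (int_of_Z (Qnum x))%:~R / (Pos.to_nat (Qden x))%:R.

Local Open Scope Q_scope.

Definition krein_arrays_three : seq (seq Q * seq Q) := [::
  ([:: 12; 338#35; 39#25], [:: 1; 312#175; 39#5]);
  ([:: 24; 20; 36#11], [:: 1; 30#11; 24]);
  ([:: 17; 16; 10], [:: 1; 2; 8]);
  ([:: 19; 128#9; 10], [:: 1; 16#9; 10]);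
  ([:: 20; 378#25; 12], [:: 1; 42#25; 9]);
  ([:: 33; 20; 63#5], [:: 1; 12#5; 15]);
  ([:: 35; 243#10; 27#2], [:: 1; 27#10; 45#2]);
  ([:: 23; 432#25; 15], [:: 1; 48#25; 9]);
  ([:: 26; 486#25; 18], [:: 1; 54#25; 9]);
  ([:: 37; 24; 14], [:: 1; 2; 12]);
  ([:: 28; 2523#130; 4263#338], [:: 1; 1218#845; 203#26]);
  ([:: 83; 54; 21], [:: 1; 6; 63]);
  ([:: 49; 48; 644#75], [:: 1; 196#75; 42]);
  ([:: 40; 5043#203; 123#7], [:: 1; 615#406; 164#7]);
  ([:: 104; 70; 25], [:: 1; 7; 80]);
  ([:: 35; 2187#86; 45#2], [:: 1; 135#86; 27#2]);
  ([:: 69; 42; 7], [:: 1; 2; 63]);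
  ([:: 45; 4761#148; 115#4], [:: 1; 345#148; 69#4]);
  ([:: 29; 22; 25], [:: 1; 2; 5]);
  ([:: 195; 160; 28], [:: 1; 20; 168]);
  ([:: 65; 64; 676#25], [:: 1; 104#25; 26]);
  ([:: 114; 4761#65; 58121#1521], [:: 1; 11799#1690; 6118#117]);
  ([:: 36; 45#2; 45#2], [:: 1; 3#2; 15#2]);
  ([:: 126; 90; 10], [:: 1; 6; 105]);
  ([:: 47; 135#4; 33], [:: 1; 9#4; 15]);
  ([:: 95; 63; 12], [:: 1; 3; 84]);
  ([:: 48; 30; 29], [:: 1; 3#2; 20]);
  ([:: 49; 48; 26], [:: 1; 2; 24]);
  ([:: 203; 160; 34], [:: 1; 16; 170])].

Definition krein_arrays_four : seq (seq Q * seq Q) := [::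
  ([:: 12; 11; 256#25; 36#11], [:: 1; 44#25; 96#11; 12]);
  ([:: 21; 20; 196#11; 49#5], [:: 1; 35#11; 56#5; 21]);
  ([:: 45; 44; 36; 5], [:: 1; 9; 40; 45]);
  ([:: 17; 16; 136#9; 9], [:: 1; 17#9; 8; 17]);
  ([:: 28; 27; 25; 8], [:: 1; 3; 20; 28]);
  ([:: 36; 35; 405#13; 72#7], [:: 1; 63#13; 180#7; 36]);
  ([:: 19; 18; 152#9; 11], [:: 1; 19#9; 8; 19]);
  ([:: 21; 20; 56#3; 13], [:: 1; 7#3; 8; 21]);
  ([:: 66; 65; 847#15; 88#13], [:: 1; 143#15; 770#13; 66]);
  ([:: 78; 77; 65; 8], [:: 1; 13; 70; 78]);
  ([:: 23; 22; 184#9; 15], [:: 1; 23#9; 8; 23]);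
  ([:: 25; 24; 200#9; 17], [:: 1; 25#9; 8; 25]);
  ([:: 27; 26; 24; 19], [:: 1; 3; 8; 27]);
  ([:: 36; 35; 33; 16], [:: 1; 3; 20; 36]);
  ([:: 38; 37; 12635#351; 76#37], [:: 1; 703#351; 1330#37; 38]);
  ([:: 45; 44; 1296#31; 135#11], [:: 1; 99#31; 360#11; 45]);
  ([:: 29; 28; 232#9; 21], [:: 1; 29#9; 8; 29]);
  ([:: 55; 54; 352#7; 15], [:: 1; 33#7; 40; 55]);
  ([:: 21; 20; 364#19; 81#5], [:: 1; 35#19; 24#5; 21]);
  ([:: 49; 48; 686#15; 77#5], [:: 1; 49#15; 168#5; 49]);
  ([:: 50; 49; 4800#103; 110#7], [:: 1; 350#103; 240#7; 50]);
  ([:: 27; 26; 3240#133; 279#13], [:: 1; 351#133; 72#13; 27]);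
  ([:: 36; 35; 4617#137; 144#7], [:: 1; 315#137; 108#7; 36]);
  ([:: 85; 84; 1156#15; 187#7], [:: 1; 119#15; 408#7; 85]);
  ([:: 121; 120; 5324#49; 77#5], [:: 1; 605#49; 528#5; 121]);
  ([:: 66; 65; 2541#41; 44#3], [:: 1; 165#41; 154#3; 66]);
  ([:: 78; 77; 507#7; 52#3], [:: 1; 39#7; 182#3; 78]);
  ([:: 25; 24; 250#11; 185#9], [:: 1; 25#11; 40#9; 25]);
  ([:: 53; 52; 11236#225; 265#13], [:: 1; 689#225; 424#13; 53]);
  ([:: 153; 152; 136; 9], [:: 1; 17; 144; 153]);
  ([:: 171; 170; 11552#77; 171#17], [:: 1; 1615#77; 2736#17; 171]);
  ([:: 54; 53; 567#11; 12], [:: 1; 27#11; 42; 54]);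
  ([:: 65; 64; 182#3; 25], [:: 1; 13#3; 40; 65]);
  ([:: 106; 105; 2809#29; 212#9], [:: 1; 265#29; 742#9; 106]);
  ([:: 184; 183; 161; 16], [:: 1; 23; 168; 184]);
  ([:: 50; 49; 625#13; 100#9], [:: 1; 25#13; 350#9; 50]);
  ([:: 126; 125; 343#3; 28], [:: 1; 35#3; 98; 126]);
  ([:: 77; 76; 3872#53; 231#19], [:: 1; 209#53; 1232#19; 77]);
  ([:: 133; 132; 608#5; 21], [:: 1; 57#5; 112; 133]);
  ([:: 36; 35; 783#23; 24], [:: 1; 45#23; 12; 36]);
  ([:: 55; 54; 1936#37; 77#3], [:: 1; 99#37; 88#3; 55]);
  ([:: 119; 118; 13872#125; 1309#59], [:: 1; 1003#125; 5712#59; 119]);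
  ([:: 190; 189; 3971#23; 76#7], [:: 1; 399#23; 1254#7; 190]);
  ([:: 210; 209; 189; 12], [:: 1; 21; 198; 210]);
  ([:: 24; 23; 2048#93; 488#23], [:: 1; 184#93; 64#23; 24]);
  ([:: 73; 72; 10658#155; 511#15], [:: 1; 657#155; 584#15; 73]);
  ([:: 86; 85; 12943#159; 1376#51], [:: 1; 731#159; 3010#51; 86]);
  ([:: 75; 74; 1200#17; 35], [:: 1; 75#17; 40; 75]);
  ([:: 117; 116; 6760#61; 273#29], [:: 1; 377#61; 3120#29; 117]);
  ([:: 49; 48; 1176#25; 25], [:: 1; 49#25; 24; 49]);
  ([:: 261; 260; 232; 21], [:: 1; 29; 240; 261]);
  ([:: 51; 50; 1224#25; 27], [:: 1; 51#25; 24; 51]);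
  ([:: 100; 99; 12800#137; 140#3], [:: 1; 900#137; 160#3; 100]);
  ([:: 66; 65; 1463#23; 24], [:: 1; 55#23; 42; 66]);
  ([:: 78; 77; 3211#43; 312#11], [:: 1; 143#43; 546#11; 78]);
  ([:: 53; 52; 1272#25; 29], [:: 1; 53#25; 24; 53]);
  ([:: 106; 105; 901#9; 36], [:: 1; 53#9; 70; 106]);
  ([:: 91; 90; 2704#31; 65#3], [:: 1; 117#31; 208#3; 91]);
  ([:: 105; 104; 98; 49], [:: 1; 7; 56; 105]);
  ([:: 105; 104; 100; 25], [:: 1; 5; 80; 105]);
  ([:: 55; 54; 264#5; 31], [:: 1; 11#5; 24; 55]);
  ([:: 73; 72; 21316#301; 365#21], [:: 1; 657#301; 1168#21; 73]);
  ([:: 85; 84; 884#11; 45], [:: 1; 51#11; 40; 85]);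
  ([:: 91; 90; 1664#19; 119#5], [:: 1; 65#19; 336#5; 91]);
  ([:: 147; 146; 2352#17; 35], [:: 1; 147#17; 112; 147]);
  ([:: 105; 104; 4320#43; 357#13], [:: 1; 195#43; 1008#13; 105]);
  ([:: 57; 56; 1368#25; 33], [:: 1; 57#25; 24; 57]);
  ([:: 59; 58; 1416#25; 35], [:: 1; 59#25; 24; 59]);
  ([:: 103; 102; 84872#875; 927#17], [:: 1; 5253#875; 824#17; 103]);
  ([:: 61; 60; 1464#25; 37], [:: 1; 61#25; 24; 61]);
  ([:: 66; 65; 1089#17; 88#3], [:: 1; 33#17; 110#3; 66]);
  ([:: 78; 77; 7605#101; 104#3], [:: 1; 273#101; 130#3; 78]);
  ([:: 134; 133; 22445#177; 2948#57], [:: 1; 1273#177; 4690#57; 134]);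
  ([:: 63; 62; 1512#25; 39], [:: 1; 63#25; 24; 63]);
  ([:: 100; 99; 19200#203; 620#11], [:: 1; 1100#203; 480#11; 100]);
  ([:: 90; 89; 1125#13; 40], [:: 1; 45#13; 50; 90]);
  ([:: 217; 216; 3844#19; 155#3], [:: 1; 279#19; 496#3; 217]);
  ([:: 65; 64; 312#5; 41], [:: 1; 13#5; 24; 65]);
  ([:: 78; 77; 377#5; 36], [:: 1; 13#5; 42; 78]);
  ([:: 88; 87; 429#5; 16], [:: 1; 11#5; 72; 88]);
  ([:: 27; 26; 3888#157; 327#13], [:: 1; 351#157; 24#13; 27]);
  ([:: 325; 324; 300; 13], [:: 1; 25; 312; 325]);
  ([:: 232; 231; 32799#151; 464#11], [:: 1; 2233#151; 2088#11; 232]);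
  ([:: 106; 105; 8427#83; 424#9], [:: 1; 371#83; 530#9; 106]);
  ([:: 351; 350; 52488#163; 351#25], [:: 1; 4725#163; 8424#25; 351]);
  ([:: 67; 66; 1608#25; 43], [:: 1; 67#25; 24; 67]);
  ([:: 105; 104; 17500#171; 165#13], [:: 1; 455#171; 1200#13; 105]);
  ([:: 153; 152; 8092#55; 459#19], [:: 1; 323#55; 2448#19; 153]);
  ([:: 171; 170; 2128#13; 27], [:: 1; 95#13; 144; 171]);
  ([:: 69; 68; 1656#25; 45], [:: 1; 69#25; 24; 69]);
  ([:: 161; 160; 460#3; 49], [:: 1; 23#3; 112; 161]);
  ([:: 126; 125; 1323#11; 56], [:: 1; 63#11; 70; 126])].

Definition krein_arrays_five : seq (seq Q * seq Q) := [::
  ([:: 21; 20; 18; 21#2; 27#7], [:: 1; 3; 21#2; 120#7; 21]);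
  ([:: 25; 24; 625#28; 75#7; 25#7], [:: 1; 75#28; 100#7; 150#7; 25]);
  ([:: 25; 24; 625#27; 50#3; 25#9], [:: 1; 50#27; 25#3; 200#9; 25]);
  ([:: 22; 21; 20; 88#5; 32#11], [:: 1; 2; 22#5; 210#11; 22]);
  ([:: 61; 60; 3721#66; 305#11; 61#11], [:: 1; 305#66; 366#11; 610#11; 61]);
  ([:: 113; 112; 12769#120; 791#15; 113#15], [:: 1; 791#120; 904#15; 1582#15; 113]);
  ([:: 181; 180; 32761#190; 1629#19; 181#19], [:: 1; 1629#190; 1810#19; 3258#19; 181]);
  ([:: 265; 264; 70225#276; 2915#23; 265#23], [:: 1; 2915#276; 3180#23; 5830#23; 265]);
  ([:: 121; 120; 14641#125; 484#5; 121#25], [:: 1; 484#125; 121#5; 2904#25; 121]);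
  ([:: 365; 364; 133225#378; 4745#27; 365#27], [:: 1; 4745#378; 5110#27; 9490#27; 365]);
  ([:: 116; 115; 112; 696#7; 144#29], [:: 1; 4; 116#7; 3220#29; 116])].

Definition excluded_krein_arrays : seq (seq Q * seq Q) :=
  krein_arrays_three ++ krein_arrays_four ++ krein_arrays_five.

(* Main.v *)
(* Number the relations of a Q-polynomial scheme by the eigenvalues of its Krein
   matrix: these are the values of |X| E_1, and the rows of the eigenmatrix Q are
   the eigenvectors.  The array thus determines Q, the valencies and the
   intersection numbers.  For points u, v, w with given mutual relations let
   [rst] be the number of points in relation r to u, s to v and t to w.  Summing
   over r, s or t gives intersection numbers, and, by Cameron, Goethals and
   Seidel, each vanishing Krein parameter q_{ij}^l gives
   sum_{rst} Q_{ri} Q_{sj} Q_{tl} [rst] = 0.  For all arrays but two these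
   equations have no solution in nonnegative integers for a suitable type of
   triple.  For {104,70,25;1,7,80} they bound [121] for triples of type 111 and
   [111] for triples of type 112, against the double counting of the edges
   between two neighbourhoods; for {24,20,36/11;1,30/11,24} they make a graph on
   3 vertices regular of degree 1.  The infeasibility is certified by a
   combination of the equations and of Chvatal-Gomory cuts; when Q is irrational
   the multipliers lie in its quadratic field. *)
Require Import Defs.
From Stdlib Require Import ZArith QArith.
From mathcomp Require Import all_boot all_order all_algebra.
From mathcomp Require Import reals ssrZ zify ring.

Set Implicit Arguments.
Unset Strict Implicit.
Unset Printing Implicit Defensive.
Import Order.TTheory GRing.Theory Num.Theory.
Local Open Scope ring_scope.

(** * Bose-Mesner algebra *)

(** For two points the values of the [|X| E_j] form an eigenvector of the Krein matrix with entry 1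
    at [E_0]. The Krein matrix has distinct eigenvalues, so this vector is a row of Q, and the
    relation between the points is defined as the index of that row. The counting rests on four
    facts about this function: it is symmetric, it is [ord0] on the diagonal, the columns of Q are
    orthogonal for the valencies as weights, and products of idempotents turn into sums over points
    of products of entries of Q. The checker is shaped by the need to evaluate everything inside the
    kernel. Column j of Q is multiplied by a positive integer that makes its entries pairs of binary
    integers, and this scale accompanies every identity between idempotents. Signs of irrational
    numbers are never decided: equality in the quadratic field is compared by components,
    non-vanishing is read off from the norm, and inequalities occur only between integers. *)

Lemma mem_span_image (K : fieldType) (vT : vectType K) (I : finType)
    (f : I -> vT) v :
  v \in <<[seq f i | i : I]>>%VS -> exists a : I -> K, v = \sum_i a i *: f i.
Proof.
rewrite span_def big_map big_enum /= => /memv_sumP[vs vsP ->].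
have aP i : exists a, vs i == a *: f i.
  by have /vlineP[a ->] := vsP i isT; exists a.
exists (fun i => xchoose (aP i)); apply: eq_bigr => i _.
exact/eqP/(xchooseP (aP i)).
Qed.

Section BoseMesner.
Variables (R : realType) (X : finType) (D : nat) (Rel : 'I_D.+1 -> {set X * X}).
Hypothesis schemeP : association_scheme R Rel.
Local Notation U := (bose_mesner R Rel).

Lemma adjmx_bose_mesner i : adjmx R (Rel i) \in U.
Proof. by apply/memv_span/imageP; exists i. Qed.

Lemma bose_mesner_tr M : M \in U -> M^T = M.
Proof.
move=> /mem_span_image[a ->]; rewrite linear_sum; apply: eq_bigr => i _.
by rewrite linearZ /= (scheme_sym schemeP).
Qed.

Lemma bose_mesnerM M M' : M \in U -> M' \in U -> M *m M' \in U.
Proof.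
move=> /mem_span_image[a ->] /mem_span_image[b ->].
rewrite mulmx_suml memv_suml // => i _; rewrite mulmx_sumr memv_suml // => j _.
rewrite -scalemxAl -scalemxAr !memvZ //.
have [p ->] := scheme_mul schemeP.
by rewrite memv_suml // => k _; rewrite memvZ // adjmx_bose_mesner.
Qed.

Lemma bose_mesnerC M M' : M \in U -> M' \in U -> M *m M' = M' *m M.
Proof.
move=> UM UM'; rewrite -[LHS](bose_mesner_tr (bose_mesnerM UM UM')) trmx_mul.
by rewrite !bose_mesner_tr.
Qed.

Lemma card_scheme_gt0 : (0 < #|X|)%N.
Proof.
have /set0Pn[[x y] _] := scheme_neq0 schemeP ord0.
by apply/card_gt0P; exists x.
Qed.

(** In the commutative algebra [U] the idempotent [e] splits as [e f + (e - e f)], two orthogonal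
    idempotents of [U]; primitivity kills one of them. *)
Lemma primitive_idempotent_absorb e f :
  primitive_idempotent U e -> f \in U -> f *m f = f ->
  e *m f = 0 \/ e = e *m f.
Proof.
move=> [Ue _ ee eP] Uf ff.
have Uef := bose_mesnerM Ue Uf; have efC := bose_mesnerC Ue Uf.
have efef : (e *m f) *m (e *m f) = e *m f.
  by rewrite -mulmxA (mulmxA f) -efC -(mulmxA e) ff mulmxA ee.
have eef : e *m (e *m f) = e *m f by rewrite mulmxA ee.
have efe : (e *m f) *m e = e *m f by rewrite (bose_mesnerC Uef Ue).
suff [?|/subr0_eq ?] : e *m f = 0 \/ e - e *m f = 0 by [left|right].
apply: eP => //.
- by rewrite memvB.
- by rewrite mulmxBl !mulmxBr ee eef efe efef subrr subr0.
- by rewrite mulmxBr efe efef subrr.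
- by rewrite mulmxBl eef efef subrr.
- by rewrite addrC subrK.
Qed.

(** If neither product vanished, absorption in both directions and commutativity would give
    [e = e f = f e = f]. *)
Lemma primitive_idempotent_orthogonal e f :
  primitive_idempotent U e -> primitive_idempotent U f -> e != f ->
  e *m f = 0.
Proof.
move=> eP fP; have [Ue _ ee _] := eP; have [Uf _ ff _] := fP.
have [//|e_ef] := primitive_idempotent_absorb eP Uf ff.
have [fe0|f_fe] := primitive_idempotent_absorb fP Ue ee.
  by rewrite bose_mesnerC.
by rewrite e_ef bose_mesnerC // -f_fe eqxx.
Qed.

Variables (E : 'I_D.+1 -> 'M[R]_#|X|).
Hypothesis E_ordering : idempotent_ordering Rel E.

Lemma idempotent_ordering_orthogonal i j :
  E i *m E j = if i == j then E i else 0.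
Proof.
have [_ prim /andP[_ Efree]] := E_ordering.
case: eqVneq => [<-|neq_ij]; first by have [] := prim i.
apply: primitive_idempotent_orthogonal => //; apply: contraNneq neq_ij => eqE.
by have /injectiveP/(_ i j eqE)-> := free_uniq Efree.
Qed.

(** The identity is the adjacency matrix of the relation 0, hence a combination of the [E i];
    multiplying it by [E i] shows that the coefficient [a i] acts as 1 on [E i]. *)
Lemma idempotent_ordering_sum : \sum_i E i = 1%:M.
Proof.
have [_ prim /andP[/eqP Espan _]] := E_ordering.
have: (1%:M : 'M[R]_#|X|) \in U by rewrite -(scheme_id schemeP) adjmx_bose_mesner.
rewrite -Espan => /mem_span_image[a a1]; rewrite a1; apply: eq_bigr => i _.
rewrite -[LHS]mulmx1 a1 mulmx_sumr (bigD1 i) //= big1 => [|j ne_ji].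
  by rewrite addr0 -scalemxAr idempotent_ordering_orthogonal eqxx.
by rewrite -scalemxAr idempotent_ordering_orthogonal eq_sym (negPf ne_ji) scaler0.
Qed.

Local Notation N := (#|X|%:R : R).
(** On a relation r this matrix takes the constant value [Q_{ri}] of the second eigenmatrix. In this
    normalisation the one at [ord0] is the all-one matrix, and the Krein parameters are the
    structure constants of the entrywise product without the factor [1/|X|]. *)
Definition scaled_idempotent i : 'M[R]_#|X| := N *: E i.
Local Notation F := scaled_idempotent.

Lemma cardR_neq0 : N != 0.
Proof. by rewrite pnatr_eq0 -lt0n card_scheme_gt0. Qed.

Lemma scaled_idempotent0 x y : F ord0 x y = 1.
Proof.
have [E0 _ _] := E_ordering.
by rewrite /scaled_idempotent E0 !mxE mulrA mulfV ?cardR_neq0 ?mulr1.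
Qed.

Lemma scaled_idempotent_neq0 i : F i != 0.
Proof.
have [_ prim _] := E_ordering; have [_ Ei0 _ _] := prim i.
by rewrite scaler_eq0 negb_or cardR_neq0.
Qed.

Lemma scaled_idempotent_sym i x y : F i x y = F i y x.
Proof.
have [_ prim _] := E_ordering; have [UE _ _ _] := prim i.
by rewrite -[F i in LHS]bose_mesner_tr ?memvZ // mxE.
Qed.

Lemma scaled_idempotentM i j : F i *m F j = if i == j then N *: F i else 0.
Proof.
rewrite -scalemxAl -scalemxAr idempotent_ordering_orthogonal.
by case: eqP => // _; rewrite !scaler0.
Qed.

Lemma sum_scaled_idempotent_mul i j x y :
  \sum_z F i x z * F j z y = if i == j then N * F i x y else 0.
Proof.
have /matrixP/(_ x y) := scaled_idempotentM i j.
by rewrite !mxE => ->; case: eqP => _; rewrite !mxE.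
Qed.

Lemma sum_scaled_idempotent_row i x :
  \sum_z F i x z = if i == ord0 then N else 0.
Proof.
have := sum_scaled_idempotent_mul i ord0 x x.
under eq_bigr do rewrite scaled_idempotent0 mulr1.
by move=> ->; case: eqP => // ->; rewrite scaled_idempotent0 mulr1.
Qed.

Lemma sum_scaled_idempotent : \sum_i F i = N%:M.
Proof. by rewrite -scaler_sumr idempotent_ordering_sum scalemx1. Qed.

Variables (q : 'I_D.+1 -> 'I_D.+1 -> 'I_D.+1 -> R).
Hypothesis kreinP : krein_parameters E q.

Lemma scaled_idempotent_hadamard i j x y :
  F i x y * F j x y = \sum_k q i j k * F k x y.
Proof.
have /matrixP/(_ x y) := kreinP i j; rewrite !mxE summxE => eqE.
rewrite mulrACA eqE mulrA mulrK ?unitfE ?cardR_neq0 // mulr_sumr.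
by apply: eq_bigr => k _; rewrite !mxE mulrCA.
Qed.

(** The sum of [F i x z ^ 2] over z is computed twice: as a diagonal entry of the matrix square it
    is [N * F i x x], and after expansion in Krein parameters only the row sum of [F ord0] survives.
    So the diagonal is constant and equals the multiplicity. *)
Lemma scaled_idempotent_diag i x : F i x x = q i i ord0.
Proof.
have := sum_scaled_idempotent_mul i i x x; rewrite eqxx.
under eq_bigr => z _ do rewrite -[F i z x]scaled_idempotent_sym
  scaled_idempotent_hadamard.
rewrite exchange_big (bigD1 ord0) //= [X in _ + X]big1 => [|k k0]; last first.
  by rewrite -mulr_sumr sum_scaled_idempotent_row (negPf k0) mulr0.
rewrite addr0 -mulr_sumr sum_scaled_idempotent_row eqxx mulrC.
by move/(mulfI cardR_neq0).
Qed.

(** The [F j] add up to N times the identity, so the entrywise product of [F i] with this sum is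
    [q i i ord0] times the same sum. Comparing the coefficients of [F k] gives the claim. It is what
    recovers the diagonal of the Krein matrix, which the array does not list. *)
Lemma sum_krein i k : \sum_j q i j k = q i i ord0.
Proof.
have eqF : \sum_l (\sum_j q i j l) *: F l = q i i ord0 *: \sum_l F l.
  apply/matrixP => x y; rewrite summxE.
  transitivity (\sum_j F i x y * F j x y).
    under [RHS]eq_bigr do rewrite scaled_idempotent_hadamard.
    rewrite exchange_big; apply: eq_bigr => l _.
    by rewrite !mxE -mulr_suml.
  rewrite -mulr_sumr -summxE [in RHS]mxE sum_scaled_idempotent [_%:M _ _]mxE.
  case: eqVneq => [<-|_]; last by rewrite !mulr0n !mulr0.
  by rewrite scaled_idempotent_diag.
(* Multiplication by [F k] isolates one coefficient, as the [F l] are orthogonal and [F k] is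
   nonzero. *)
have /(congr1 (fun A => A *m F k)) := eqF.
rewrite mulmx_suml scaler_sumr mulmx_suml.
have pick (a : 'I_D.+1 -> R) : \sum_l (a l *: F l) *m F k = (a k * N) *: F k.
  rewrite (bigD1 k) //= big1 => [|l ne_lk]; rewrite -scalemxAl scaled_idempotentM.
    by rewrite eqxx scalerA addr0.
  by rewrite (negPf ne_lk) scaler0.
rewrite (pick (fun l => _)) (pick (fun=> _)).
move/eqP; rewrite -subr_eq0 -scalerBl scaler_eq0 (negPf (scaled_idempotent_neq0 k)).
by rewrite orbF -mulrBl mulf_eq0 (negPf cardR_neq0) orbF subr_eq0 => /eqP.
Qed.

End BoseMesner.

(** * Eigenvectors of the Krein matrix *)

Section EigenRows.
Variables (R : fieldType) (m : nat).
Variables (Q : 'I_m -> 'I_m -> R) (k g : 'I_m -> R).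
Hypothesis Q_orthogonal : forall i j,
  \sum_r k r * (Q r i * Q r j) = if i == j then g i else 0.
Hypothesis g_neq0 : forall i, g i != 0.

(** The inverse matrix of Q, read off from orthogonality. For unscaled columns, [g i] is [|X|] times
    the multiplicity, and this is the first eigenmatrix P divided by [|X|]. *)
Definition eigen_inv i r := k r * Q r i / g i.

Let A := \matrix_(r, i) Q r i.
Let B := \matrix_(i, r) eigen_inv i r.

Let BA : B *m A = 1%:M.
Proof.
apply/matrixP => i j; rewrite !mxE.
under eq_bigr do rewrite !mxE /eigen_inv mulrAC -(mulrA (k _)).
rewrite -mulr_suml Q_orthogonal; case: eqP => _; last by rewrite mul0r.
by rewrite mulfV.
Qed.

Lemma mul_eigen_inv r s : \sum_i Q r i * eigen_inv i s = (r == s)%:R.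
Proof.
have /matrixP/(_ r s) := mulmx1C BA; rewrite !mxE => <-.
by apply: eq_bigr => i _; rewrite !mxE.
Qed.

Lemma eigen_inv_mul i j : \sum_r eigen_inv i r * Q r j = (i == j)%:R.
Proof.
have /matrixP/(_ i j) := BA; rewrite !mxE => <-.
by apply: eq_bigr => r _; rewrite !mxE.
Qed.

Lemma eigen_row_decomp (v : 'I_m -> R) j :
  v j = \sum_r (\sum_i v i * eigen_inv i r) * Q r j.
Proof.
under eq_bigr do rewrite mulr_suml.
rewrite exchange_big (bigD1 j) //= [X in _ + X]big1 => [|i ne_ij].
  under eq_bigr do rewrite -mulrA.
  by rewrite -mulr_sumr eigen_inv_mul eqxx mulr1 addr0.
under eq_bigr do rewrite -mulrA.
by rewrite -mulr_sumr eigen_inv_mul (negPf ne_ij) mulr0.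
Qed.

Variables (M : 'I_m -> 'I_m -> R) (one zero : 'I_m).
Hypothesis Q_eigen : forall r j, Q r one * Q r j = \sum_l M j l * Q r l.
Hypothesis Q_zero : forall r, Q r zero = 1.
Hypothesis Q_one_inj : injective (Q^~ one).

(* [v one] is an eigenvalue of [M], hence one of the [Q r one], and the
   coordinates of [v] on the other rows vanish. *)
Lemma eigen_row_ex (v : 'I_m -> R) :
  v zero = 1 -> (forall j, v one * v j = \sum_l M j l * v l) ->
  exists r, forall j, v j = Q r j.
Proof.
move=> v0 v_eigen; pose a r := \sum_i v i * eigen_inv i r.
have aP r : v one * a r = Q r one * a r.
  (* The hypothesis on the rows of Q says that [A] intertwines the transpose of [M] with the
     diagonal matrix of the [Q r one]. Conjugating by [B], the inverse of [A], makes the columns of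
     [B] eigenvectors. *)
  have MB l : \sum_j M j l * eigen_inv j r = Q r one * eigen_inv l r.
    have /matrixP/(_ l r) : (\matrix_(l, j) M j l) *m B =
        B *m \matrix_(r, s) (Q r one *+ (r == s)).
      have AM : (\matrix_(r, s) (Q r one *+ (r == s))) *m A =
          A *m \matrix_(l, j) M j l.
        apply/matrixP => s j; rewrite !mxE (bigD1 s) //= big1 => [|t ne_ts].
          by rewrite !mxE eqxx addr0 Q_eigen; apply: eq_bigr => i _;
            rewrite !mxE mulrC.
        by rewrite !mxE eq_sym (negPf ne_ts) mul0r.
      rewrite -[LHS]mul1mx -BA -mulmxA (mulmxA A) -AM -(mulmxA _ A).
      by rewrite (mulmx1C BA) mulmx1.
    rewrite !mxE [RHS](bigD1 r) //= [X in _ + X]big1 => [|t ne_tr]; last first.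
      by rewrite !mxE (negPf ne_tr) mulr0.
    rewrite !mxE eqxx addr0 mulrC => <-.
    by apply: eq_bigr => j _; rewrite !mxE.
  rewrite /a !mulr_sumr.
  under eq_bigr do rewrite mulrA v_eigen mulr_suml.
  rewrite exchange_big; apply: eq_bigr => l _ /=.
  by under eq_bigr do rewrite mulrAC; rewrite -mulr_suml MB mulrC mulrCA.
have [r ar0] : exists r, a r != 0.
  apply/existsP; apply: contraTT isT; rewrite negb_exists => /forallP a0.
  have := oner_neq0 R; rewrite -v0 (eigen_row_decomp v zero) big1 ?eqxx // => r _.
  by have /negPn/eqP := a0 r; rewrite /a => ->; rewrite mul0r.
have vr : v one = Q r one by apply: (mulIf ar0).
have v_ar j : v j = a r * Q r j.
  rewrite (eigen_row_decomp v j) (bigD1 r) //= [X in _ + X]big1 ?addr0 // => s ne_sr.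
  suff -> : \sum_i v i * eigen_inv i s = 0 by rewrite mul0r.
  apply/eqP; apply: contraNT ne_sr => as0; apply/eqP/Q_one_inj.
  by rewrite /= -vr; apply: (mulIf as0); rewrite aP.
(* Both [v] and the row r have entry 1 at [zero], so the factor [a r] is 1. *)
exists r => j; rewrite v_ar.
by have := v_ar zero; rewrite v0 Q_zero mulr1 => <-; rewrite mul1r.
Qed.

End EigenRows.

(** * Triple intersection numbers *)

Section IntersectionNumbers.
Variables (Y I : finType) (rho : Y -> Y -> I).

Definition valency x r := #|[set z | rho x z == r]|.
Definition pair_number x y r s := #|[set z | (rho x z == r) && (rho y z == s)]|.
Definition triple_number u v w r s t :=
  #|[set z | [&& rho u z == r, rho v z == s & rho w z == t]]|.

Lemma triple_number_sum1 u v w s t :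
  (\sum_r triple_number u v w r s t)%N = pair_number v w s t.
Proof.
rewrite /pair_number -sum1_card (partition_big (rho u) xpredT) //=.
by apply: eq_bigr => r _; rewrite /triple_number -sum1_card; apply: eq_bigl => z;
  rewrite !inE andbC.
Qed.

Lemma triple_number_sum2 u v w r t :
  (\sum_s triple_number u v w r s t)%N = pair_number u w r t.
Proof.
rewrite /pair_number -sum1_card (partition_big (rho v) xpredT) //=.
by apply: eq_bigr => s _; rewrite /triple_number -sum1_card; apply: eq_bigl => z;
  rewrite !inE andbAC andbA.
Qed.

Lemma triple_number_sum3 u v w r s :
  (\sum_t triple_number u v w r s t)%N = pair_number u v r s.
Proof.
rewrite /pair_number -sum1_card (partition_big (rho w) xpredT) //=.
by apply: eq_bigr => t _; rewrite /triple_number -sum1_card; apply: eq_bigl => z;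
  rewrite !inE andbA.
Qed.

Lemma sum_triple_number (V : zmodType) (f : I -> I -> I -> V) u v w :
  \sum_z f (rho u z) (rho v z) (rho w z) =
  \sum_r \sum_s \sum_t f r s t *+ triple_number u v w r s t.
Proof.
rewrite (partition_big (rho u) xpredT) //=; apply: eq_bigr => r _.
rewrite (partition_big (rho v) xpredT) //=; apply: eq_bigr => s _.
rewrite (partition_big (rho w) xpredT) //=; apply: eq_bigr => t _.
rewrite -sumr_const; apply: eq_big => [z|z]; first by rewrite inE andbA.
by case/andP=> /andP[/eqP-> /eqP->] /eqP->.
Qed.

End IntersectionNumbers.

(** * Intersection numbers and equations between triple intersection numbers *)

Section Counting.
Variables (R : realFieldType) (Y : finType) (m : nat) (rho : Y -> Y -> 'I_m).
Variables (Q : 'I_m -> 'I_m -> R) (k g sc : 'I_m -> R) (n : R) (zero : 'I_m).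
Hypothesis Q_orthogonal : forall i j,
  \sum_r k r * (Q r i * Q r j) = if i == j then g i else 0.
Hypothesis g_neq0 : forall i, g i != 0.
Hypothesis Q_zero : forall r, Q r zero = 1.
Hypothesis g_zero : g zero = n.
Hypothesis sc_zero : sc zero = 1.
Hypothesis rho_sym : forall x y, rho x y = rho y x.
Hypothesis Q_conv : forall x y i j,
  \sum_z Q (rho x z) i * Q (rho z y) j =
  if i == j then n * sc i * Q (rho x y) i else 0.

(** The indicator of a relation is a combination of the columns of Q with coefficients [eigen_inv].
    In the sum over z of a product of two indicators, [Q_conv] kills the mixed terms. The factor
    [n * sc i] arises because the scaled matrix [sc i * F i] has square [n * sc i] times itself. *)
Lemma pair_numberE x y r s : (pair_number rho x y r s)%:R =
  k r * k s * \sum_i n * sc i / g i ^+ 2 * (Q r i * Q s i * Q (rho x y) i).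
Proof.
have -> : (pair_number rho x y r s)%:R =
    \sum_z (rho x z == r)%:R * (rho z y == s)%:R :> R.
  rewrite /pair_number -sum1_card natr_sum big_mkcond /=.
  apply: eq_bigr => z _; rewrite inE (rho_sym y z).
  by do 2!case: (_ == _); rewrite ?mul0r ?mulr0 ?mulr1.
under eq_bigr => z _ do
  rewrite -!(mul_eigen_inv Q_orthogonal g_neq0) big_distrlr /=.
rewrite exchange_big mulr_sumr; apply: eq_bigr => i _ /=.
rewrite exchange_big (bigD1 i) //= [X in _ + X]big1 => [|j ne_ji].
  under eq_bigr do rewrite mulrACA.
  by rewrite -mulr_suml Q_conv eqxx addr0 /eigen_inv; field; rewrite g_neq0.
under eq_bigr do rewrite mulrACA.
by rewrite -mulr_suml Q_conv eq_sym (negPf ne_ji) mul0r.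
Qed.

Lemma sum_Q_row x i : \sum_z Q (rho x z) i = if i == zero then n else 0.
Proof.
have := Q_conv x x i zero; under eq_bigr do rewrite Q_zero mulr1.
by move=> ->; case: eqP => // ->; rewrite sc_zero Q_zero !mulr1.
Qed.

(** [k] enters as a mere weight that makes the columns of Q orthogonal. Summing the expanded
    indicator of r over z leaves only the column [zero], with row sum n, so the weight has to be the
    valency. The valencies supplied by a certificate are confirmed in this way. *)
Lemma valencyE x r : (valency rho x r)%:R = k r.
Proof.
have -> : (valency rho x r)%:R = \sum_z (rho x z == r)%:R :> R.
  rewrite /valency -sum1_card natr_sum big_mkcond /=.
  by apply: eq_bigr => z _; rewrite inE; case: eqP.
under eq_bigr do rewrite -(mul_eigen_inv Q_orthogonal g_neq0).
rewrite exchange_big (bigD1 zero) //= [X in _ + X]big1 => [|j ne_j0].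
  rewrite -mulr_suml sum_Q_row eqxx addr0 /eigen_inv Q_zero g_zero.
  by rewrite mulr1 mulrC divfK // -g_zero g_neq0.
by rewrite -mulr_suml sum_Q_row (negPf ne_j0) mul0r.
Qed.

Lemma sum_valency (f : 'I_m -> R) x : \sum_z f (rho x z) = \sum_r k r * f r.
Proof.
rewrite (partition_big (rho x) xpredT) //=; apply: eq_bigr => r _.
rewrite -(valencyE x) mulr_natl -sumr_const; apply: eq_big => [z|z /eqP-> //].
by rewrite inE.
Qed.

(* The sum of the squares over all [u], [v], [w] is, up to a factor, the sum of
   all entries of the entrywise product of three idempotents. *)
Lemma krein_vanishing i j l u v w :
  \sum_r k r * (Q r i * Q r j * Q r l) = 0 ->
  \sum_z Q (rho u z) i * Q (rho v z) j * Q (rho w z) l = 0.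
Proof.
move=> kreins0.
pose T u v w := \sum_z Q (rho u z) i * Q (rho v z) j * Q (rho w z) l.
have exch (f : Y -> Y -> Y -> R) : \sum_a \sum_z \sum_z' f a z z' =
    \sum_z \sum_z' \sum_a f a z z'.
  by rewrite exchange_big; apply: eq_bigr => z _; rewrite exchange_big.
have conv a z z' : \sum_u Q (rho u z) a * Q (rho u z') a =
    n * sc a * Q (rho z z') a.
  have := Q_conv z z' a a; rewrite eqxx => <-.
  by apply: eq_bigr => u' _; rewrite (rho_sym z).
have T0 : \sum_u \sum_v \sum_w T u v w ^+ 2 = 0.
  transitivity (\sum_z \sum_z' (n * sc i * Q (rho z z') i) *
     ((n * sc j * Q (rho z z') j) * (n * sc l * Q (rho z z') l))).
    under eq_bigr => u' _ do under eq_bigr => v' _ do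
      [under eq_bigr => w' _ do rewrite expr2 /T big_distrlr /=; rewrite exch].
    under eq_bigr => u' _ do rewrite exch.
    rewrite exch; apply: eq_bigr => z _; apply: eq_bigr => z' _.
    rewrite -!conv mulr_suml; apply: eq_bigr => u' _.
    rewrite big_distrlr mulr_sumr; apply: eq_bigr => v' _ /=.
    by rewrite mulr_sumr; apply: eq_bigr => w' _; ring.
  rewrite big1 // => z _.
  rewrite (sum_valency (fun r => n * sc i * Q r i *
    (n * sc j * Q r j * (n * sc l * Q r l)))).
  transitivity (n ^+ 3 * (sc i * sc j * sc l) *
    \sum_r k r * (Q r i * Q r j * Q r l)); last by rewrite kreins0 mulr0.
  by rewrite mulr_sumr; apply: eq_bigr => r _; ring.
have ge0 u' v' : 0 <= \sum_w' T u' v' w' ^+ 2 by apply: sumr_ge0 => w' _; exact: sqr_ge0.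
have ge0' u' : 0 <= \sum_v' \sum_w' T u' v' w' ^+ 2 by exact: sumr_ge0.
have /(_ u isT) := psumr_eq0P (fun u' _ => ge0' u') T0.
move=> /(psumr_eq0P (fun v' _ => ge0 u v'))/(_ v isT).
move=> /(psumr_eq0P (fun w' _ => sqr_ge0 (T u v w')))/(_ w isT)/eqP.
by rewrite sqrf_eq0 => /eqP.
Qed.

Variables (T : Type) (ti tj tl : T -> 'I_m) (mu : T -> R).

(** [L1], [L2], [L3] multiply the equations for the sums over one index, and [mu t] multiplies the
    equation of a vanishing Krein parameter, which contributes 0 to the right-hand side. The index
    type [T] is left abstract because the entries of a certificate carry natural numbers that are
    cast to ['I_m] only in the application. *)
Lemma triple_equation (L1 L2 L3 : 'I_m -> 'I_m -> R) (ts : seq T) u v w :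
  (forall t, List.In t ts ->
    \sum_r k r * (Q r (ti t) * Q r (tj t) * Q r (tl t)) = 0) ->
  \sum_a \sum_b \sum_c
    (L1 a b + L2 a c + L3 b c +
     \sum_(t <- ts) mu t * Q a (ti t) * Q b (tj t) * Q c (tl t)) *+
    triple_number rho u v w a b c =
  \sum_a \sum_b L1 a b *+ pair_number rho u v a b +
  \sum_a \sum_c L2 a c *+ pair_number rho u w a c +
  \sum_b \sum_c L3 b c *+ pair_number rho v w b c.
Proof.
move=> vanish; pose x := triple_number rho u v w.
have -> : \sum_a \sum_b L1 a b *+ pair_number rho u v a b =
    \sum_a \sum_b \sum_c L1 a b *+ x a b c.
  apply: eq_bigr => a _; apply: eq_bigr => b _.
  by rewrite -(triple_number_sum3 rho u v w) sumrMnr.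
have -> : \sum_a \sum_c L2 a c *+ pair_number rho u w a c =
    \sum_a \sum_b \sum_c L2 a c *+ x a b c.
  apply: eq_bigr => a _; rewrite exchange_big; apply: eq_bigr => c _.
  by rewrite -(triple_number_sum2 rho u v w) sumrMnr.
have -> : \sum_b \sum_c L3 b c *+ pair_number rho v w b c =
    \sum_a \sum_b \sum_c L3 b c *+ x a b c.
  rewrite [RHS]exchange_big; apply: eq_bigr => b _.
  rewrite [RHS]exchange_big; apply: eq_bigr => c _.
  by rewrite -(triple_number_sum1 rho u v w) sumrMnr.
have sum3D (f h : 'I_m -> 'I_m -> 'I_m -> R) :
    \sum_a \sum_b \sum_c (f a b c + h a b c) =
    \sum_a \sum_b \sum_c f a b c + \sum_a \sum_b \sum_c h a b c.
  by do 3![rewrite -big_split /=; apply: eq_bigr => ? _].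
under eq_bigr => a _ do under eq_bigr => b _ do under eq_bigr => c _ do
  rewrite !mulrnDl.
rewrite !sum3D -[RHS]addr0; congr (_ + _).
elim: ts vanish => [|t ts IHts] vanish.
  by rewrite !big1 // => a _; rewrite big1 // => b _; rewrite big1 // => c _;
    rewrite big_nil mul0rn.
under eq_bigr => a _ do under eq_bigr => b _ do under eq_bigr => c _ do
  rewrite big_cons mulrnDl.
rewrite sum3D IHts => [|t' t'in]; last by apply: vanish; right.
(* Grouping the points z by their relations to u, v, w turns the weighted sum of the [abc] back into
   the sum over z that [krein_vanishing] annihilates. *)
rewrite addr0 -(sum_triple_number rho (fun a b c =>
  mu t * Q a (ti t) * Q b (tj t) * Q c (tl t))).
transitivity (mu t * \sum_z Q (rho u z) (ti t) * Q (rho v z) (tj t) *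
  Q (rho w z) (tl t)).
  by rewrite mulr_sumr; apply: eq_bigr => z _; rewrite !mulrA.
by rewrite krein_vanishing ?mulr0 //; apply: vanish; left.
Qed.

End Counting.

(** * Integer and quadratic arithmetic *)

(** The default value 0 lets the tables of a certificate drop trailing zeros and whole trailing
    rows. *)
Definition nth2 (l : seq (seq Z)) i j : Z := nth Z0 (nth [::] l i) j.
Definition zsum (f : nat -> Z) m : Z :=
  foldr (fun i a => Z.add (f i) a) Z0 (iota 0 m).

(* The pair (x, y) stands for x + y sqrt d. *)
Definition qadd (x y : Z * Z) : Z * Z := (Z.add x.1 y.1, Z.add x.2 y.2).
Definition qmul d (x y : Z * Z) : Z * Z :=
  (Z.add (Z.mul x.1 y.1) (Z.mul d (Z.mul x.2 y.2)),
   Z.add (Z.mul x.1 y.2) (Z.mul x.2 y.1)).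
Definition qscale a (x : Z * Z) : Z * Z := (Z.mul a x.1, Z.mul a x.2).
Definition qsum (f : nat -> Z * Z) m : Z * Z :=
  foldr (fun i a => qadd (f i) a) (Z0, Z0) (iota 0 m).
Definition qis0 (x : Z * Z) := Z.eqb x.1 Z0 && Z.eqb x.2 Z0.

Lemma all_iotaP m (p : pred nat) i : all p (iota 0 m) -> (i < m)%N -> p i.
Proof. by move=> /allP ap lt_im; apply: ap; rewrite mem_iota. Qed.

Lemma nth_map_iota (T : Type) (x0 : T) (f : nat -> T) m i :
  (i < m)%N -> nth x0 [seq f j | j <- iota 0 m] i = f i.
Proof. by move=> lt_im; rewrite (nth_map 0%N) ?size_iota // nth_iota. Qed.

Lemma foldr_iota (V : nmodType) (f : nat -> V) m :
  foldr (fun i a => f i + a) 0 (iota 0 m) = \sum_(i < m) f i.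
Proof.
by rewrite -(big_mkord xpredT) /index_iota subn0 unlock.
Qed.

Section Zreal.
Variable R : realType.

Definition zr (x : Z) : R := (int_of_Z x)%:~R.

Lemma zrD x y : zr (Z.add x y) = zr x + zr y.
Proof. by rewrite /zr (rmorphD int_of_Z) rmorphD. Qed.
Lemma zrM x y : zr (Z.mul x y) = zr x * zr y.
Proof. by rewrite /zr (rmorphM int_of_Z) rmorphM. Qed.
Lemma zrN x : zr (Z.opp x) = - zr x.
Proof. by rewrite /zr (rmorphN int_of_Z) rmorphN. Qed.
Lemma zr0 : zr Z0 = 0. Proof. by []. Qed.
Lemma zr1 : zr (Zpos xH) = 1. Proof. by []. Qed.
Lemma zr_nat n : zr (Z.of_nat n) = n%:R.
Proof.
rewrite /zr -[n%:R]/((Posz n)%:~R); congr (_ %:~R).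
by apply: (can_inj Z_of_intK); rewrite int_of_ZK.
Qed.
Lemma zr_pos p : zr (Zpos p) = (Pos.to_nat p)%:R.
Proof. by []. Qed.
Lemma zr_inj : injective zr.
Proof. by move=> x y /intr_inj/(can_inj int_of_ZK). Qed.
Lemma zr_eq0 x : (zr x == 0) = Z.eqb x Z0.
Proof.
apply/eqP/Z.eqb_spec => [|->//]; rewrite -zr0; exact: zr_inj.
Qed.
Lemma zr_sum (f : nat -> Z) m : zr (zsum f m) = \sum_(i < m) zr (f i).
Proof.
rewrite /zsum -(foldr_iota (fun i => zr (f i))).
by elim: (iota 0 m) => //= i s <-; exact: zrD.
Qed.

Lemma of_QE x : of_Q R x = zr (Qnum x) / zr (Zpos (Qden x)).
Proof. by []. Qed.
Lemma zr_pos_neq0 p : zr (Zpos p) != 0.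
Proof. by rewrite zr_eq0. Qed.
Lemma of_QD x y : of_Q R (Qplus x y) = of_Q R x + of_Q R y.
Proof.
case: x y => [a b] [c d]; rewrite !of_QE /= Pos2Z.inj_mul !(zrD, zrM).
by field; rewrite !zr_pos_neq0.
Qed.
Lemma of_QM x y : of_Q R (Qmult x y) = of_Q R x * of_Q R y.
Proof.
case: x y => [a b] [c d]; rewrite !of_QE /= Pos2Z.inj_mul !zrM.
by field; rewrite !zr_pos_neq0.
Qed.
Lemma of_QN x : of_Q R (Qopp x) = - of_Q R x.
Proof. by case: x => a b; rewrite !of_QE /= zrN mulNr. Qed.
Lemma of_Q_eq x y : Qeq_bool x y -> of_Q R x = of_Q R y.
Proof.
move=> /Qeq_bool_iff; case: x y => [a b] [c d]; rewrite /Qeq /= !of_QE /=.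
move/(congr1 zr); rewrite !zrM => e; apply/eqP.
by rewrite eqr_div ?zr_pos_neq0 // e.
Qed.
Lemma of_QZ x : of_Q R (inject_Z x) = zr x.
Proof. by rewrite of_QE /= zr1 divr1. Qed.

Variable d : Z.
Hypothesis d_ge0 : Z.leb Z0 d.

Definition ev (x : Z * Z) : R := zr x.1 + zr x.2 * Num.sqrt (zr d).

Lemma zr_ge0 x : Z.leb Z0 x -> 0 <= zr x.
Proof.
by case: x => // p _; rewrite zr_pos ler0n.
Qed.
Lemma evD x y : ev (qadd x y) = ev x + ev y.
Proof. by rewrite /ev /= !zrD; ring. Qed.
Lemma evM x y : ev (qmul d x y) = ev x * ev y.
Proof.
rewrite /ev /= !zrD !zrM -{1}[zr d]sqr_sqrtr ?zr_ge0 //; ring.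
Qed.
Lemma ev_scale a x : ev (qscale a x) = zr a * ev x.
Proof. by rewrite /ev /= !zrM; ring. Qed.
Lemma ev_sum f m : ev (qsum f m) = \sum_(i < m) ev (f i).
Proof.
rewrite /qsum -(foldr_iota (fun i => ev (f i))); elim: (iota 0 m) => [|i s IHs] /=.
  by rewrite /ev /= zr0 mul0r addr0.
by rewrite evD IHs.
Qed.
Lemma ev_rat x : Z.eqb x.2 Z0 -> ev x = zr x.1.
Proof. by rewrite -zr_eq0 /ev => /eqP->; rewrite mul0r addr0. Qed.
Lemma ev_is0 x : qis0 x -> ev x = 0.
Proof. by move=> /andP[]; rewrite -zr_eq0 => /eqP x0 /ev_rat->. Qed.
(** The tested integer is the norm, the product of [ev x] with its conjugate. The factorisation
    holds for every nonnegative d, including the value 0 that stands for a rational Q. *)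
Lemma ev_neq0 x :
  ~~ Z.eqb (Z.sub (Z.mul x.1 x.1) (Z.mul d (Z.mul x.2 x.2))) Z0 -> ev x != 0.
Proof.
rewrite -zr_eq0 -Z.add_opp_r; apply: contraNneq => ex0.
suff -> : zr (Z.add (Z.mul x.1 x.1) (Z.opp (Z.mul d (Z.mul x.2 x.2)))) =
    ev x * (zr x.1 - zr x.2 * Num.sqrt (zr d)) by rewrite ex0 mul0r.
rewrite /ev zrD zrN !zrM -{1}[zr d]sqr_sqrtr ?zr_ge0 //; ring.
Qed.
End Zreal.

(** * Certificates *)

Definition fsum (T : Type) (F : T -> Z) (s : seq T) : Z :=
  foldr (fun g a => Z.add (F g) a) Z0 s.

Lemma all_In (T : Type) (p : pred T) s x : all p s -> List.In x s -> p x.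
Proof. by elim: s => //= y s IHs /andP[py ps] [<-//|/(IHs ps)]. Qed.

(** * Integer rounding of linear equations in nonnegative unknowns *)

Section Cuts.
Variables (J : finType) (x : J -> Z).
Hypothesis x_ge0 : forall j, Z.le Z0 (x j).

(* Chvatal-Gomory rounding: the right-hand side is nonnegative and congruent to
   [- beta] modulo [M]. *)
Lemma cut_bound (c : J -> Z) beta M : Z.lt Z0 M ->
  \sum_j c j * x j = beta ->
  Z.le (Z.modulo (Z.opp beta) M) (\sum_j Z.modulo (Z.opp (c j)) M * x j).
Proof.
move=> M_gt0 cx; set S := \sum_j _.
have S_ge0 : Z.le Z0 S.
  apply: (big_ind (fun s => Z.le Z0 s)) => // [s t|j _]; first by move=> ? ?; lia.
  by have := @x_ge0 j; have := Z.mod_pos_bound (Z.opp (c j)) M M_gt0; nia.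
pose t := \sum_j Z.div (Z.opp (c j)) M * x j.
have SE : Z.opp beta = Z.add S (Z.mul t M).
  rewrite -cx; transitivity (\sum_j (Z.opp (c j) * x j)).
    rewrite -[LHS]/(- \sum_j c j * x j) -sumrN.
    by apply: eq_bigr => j _; rewrite -mulNr.
  rewrite -[Z.add S _]/(S + t * M) mulr_suml -big_split; apply: eq_bigr => j _ /=.
  have {1}-> := Z.div_mod (Z.opp (c j)) M; last by lia.
  set u := Z.div _ _; set v := Z.modulo _ _.
  rewrite -[Z.add _ _]/(M * u + v); ring.
by rewrite SE Z.mod_add; [apply: Z.mod_le; lia | lia].
Qed.

Variables (G : Type) (wt md be : G -> Z) (c : G -> J -> Z).

Lemma cuts_bound (s : seq G) :
  (forall g, List.In g s -> [/\ Z.le Z0 (wt g), Z.lt Z0 (md g) &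
    \sum_j c g j * x j = be g]) ->
  Z.le (fsum (fun g => Z.mul (wt g) (Z.modulo (Z.opp (be g)) (md g))) s)
    (\sum_j fsum (fun g => Z.mul (wt g) (Z.modulo (Z.opp (c g j)) (md g))) s
            * x j).
Proof.
elim: s => [|g s IHs] sP /=; first by rewrite big1 // => j _; rewrite mul0r.
have [w0 M0 eqg] := sP g (or_introl erefl).
have /IHs {}IHs : forall h, List.In h s -> [/\ Z.le Z0 (wt h), Z.lt Z0 (md h) &
    \sum_j c h j * x j = be h] by move=> h hs; apply: sP; right.
have cutg := cut_bound M0 eqg.
set A := fsum _ s in IHs *; set B := \sum_j _ in cutg.
pose A' j := fsum (fun g => Z.mul (wt g) (Z.modulo (Z.opp (c g j)) (md g))) s.
have -> : \sum_j Z.add (Z.mul (wt g) (Z.modulo (Z.opp (c g j)) (md g))) (A' j) * x j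
   = Z.add (Z.mul (wt g) B) (\sum_j A' j * x j).
  rewrite -[RHS]/(wt g * B + _) mulr_sumr -big_split; apply: eq_bigr => j _ /=.
  by rewrite mulrA -mulrDl.
exact: Z.add_le_mono (Z.mul_le_mono_nonneg_l _ _ _ w0 cutg) IHs.
Qed.

(** The equation with coefficients [e] is subtracted from the sum of the cuts, and the coefficients
    that remain are majorised by [tgt]. The comparison is asked only where [x j] is nonzero, since
    the other terms vanish on both sides; this allows the checker to skip the triples that some zero
    intersection number excludes. *)
Lemma cuts_final (s : seq G) (e tgt : J -> Z) beta tau :
  (forall g, List.In g s -> [/\ Z.le Z0 (wt g), Z.lt Z0 (md g) &
    \sum_j c g j * x j = be g]) ->
  \sum_j e j * x j = beta ->
  (forall j, x j <> Z0 ->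
   Z.le (Z.sub (fsum (fun g => Z.mul (wt g) (Z.modulo (Z.opp (c g j)) (md g))) s)
               (e j)) (tgt j)) ->
  Z.le tau (Z.sub (fsum (fun g =>
      Z.mul (wt g) (Z.modulo (Z.opp (be g)) (md g))) s) beta) ->
  Z.le tau (\sum_j tgt j * x j).
Proof.
move=> /cuts_bound cutP <- le_tgt le_tau.
set A := fsum _ s in cutP le_tau; set B := \sum_j _ in cutP.
apply: Z.le_trans le_tau _; apply: Z.le_trans (_ : Z.le _ (Z.sub B (\sum_j e j * x j))) _.
  by lia.
rewrite -Z.add_opp_r -[Z.add _ _]/(B - \sum_j e j * x j) -sumrB.
apply: (big_ind2 (fun a b => Z.le a b)) => // [a a' b b'|j _].
  by rewrite -[a + b]/(Z.add a b) -[a' + b']/(Z.add a' b'); lia.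
rewrite -mulrBl; have [->|xj] := Z.eq_dec (x j) Z0; first by rewrite !mulr0.
have := le_tgt j xj; have := @x_ge0 j; rewrite -Z.add_opp_r.
exact: Z.mul_le_mono_nonneg_r.
Qed.
End Cuts.

(* The entry (r, j) of the eigenmatrix Q (the value of |X| E_j on the relation
   r) is [(re + im sqrt disc) / scale_j], where an empty [sd_im] stands for the
   zero matrix.  With g_j the Gram number [gram j j], [sd_h] and [sd_den] hold
   the fractions [h_j / den = card * scale_j / g_j^2] that occur in the
   intersection numbers. *)
Record scheme_data := SchemeData {
  sd_disc : Z;
  sd_card : Z;
  sd_scale : seq positive;
  sd_re : seq (seq Z);
  sd_im : seq (seq Z);
  sd_valency : seq Z;
  sd_h : seq Z;
  sd_den : Z }.

(* Multipliers of the equations between the triple intersection numbers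
   [rst]: [lam1], [lam2], [lam3] for the sums over t, s, r respectively, and
   an entry (i, j, l, mu) of [cb_mu] for the vanishing of q_{ij}^l. *)
Record combination := Comb {
  cb_lam1 : seq (seq Z);
  cb_lam2 : seq (seq Z);
  cb_lam3 : seq (seq Z);
  cb_mu : seq (nat * nat * nat * (Z * Z)) }.

(* A cut (w, M, c) is the equation [c] rounded modulo [M] and taken [w] times;
   subtracting [bd_final] from the sum of the cuts must leave
   [bd_tau <= bd_coef * [r0 s0 t0]]. *)
Record bound := Bound {
  bd_cuts : seq (Z * Z * combination);
  bd_final : combination;
  bd_coef : Z;
  bd_tau : Z }.

(** * The executable test of a bound *)

Section Checker.
Variables (S : scheme_data) (m : nat).
Local Notation d := (sd_disc S).

Definition sd_q r i : Z * Z := (nth2 (sd_re S) r i, nth2 (sd_im S) r i).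
Definition sd_sc i : positive := nth xH (sd_scale S) i.
Definition sd_k r : Z := nth Z0 (sd_valency S) r.

Definition gram i j : Z * Z :=
  qsum (fun r => qscale (sd_k r) (qmul d (sd_q r i) (sd_q r j))) m.

(** Up to nonzero factors this is the Krein parameter [q_{ij}^l]: expanding the product of the
    columns i and j leaves, by orthogonality, only the term of the column l. *)
Definition krein_sum i j l : Z * Z :=
  qsum (fun r => qscale (sd_k r)
    (qmul d (qmul d (sd_q r i) (sd_q r j)) (sd_q r l))) m.

(** The classical formula [k_r k_s / |X|] times the sum over i of [Q_{ri} Q_{si} Q_{Ai} / m_i^2],
    with [m_i] the multiplicity, for scaled columns and multiplied by the common denominator
    [sd_den]. *)
Definition intersection_pair A r s : Z * Z :=
  qscale (Z.mul (sd_k r) (sd_k s)) (qsum (fun i => qscale (nth Z0 (sd_h S) i)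
    (qmul d (qmul d (sd_q r i) (sd_q s i)) (sd_q A i))) m).

Definition intersection_pairs A : seq (seq (Z * Z)) :=
  [seq [seq intersection_pair A r s | s <- iota 0 m] | r <- iota 0 m].

Definition rational_table (T : seq (seq (Z * Z))) : bool :=
  all (all (fun p => Z.eqb p.2 Z0)) T.

(** No divisibility is tested here. In a scheme the entry is [sd_den] times a cardinality, so the
    division is exact there. *)
Definition table_numbers (T : seq (seq (Z * Z))) : seq (seq Z) :=
  [seq [seq Z.div p.1 (sd_den S) | p <- row] | row <- T].

(** The coefficient of [rst] in a combination, as an element of the quadratic field. The multipliers
    of the sum equations are integers; only those of the vanishing Krein parameters can be
    irrational. *)
Definition comb_form (cb : combination) r s t : Z * Z :=
  qadd (Z.add (Z.add (nth2 (cb_lam1 cb) r s) (nth2 (cb_lam2 cb) r t))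
              (nth2 (cb_lam3 cb) s t), Z0)
    (foldr (fun e a => qadd
       (qmul d (qmul d (qmul d e.2 (sd_q r e.1.1.1)) (sd_q s e.1.1.2))
               (sd_q t e.1.2)) a) (Z0, Z0) (cb_mu cb)).

(** The tests on the size of the indices make the later casts by [inord] faithful. *)
Definition comb_krein (cb : combination) : bool :=
  all (fun e => [&& (e.1.1.1 < m)%N, (e.1.1.2 < m)%N, (e.1.2 < m)%N &
    qis0 (krein_sum e.1.1.1 e.1.1.2 e.1.2)]) (cb_mu cb).

Definition table_pairing (l N : seq (seq Z)) : Z :=
  zsum (fun a => zsum (fun b => Z.mul (nth2 l a b) (nth2 N a b)) m) m.

Definition comb_rhs (cb : combination) (N1 N2 N3 : seq (seq Z)) : Z :=
  Z.add (Z.add (table_pairing (cb_lam1 cb) N1) (table_pairing (cb_lam2 cb) N2))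
        (table_pairing (cb_lam3 cb) N3).

Definition bound_target (bd : bound) r0 s0 t0 r s t : Z :=
  if [&& eqn r r0, eqn s s0 & eqn t t0] then bd_coef bd else Z0.

(** Coefficients are inspected only at triples whose three intersection numbers are positive, for
    [rst] is 0 elsewhere. There the irrational parts must vanish, because rounding modulo M makes
    sense for integer coefficients only. *)
Definition check_bound A B C r0 s0 t0 (bd : bound) : bool :=
  let T1 := intersection_pairs A in
  let T2 := intersection_pairs B in
  let T3 := intersection_pairs C in
  let N1 := table_numbers T1 in
  let N2 := table_numbers T2 in
  let N3 := table_numbers T3 in
  [&& rational_table T1, rational_table T2, rational_table T3,
      all (fun g => [&& Z.leb Z0 g.1.1, Z.ltb Z0 g.1.2 & comb_krein g.2])
        (bd_cuts bd),
      comb_krein (bd_final bd),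
      all (fun r => all (fun s => all (fun t =>
        if [&& Z.ltb Z0 (nth2 N1 r s), Z.ltb Z0 (nth2 N2 r t) &
               Z.ltb Z0 (nth2 N3 s t)]
        then
          let fs := [seq (g.1, comb_form g.2 r s t) | g <- bd_cuts bd] in
          let f := comb_form (bd_final bd) r s t in
          [&& all (fun p => Z.eqb p.2.2 Z0) fs, Z.eqb f.2 Z0 &
              Z.leb (Z.sub (fsum (fun p =>
                Z.mul p.1.1 (Z.modulo (Z.opp p.2.1) p.1.2)) fs) f.1)
                (bound_target bd r0 s0 t0 r s t)]
        else true) (iota 0 m)) (iota 0 m)) (iota 0 m) &
      Z.leb (bd_tau bd)
        (Z.sub (fsum (fun g => Z.mul g.1.1
            (Z.modulo (Z.opp (comb_rhs g.2 N1 N2 N3)) g.1.2)) (bd_cuts bd))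
          (comb_rhs (bd_final bd) N1 N2 N3))].

End Checker.

Arguments comb_form : simpl never.
Arguments zsum : simpl never.
Arguments qsum : simpl never.

(** * Soundness of the test of a bound *)

Section BoundSound.
Variables (R : realType) (S : scheme_data) (D : nat).
Variables (Y : finType) (rho : Y -> Y -> 'I_D.+1).
Local Notation m := D.+1.
Local Notation d := (sd_disc S).
Local Notation zr := (zr R).
Local Notation ev := (ev R d).

(** These are the hypotheses on Q of the counting section, in integers: the column 0 is constant 1,
    the Gram matrix for the valencies is diagonal with nonzero rational diagonal, and its first
    entry is the number of points. The last test ties [sd_h] and [sd_den] to the fractions in the
    intersection numbers. *)
Definition check_gram : bool :=
  [&& Z.leb Z0 d,
      all (fun r => Z.eqb (sd_q S r 0).1 1 && Z.eqb (sd_q S r 0).2 0) (iota 0 m),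
      Z.eqb (Zpos (sd_sc S 0)) 1,
      all (fun i => all (fun j => let p := gram S m i j in
        Z.eqb p.2 0 && (if eqn i j then ~~ Z.eqb p.1 0 else Z.eqb p.1 0))
        (iota 0 m)) (iota 0 m),
      Z.eqb (gram S m 0 0).1 (sd_card S),
      ~~ Z.eqb (sd_den S) 0 &
      all (fun i => let gi := (gram S m i i).1 in
        Z.eqb (Z.mul (nth Z0 (sd_h S) i) (Z.mul gi gi))
          (Z.mul (sd_den S) (Z.mul (sd_card S) (Zpos (sd_sc S i)))))
        (iota 0 m)].

Definition q_real (r i : 'I_m) : R := ev (sd_q S r i).
Definition k_real (r : 'I_m) : R := zr (sd_k S r).
Definition g_real (i : 'I_m) : R := zr (gram S m i i).1.
Definition sc_real (i : 'I_m) : R := zr (Zpos (sd_sc S i)).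
Local Notation n_real := (zr (sd_card S)).

Hypothesis gramP : check_gram.

Lemma check_disc : Z.leb Z0 d. Proof. by case/and5P: gramP. Qed.

Lemma q_real0 r : q_real r ord0 = 1.
Proof.
case/and5P: gramP => _ /all_iotaP/(_ (ltn_ord r))/andP[/Z.eqb_spec q1 q2] _ _ _.
by rewrite /q_real ev_rat // q1 zr1.
Qed.

Lemma sc_real0 : sc_real ord0 = 1.
Proof. by case/and5P: gramP => _ _ /Z.eqb_spec; rewrite /sc_real => ->. Qed.

Lemma sum_gram (i j : 'I_m) :
  \sum_r k_real r * (q_real r i * q_real r j) = ev (gram S m i j).
Proof.
rewrite /gram ev_sum; apply: eq_bigr => r _.
by rewrite ev_scale evM ?check_disc.
Qed.

Lemma q_real_orthogonal i j :
  \sum_r k_real r * (q_real r i * q_real r j) = if i == j then g_real i else 0.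
Proof.
rewrite sum_gram; case/and5P: gramP => _ _ _.
move=> /all_iotaP/(_ (ltn_ord i))/all_iotaP/(_ (ltn_ord j))/=/andP[g2 g1] _.
rewrite ev_rat //; move: g1; rewrite -[eqn i j]/(i == j).
by case: eqP => [<-|_] //; rewrite -(zr_eq0 R) => /eqP.
Qed.

Lemma g_real_neq0 i : g_real i != 0.
Proof.
case/and5P: gramP => _ _ _.
move=> /all_iotaP/(_ (ltn_ord i))/all_iotaP/(_ (ltn_ord i))/=/andP[_ g1] _.
by move: g1; rewrite -[eqn i i]/(i == i :> nat) eqxx -(zr_eq0 R).
Qed.

Lemma g_real0 : g_real ord0 = n_real.
Proof.
by case/and5P: gramP => _ _ _ _ /and3P[/Z.eqb_spec]; rewrite /g_real => ->.
Qed.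

Lemma den_neq0 : zr (sd_den S) != 0.
Proof. by case/and5P: gramP => _ _ _ _ /and3P[_]; rewrite zr_eq0. Qed.

Lemma h_realE i : zr (sd_den S) * (n_real * sc_real i / g_real i ^+ 2) =
  zr (nth Z0 (sd_h S) i).
Proof.
case/and5P: gramP => _ _ _ _ /and3P[_ _] /all_iotaP/(_ (ltn_ord i))/=.
move=> /Z.eqb_spec/(congr1 zr); rewrite !zrM -/(g_real i) -/(sc_real i) => e.
by rewrite mulrA -e; field; rewrite g_real_neq0.
Qed.

Hypothesis rho_sym : forall x y, rho x y = rho y x.
Hypothesis q_real_conv : forall x y i j,
  \sum_z q_real (rho x z) i * q_real (rho z y) j =
  if i == j then n_real * sc_real i * q_real (rho x y) i else 0.

(** [pair_numberE], multiplied by [sd_den], becomes an equation in the quadratic field. As the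
    irrational part of the left-hand side is 0, it is an equation between integers, and it exhibits
    the dividend as a multiple of [sd_den]. *)
Lemma intersection_numberP A x y (r s : 'I_m) : rho x y = A ->
  rational_table (intersection_pairs S m A) ->
  nth2 (table_numbers S (intersection_pairs S m A)) r s =
  Z.of_nat (pair_number rho x y r s).
Proof.
move=> <- rat; rewrite /nth2 /table_numbers /intersection_pairs.
rewrite (nth_map [::]) ?size_map ?size_iota // nth_map_iota //.
rewrite (nth_map (Z0, Z0)) ?size_map ?size_iota // nth_map_iota //.
have {}rat : Z.eqb (intersection_pair S m (rho x y) r s).2 Z0.
  move: rat; rewrite /rational_table /intersection_pairs.
  move=> /(all_nthP [::])/(_ r); rewrite size_map size_iota => /(_ (ltn_ord r)).
  rewrite nth_map_iota // => /(all_nthP (Z0, Z0))/(_ s).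
  by rewrite size_map size_iota nth_map_iota // => /(_ (ltn_ord s)).
suff -> : (intersection_pair S m (rho x y) r s).1 =
    Z.mul (Z.of_nat (pair_number rho x y r s)) (sd_den S).
  by rewrite Z.div_mul // => den0; have := den_neq0; rewrite den0 eqxx.
apply: (@zr_inj R); rewrite -(ev_rat R d) // zrM zr_nat.
rewrite (pair_numberE q_real_orthogonal g_real_neq0 rho_sym q_real_conv).
rewrite /intersection_pair ev_scale ev_sum zrM -/(k_real r) -/(k_real s).
rewrite -[RHS]mulrA; congr (_ * _); rewrite mulr_suml; apply: eq_bigr => i _.
rewrite ev_scale !evM ?check_disc // -h_realE /q_real; ring.
Qed.

Section Triple.
Variables (u v w : Y).
Let T1 := intersection_pairs S m (rho u v).
Let T2 := intersection_pairs S m (rho u w).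
Let T3 := intersection_pairs S m (rho v w).
Let N1 := table_numbers S T1.
Let N2 := table_numbers S T2.
Let N3 := table_numbers S T3.
Hypothesis rat1 : rational_table T1.
Hypothesis rat2 : rational_table T2.
Hypothesis rat3 : rational_table T3.

Let x (p : 'I_m * 'I_m * 'I_m) : Z :=
  Z.of_nat (triple_number rho u v w p.1.1 p.1.2 p.2).

(** [rst] is one of the nonnegative terms of each of three sums that equal intersection numbers. *)
Lemma triple_support (r s t : 'I_m) : x (r, s, t) <> Z0 ->
  [&& Z.ltb Z0 (nth2 N1 r s), Z.ltb Z0 (nth2 N2 r t) & Z.ltb Z0 (nth2 N3 s t)].
Proof.
move=> x0; rewrite (intersection_numberP _ _ erefl rat1).
rewrite (intersection_numberP _ _ erefl rat2).
rewrite (intersection_numberP _ _ erefl rat3).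
have := triple_number_sum1 rho u v w s t; rewrite (bigD1 r) //=.
have := triple_number_sum2 rho u v w r t; rewrite (bigD1 s) //=.
have := triple_number_sum3 rho u v w r s; rewrite (bigD1 t) //=.
by move: x0; rewrite /x /=; lia.
Qed.

(** [triple_equation] holds over R with coefficients in the quadratic field. Wherever [rst] is
    nonzero the irrational part of its coefficient is 0, so dropping that part everywhere leaves the
    sum unchanged, and the equation descends to Z. *)
Lemma comb_equation cb : comb_krein S m cb ->
  (forall r s t : 'I_m, x (r, s, t) <> Z0 -> Z.eqb (comb_form S cb r s t).2 Z0) ->
  \sum_(p : 'I_m * 'I_m * 'I_m) (comb_form S cb p.1.1 p.1.2 p.2).1 * x p =
  comb_rhs m cb N1 N2 N3.
Proof.
move=> kreinP rat; apply: (@zr_inj R).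
pose nt (e : nat * nat * nat * (Z * Z)) := (ev e.2).
pose ti (e : nat * nat * nat * (Z * Z)) : 'I_m := inord e.1.1.1.
pose tj (e : nat * nat * nat * (Z * Z)) : 'I_m := inord e.1.1.2.
pose tl (e : nat * nat * nat * (Z * Z)) : 'I_m := inord e.1.2.
pose L l (a b : 'I_m) := zr (nth2 l a b).
have := @triple_equation _ _ _ rho q_real k_real g_real sc_real n_real ord0
  q_real_orthogonal g_real_neq0 q_real0 g_real0 sc_real0 rho_sym q_real_conv
  _ ti tj tl nt (L (cb_lam1 cb)) (L (cb_lam2 cb)) (L (cb_lam3 cb)) (cb_mu cb) u v w.
have vanish e : List.In e (cb_mu cb) ->
    \sum_r k_real r * (q_real r (ti e) * q_real r (tj e) * q_real r (tl e)) = 0.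
  move=> /(all_In kreinP)/and4P[ei ej el /(ev_is0 R d)].
  rewrite /krein_sum ev_sum => e0; rewrite -[RHS]e0; apply: eq_bigr => r _.
  by rewrite ev_scale !evM ?check_disc // /q_real !inordK.
move=> /(_ vanish) eqR.
have pairing l N y z :
    (forall a b : 'I_m, nth2 N a b = Z.of_nat (pair_number rho y z a b)) ->
    zr (table_pairing m l N) =
    \sum_a \sum_b L l a b *+ pair_number rho y z a b.
  move=> NE; rewrite /table_pairing zr_sum; apply: eq_bigr => a _; rewrite zr_sum.
  by apply: eq_bigr => b _; rewrite NE zrM zr_nat mulr_natr.
rewrite /comb_rhs 2!zrD (pairing _ _ u v) => [|a b]; last exact: intersection_numberP.
rewrite (pairing _ _ u w) => [|a b]; last exact: intersection_numberP.
rewrite (pairing _ _ v w) => [|a b]; last exact: intersection_numberP.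
rewrite -eqR.
have -> (F : 'I_m * 'I_m * 'I_m -> Z) : zr (\sum_p F p) = \sum_p zr (F p).
  by apply: (big_morph zr) => // a b; exact: zrD.
rewrite pair_bigA pair_bigA; apply: eq_bigr => -[[r s] t] _.
rewrite -[(r, s, t).1.1]/r -[(r, s, t).1.2]/s -[(r, s, t).2]/t.
have zrM' (a b : Z) : zr (a * b) = zr a * zr b by exact: zrM.
rewrite zrM' zr_nat mulr_natr.
have [x0|xn0] := Z.eq_dec (x (r, s, t)) Z0.
  by have -> : triple_number rho u v w r s t = 0%N by move: x0; rewrite /x /=; lia.
rewrite -(ev_rat R d) ?rat // /comb_form evD; congr (_ *+ _); congr (_ + _).
  by rewrite ev_rat // !zrD.
move: kreinP; rewrite /comb_krein; elim: (cb_mu cb) => [_|e mu IHmu] /=.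
  by rewrite big_nil ev_is0.
move=> /andP[/and4P[ei ej el _] /IHmu {}IHmu].
by rewrite big_cons evD !evM ?check_disc // IHmu /q_real /ti /tj /tl !inordK.
Qed.

End Triple.

Lemma check_bound_sound u v w bd (a b c : 'I_m) :
  check_bound S m (rho u v) (rho u w) (rho v w) a b c bd ->
  Z.le (bd_tau bd)
    (Z.mul (bd_coef bd) (Z.of_nat (triple_number rho u v w a b c))).
Proof.
case/and5P=> rat1 rat2 rat3 cutsP /and3P[finP /all_iotaP allP tauP].
pose x (p : 'I_m * 'I_m * 'I_m) : Z :=
  Z.of_nat (triple_number rho u v w p.1.1 p.1.2 p.2).
have suppP (r s t : 'I_m) : x (r, s, t) <> Z0 ->
  [/\ forall g, List.In g (bd_cuts bd) -> Z.eqb (comb_form S g.2 r s t).2 Z0,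
      Z.eqb (comb_form S (bd_final bd) r s t).2 Z0 &
      Z.le (Z.sub (fsum (fun g => Z.mul g.1.1 (Z.modulo (Z.opp
           (comb_form S g.2 r s t).1) g.1.2)) (bd_cuts bd))
        (comb_form S (bd_final bd) r s t).1) (bound_target bd a b c r s t)].
  move=> /(triple_support rat1 rat2 rat3) supp.
  have /all_iotaP/(_ (ltn_ord s))/all_iotaP/(_ (ltn_ord t)) := allP r (ltn_ord r).
  rewrite supp /= => /and3P[allf f0 lef]; split=> //.
    by move=> g gin; move: allf; rewrite all_map => allm; apply: (all_In allm gin).
  move/Z.leb_spec0: lef; rewrite /fsum foldr_map; exact.
have -> : Z.mul (bd_coef bd) (Z.of_nat (triple_number rho u v w a b c)) =
    \sum_(p : 'I_m * 'I_m * 'I_m) bound_target bd a b c p.1.1 p.1.2 p.2 * x p.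
  rewrite (bigD1 (a, b, c)) //= big1 => [|[[r s] t] ne]; last first.
    rewrite /bound_target /= -[eqn r a]/(r == a) -[eqn s b]/(s == b).
    rewrite -[eqn t c]/(t == c); case: ifP => [/and3P[/eqP ra /eqP sb /eqP tc]|].
      by move: ne; rewrite ra sb tc eqxx.
    by rewrite mul0r.
  have eqnn (i : nat) : eqn i i by exact: eqxx.
  by rewrite addr0 /bound_target /= !eqnn.
apply: (@cuts_final _ x _ _ (fun g => g.1.1) (fun g => g.1.2)
  (fun g => comb_rhs m g.2 (table_numbers S (intersection_pairs S m (rho u v)))
     (table_numbers S (intersection_pairs S m (rho u w)))
     (table_numbers S (intersection_pairs S m (rho v w))))
  (fun g (p : 'I_m * 'I_m * 'I_m) => (comb_form S g.2 p.1.1 p.1.2 p.2).1) (bd_cuts bd)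
  (fun p : 'I_m * 'I_m * 'I_m => (comb_form S (bd_final bd) p.1.1 p.1.2 p.2).1)).
- by move=> p; rewrite /x; lia.
- move=> g gin; have /and3P[/Z.leb_spec0 ? /Z.ltb_spec0 ? kg] := all_In cutsP gin.
  by split=> //; apply: comb_equation => // r s t /suppP[/(_ _ gin)].
- by apply: comb_equation => // r s t /suppP[].
- by move=> [[r s] t] /suppP[].
- exact/Z.leb_spec0.
Qed.

End BoundSound.

(** * Counting arguments *)

(** Every edge is counted once from each end. The order by [enum_rank] selects one of the two
    orientations, and the sum over the selected ones is half of the total; irreflexivity disposes of
    the case of equal ends. *)
Lemma handshake (Y : finType) (P : pred Y) (e : rel Y) :
  symmetric e -> irreflexive e ->
  ~~ odd (\sum_(y | P y) \sum_(z | P z) e y z)%N.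
Proof.
move=> e_sym e_irr.
pose F y z : nat := [&& P y, P z & e y z].
pose h y z : nat := (F y z * (enum_rank y < enum_rank z))%N.
have -> : (\sum_(y | P y) \sum_(z | P z) e y z = \sum_y \sum_z F y z)%N.
  rewrite big_mkcond; apply: eq_bigr => y _; rewrite /F.
  case: (P y) => /=; last by rewrite big1.
  by rewrite big_mkcond; apply: eq_bigr => z _; case: (P z).
have -> : (\sum_y \sum_z F y z = \sum_y \sum_z h y z + \sum_y \sum_z h y z)%N.
  rewrite [X in (_ + X)%N]exchange_big -big_split /=; apply: eq_bigr => y _.
  rewrite -big_split /=; apply: eq_bigr => z _; rewrite /h.
  have -> : F z y = F y z by rewrite /F e_sym andbCA.
  case: (ltngtP (enum_rank y) (enum_rank z)) => [_|_|].
  - by rewrite muln1 muln0 addn0.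
  - by rewrite muln1 muln0.
  - by move=> /val_inj/enum_rank_inj ->; rewrite /F e_irr !andbF.
by rewrite addnn odd_double.
Qed.

Section Arguments.
Variables (Y : finType) (I : finType) (rho : Y -> Y -> I).
Hypothesis rho_sym : forall x y, rho x y = rho y x.

Lemma triple_numberE u v y r s t : triple_number rho u v y r s t =
  (\sum_(z | (rho u z == r) && (rho v z == s)) (rho y z == t))%N.
Proof.
rewrite /triple_number -sum1_card big_mkcond [RHS]big_mkcond /=.
apply: eq_bigr => z _; rewrite inE.
by case: (rho u z == r); case: (rho v z == s); case: (rho y z == t).
Qed.

(** Both sides count the pairs in relation t between the points in relations r, s to u, v and those
    in relations r', s' to u, v; the order of summation decides which end is the third point of the
    triple. *)
Lemma sum_triple_swap u v r s r' s' t :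
  (\sum_(y | (rho u y == r) && (rho v y == s)) triple_number rho u v y r' s' t =
   \sum_(w | (rho u w == r') && (rho v w == s')) triple_number rho u v w r s t)%N.
Proof.
under eq_bigr do rewrite triple_numberE; rewrite exchange_big /=.
apply: eq_bigr => w _; rewrite triple_numberE; apply: eq_bigr => y _.
by rewrite rho_sym.
Qed.

Lemma sum_triple_handshake u v r s t : (forall x, rho x x != t) ->
  ~~ odd (\sum_(y | (rho u y == r) && (rho v y == s))
            triple_number rho u v y r s t)%N.
Proof.
move=> t_irr.
under eq_bigr do rewrite triple_numberE.
apply: (handshake _ (e := fun y z => rho y z == t)) => [y z|y].
  by rewrite rho_sym.
exact/negbTE.
Qed.
End Arguments.

(* The letters A, B, C and r, s, t are relations.  [ByTriple] refutes the
   triples with mutual relations A, B, C.  The other two arguments fix a pair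
   (u, v) in A and consider the graph of the relation t between the points in
   relation r to u and s to v and those in relation r' and s', resp. among the
   former: the bounds on the degrees contradict the two counts of its edges,
   resp. force an odd number of vertices of odd degree [deg]. *)
Inductive argument :=
  | ByTriple (A B C : nat) (bd : bound)
  | ByDoubleCounting (A r s r' s' t : nat) (bd bd' : bound)
  | ByHandshake (A r s t : nat) (deg : Z) (bd bd' : bound).

Definition pnumber (S : scheme_data) m A r s : Z :=
  nth2 (table_numbers S (intersection_pairs S m A)) r s.

(** A positive valency and, for [ByTriple], a positive intersection number provide the points. For
    [ByTriple] the coefficient of the target is 0, so the bound would say that a positive [bd_tau]
    is at most 0. For [ByDoubleCounting] let e be the number of edges: summed over the vertices the
    two bounds become upper bounds by [bd_coef bd] times e and by [bd_coef bd'] times e,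
    coefficients of opposite sign, and the weights [- bd_coef bd'] and [bd_coef bd] eliminate e. For
    [ByHandshake] the bounds place the degree strictly between [deg - 1] and [deg + 1], and [0 < t]
    makes the relation t irreflexive. *)
Definition check_argument (S : scheme_data) m (a : argument) : bool :=
  match a with
  | ByTriple A B C bd =>
      [&& (A < m)%N, (B < m)%N, (C < m)%N, Z.ltb Z0 (sd_k S A) &
      [&& Z.ltb Z0 (pnumber S m A B C), check_bound S m A B C 0 0 0 bd,
          Z.eqb (bd_coef bd) 0 & Z.ltb 0 (bd_tau bd)]]
  | ByDoubleCounting A r s r' s' t bd bd' =>
      [&& (A < m)%N, [&& (r < m)%N, (s < m)%N, (r' < m)%N & (s' < m)%N],
          (t < m)%N, Z.ltb Z0 (sd_k S A) &
      [&& check_bound S m A r s r' s' t bd, check_bound S m A r' s' r s t bd',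
          Z.leb 0 (bd_coef bd), Z.leb (bd_coef bd') 0 &
          Z.ltb 0 (Z.add
            (Z.mul (Z.opp (bd_coef bd')) (Z.mul (bd_tau bd) (pnumber S m A r s)))
            (Z.mul (bd_coef bd) (Z.mul (bd_tau bd') (pnumber S m A r' s'))))]]
  | ByHandshake A r s t deg bd bd' =>
      [&& (A < m)%N, (r < m)%N, (s < m)%N, (0 < t < m)%N &
      [&& Z.ltb Z0 (sd_k S A),
          check_bound S m A r s r s t bd, check_bound S m A r s r s t bd',
          Z.ltb (Z.mul (bd_coef bd) (Z.sub deg 1)) (bd_tau bd) &
      [&& Z.leb 0 deg, Z.ltb (Z.mul (bd_coef bd') (Z.add deg 1)) (bd_tau bd'),
          Z.ltb 0 (bd_coef bd), Z.ltb (bd_coef bd') 0 &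
          Z.odd (Z.mul (pnumber S m A r s) deg)]]]
  end.

(** * Soundness of the three kinds of argument *)

Section ArgumentSound.
Variables (R : realType) (S : scheme_data) (D : nat).
Variables (Y : finType) (rho : Y -> Y -> 'I_D.+1) (y0 : Y).
Local Notation m := D.+1.
Hypothesis gramP : check_gram S D.
Hypothesis rho_sym : forall x y, rho x y = rho y x.
Hypothesis rho_diag : forall x, rho x x = ord0.
Hypothesis q_real_conv : forall x y i j,
  \sum_z q_real R S (rho x z) i * q_real R S (rho z y) j =
  if i == j then zr R (sd_card S) * sc_real R S i * q_real R S (rho x y) i else 0.

Lemma valency_ex (A : 'I_m) : Z.ltb Z0 (sd_k S A) -> exists v, rho y0 v = A.
Proof.
have := valencyE (q_real_orthogonal R gramP) (g_real_neq0 R gramP)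
  (q_real0 R gramP) (g_real0 R gramP) (sc_real0 R gramP) q_real_conv y0 A.
rewrite /k_real -(zr_nat R) => /zr_inj => <- k_gt0.
have /card_gt0P[v] : (0 < #|[set z | rho y0 z == A]|)%N.
  by rewrite -/(valency rho y0 A); move: k_gt0; lia.
by rewrite inE => /eqP; exists v.
Qed.

Lemma pnumberE x y (r s : 'I_m) :
  rational_table (intersection_pairs S m (rho x y)) ->
  pnumber S m (rho x y) r s = Z.of_nat (pair_number rho x y r s).
Proof. exact: (intersection_numberP gramP rho_sym q_real_conv). Qed.

Let bound_sound := check_bound_sound gramP rho_sym q_real_conv.

Lemma sum_bound (P : pred Y) (F : Y -> nat) cf tau :
  (forall y, P y -> Z.le tau (Z.mul cf (Z.of_nat (F y)))) ->
  Z.le (Z.mul tau (Z.of_nat #|P|)) (Z.mul cf (Z.of_nat (\sum_(y | P y) F y)%N)).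
Proof.
move=> PF; rewrite -sum1_card.
have -> : (\sum_(y in P) 1 = \sum_(y | P y) 1)%N by apply: eq_bigl.
apply: (big_ind2 (fun a b => Z.le (Z.mul tau (Z.of_nat a)) (Z.mul cf (Z.of_nat b))))
  => [|a b a' b'|y /PF]; lia.
Qed.

Lemma pair_number_card u v r s :
  #|[pred y | (rho u y == r) && (rho v y == s)]| = pair_number rho u v r s.
Proof. by apply: eq_card => y; rewrite !inE. Qed.

Lemma check_argument_sound a : check_argument S m a -> False.
Proof.
case: a => [A B C bd|A r s r' s' t bd bd'|A r s t deg bd bd'].
- case/and5P=> ltA ltB ltC kA /and4P[pABC bdP /Z.eqb_spec coef0 /Z.ltb_spec0 tau0].
  have [v rA] := valency_ex (A := Ordinal ltA) kA.
  have rat : rational_table (intersection_pairs S m (rho y0 v)).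
    by rewrite rA; case/and3P: bdP.
  have := pnumberE (Ordinal ltB) (Ordinal ltC) rat; rewrite rA /= => pE.
  have /card_gt0P[w] : (0 < #|[set z | (rho y0 z == Ordinal ltB) &&
      (rho v z == Ordinal ltC)]|)%N.
    by rewrite -/(pair_number rho y0 v (Ordinal ltB) (Ordinal ltC)); move: pABC; lia.
  rewrite inE => /andP[/eqP rB /eqP rC].
  have := @bound_sound y0 v w bd ord0 ord0 ord0.
  by rewrite rA rB rC coef0 => /(_ bdP); lia.
- case/and5P=> ltA /and4P[ltr lts ltr' lts'] ltt kA.
  case/and5P=> bdP bdP' /Z.leb_spec0 c0 /Z.leb_spec0 c0' /Z.ltb_spec0 pos.
  have [v rA] := valency_ex (A := Ordinal ltA) kA.
  have rat : rational_table (intersection_pairs S m (rho y0 v)).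
    by rewrite rA; case/and3P: bdP.
  have := pnumberE (Ordinal ltr) (Ordinal lts) rat; rewrite rA /= => pE.
  have := pnumberE (Ordinal ltr') (Ordinal lts') rat; rewrite rA /= => pE'.
  have b1 y : (rho y0 y == Ordinal ltr) && (rho v y == Ordinal lts) ->
      Z.le (bd_tau bd) (Z.mul (bd_coef bd) (Z.of_nat (triple_number rho y0 v y
        (Ordinal ltr') (Ordinal lts') (Ordinal ltt)))).
    by move=> /andP[/eqP r1 /eqP r2]; apply: bound_sound; rewrite rA r1 r2.
  have b2 y : (rho y0 y == Ordinal ltr') && (rho v y == Ordinal lts') ->
      Z.le (bd_tau bd') (Z.mul (bd_coef bd') (Z.of_nat (triple_number rho y0 v y
        (Ordinal ltr) (Ordinal lts) (Ordinal ltt)))).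
    by move=> /andP[/eqP r1 /eqP r2]; apply: bound_sound; rewrite rA r1 r2.
  have := sum_bound b1; have := sum_bound b2.
  rewrite (sum_triple_swap rho_sym) !pair_number_card -pE -pE'.
  move: pos; move: (Z.mul (bd_tau bd) _) (Z.mul (bd_tau bd') _) (Z.of_nat _).
  move=> e e' T pos b2T b1T.
  have := Z.mul_le_mono_nonneg_l _ _ _ c0 b2T.
  have c0'' : Z.le 0 (Z.opp (bd_coef bd')) by lia.
  have := Z.mul_le_mono_nonneg_l _ _ _ c0'' b1T.
  rewrite [X in Z.le _ X]Z.mul_opp_l Z.mul_shuffle3; clear -pos; lia.
- case/and5P=> ltA ltr lts /andP[t0 ltt] /and5P[kA bdP bdP' /Z.ltb_spec0 lo].
  case/and5P=> /Z.leb_spec0 deg0 /Z.ltb_spec0 hi /Z.ltb_spec0 c0 /Z.ltb_spec0 c0' odd_deg.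
  have [v rA] := valency_ex (A := Ordinal ltA) kA.
  have rat : rational_table (intersection_pairs S m (rho y0 v)).
    by rewrite rA; case/and3P: bdP.
  have := pnumberE (Ordinal ltr) (Ordinal lts) rat; rewrite rA /= => pE.
  have t_irr x : rho x x != Ordinal ltt.
    by rewrite rho_diag -val_eqE /= eq_sym -lt0n.
  have := sum_triple_handshake rho_sym y0 v (Ordinal ltr) (Ordinal lts) t_irr.
  have degE y : (rho y0 y == Ordinal ltr) && (rho v y == Ordinal lts) ->
     triple_number rho y0 v y (Ordinal ltr) (Ordinal lts) (Ordinal ltt) =
       Z.to_nat deg.
    move=> /andP[/eqP r1 /eqP r2].
    have := @bound_sound y0 v y bd (Ordinal ltr) (Ordinal lts) (Ordinal ltt).
    have := @bound_sound y0 v y bd' (Ordinal ltr) (Ordinal lts) (Ordinal ltt).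
    rewrite rA r1 r2 => /(_ bdP') b2 /(_ bdP) b1; move: lo hi b1 b2; nia.
  rewrite (eq_bigr _ degE) sum_nat_const pair_number_card.
  have Zodd n : Z.odd (Z.of_nat n) = odd n.
    by elim: n => // n IHn; rewrite Nat2Z.inj_succ Z.odd_succ -Z.negb_odd IHn.
  rewrite -Zodd Nat2Z.inj_mul Z2Nat.id // -pE.
  by rewrite odd_deg.
Qed.
End ArgumentSound.

(** * From the Krein array to the eigenmatrix *)

Definition Q0 : Q := Qmake Z0 xH.
Definition Qsum (f : nat -> Q) m : Q :=
  foldr (fun i a => Qplus (f i) a) Q0 (iota 0 m).

(* The entry q_{1j}^l of the Krein matrix of the array (b, c). *)
Definition krein_entry (b c : seq Q) j l : Q :=
  if eqn j l then
    Qminus (Qminus (nth Q0 b 0) (nth Q0 b j))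
      (if j is j'.+1 then nth Q0 c j' else Q0)
  else if eqn j l.+1 then nth Q0 b l
  else if eqn l j.+1 then nth Q0 c j else Q0.

Section Spectrum.
Variables (b c : seq Q) (S : scheme_data).
Local Notation m := (size b).+1.
Local Notation d := (sd_disc S).

(** The Krein matrix conjugated by the diagonal matrix of the scales and multiplied by the scale of
    column 1: the structure constants for the matrices [sc j * F j]. *)
Definition scaled_entry j l : Q :=
  Qmult (krein_entry b c j l)
    (Qmake (Zpos (Pos.mul (sd_sc S 1) (sd_sc S j))) (sd_sc S l)).

(** The eigenvector equation is compared separately in its rational and irrational components. The
    eigenvalues are distinct because the norms of their differences are nonzero. Row 0 belongs to
    the diagonal: its eigenvalue is [b_0], scaled, and its entries divided by the scales are the
    multiplicities, which add up to the number of points. *)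
Definition check_spectrum : bool :=
  let M := [seq [seq scaled_entry j l | l <- iota 0 m] | j <- iota 0 m] in
  [&& (0 < size b)%N, check_gram S (size b),
      all (fun r => all (fun j =>
        let p := qmul d (sd_q S r 1) (sd_q S r j) in
        let row := nth [::] M j in
        Qeq_bool (inject_Z p.1)
          (Qsum (fun l => Qmult (nth Q0 row l) (inject_Z (sd_q S r l).1)) m) &&
        Qeq_bool (inject_Z p.2)
          (Qsum (fun l => Qmult (nth Q0 row l) (inject_Z (sd_q S r l).2)) m))
        (iota 0 m)) (iota 0 m),
      all (fun r => all (fun s => eqn r s ||
        (let x := Z.sub (sd_q S r 1).1 (sd_q S s 1).1 in
         let y := Z.sub (sd_q S r 1).2 (sd_q S s 1).2 in
         ~~ Z.eqb (Z.sub (Z.mul x x) (Z.mul d (Z.mul y y))) Z0))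
        (iota 0 m)) (iota 0 m) &
      [&& Qeq_bool (inject_Z (sd_q S 0 1).1)
            (Qmult (inject_Z (Zpos (sd_sc S 1))) (nth Q0 b 0)),
          all (fun j => Z.eqb (sd_q S 0 j).2 Z0) (iota 0 m) &
          Qeq_bool (inject_Z (sd_card S))
            (Qsum (fun j => Qmake (sd_q S 0 j).1 (sd_sc S j)) m)]].

Variable R : realType.

Lemma of_Q_sum f k : of_Q R (Qsum f k) = \sum_(i < k) of_Q R (f i).
Proof.
rewrite /Qsum -(foldr_iota (fun i => of_Q R (f i))).
elim: (iota 0 k) => [|i s IHs] /=; first by rewrite of_QE mul0r.
by rewrite of_QD IHs.
Qed.

Hypothesis spectrumP : check_spectrum.

Lemma spectrum_gram : check_gram S (size b).
Proof. by case/and5P: spectrumP. Qed.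

Let d_ge0 := check_disc spectrum_gram.
Let one : 'I_m := inord 1.
Let oneE : one = 1%N :> nat.
Proof. by case/and5P: spectrumP => b0 *; rewrite inordK. Qed.

Lemma spectrum_eigen (r j : 'I_m) :
  q_real R S r one * q_real R S r j =
  \sum_(l < m) of_Q R (scaled_entry j l) * q_real R S r l.
Proof.
case/and5P: spectrumP => _ _ /all_iotaP/(_ (ltn_ord r))/all_iotaP/(_ (ltn_ord j)).
move=> /andP[/(of_Q_eq R) e1 /(of_Q_eq R) e2] _ _.
rewrite /q_real oneE -evM // /ev; move: e1 e2; rewrite !of_QZ !of_Q_sum => -> ->.
rewrite mulr_suml -big_split; apply: eq_bigr => l _.
rewrite (nth_map_iota [::]) // nth_map_iota // !of_QM !of_QZ /=; ring.
Qed.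

Lemma spectrum_inj : injective (fun r => q_real R S r one).
Proof.
move=> r s; rewrite /q_real oneE => /eqP ers; apply/eqP; apply: contraTT ers => ne_rs.
case/and5P: spectrumP => _ _ _ /all_iotaP/(_ (ltn_ord r))/all_iotaP/(_ (ltn_ord s)).
rewrite -[eqn r s]/(r == s) (negPf ne_rs) /= => nrm _.
rewrite -subr_eq0; have := @ev_neq0 R d d_ge0 (_, _) nrm.
congr (_ != 0); rewrite /ev /= -!Z.add_opp_r !zrD !zrN; ring.
Qed.

Lemma spectrum_theta0 : q_real R S ord0 one = sc_real R S one * of_Q R (nth Q0 b 0).
Proof.
case/and5P: spectrumP => b0 _ _ _ /and3P[/(of_Q_eq R) e1 im0 _].
rewrite /q_real ev_rat; last by apply: (all_iotaP im0).
by move: e1; rewrite of_QZ of_QM of_QZ oneE => ->; rewrite /sc_real oneE.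
Qed.

Lemma spectrum_card :
  zr R (sd_card S) = \sum_(j < m) q_real R S ord0 j / sc_real R S j.
Proof.
case/and5P: spectrumP => b0 _ _ _ /and3P[_ im0 /(of_Q_eq R)].
rewrite of_QZ of_Q_sum => ->; apply: eq_bigr => j _.
by rewrite /q_real ev_rat //; apply: (all_iotaP im0).
Qed.

End Spectrum.

(** * The relation function of a scheme with the given Krein array *)

Section Model.
Variables (R : realType) (X : finType) (b c : seq Q) (S : scheme_data).
Local Notation D := (size b).
Variables (Rel : 'I_D.+1 -> {set X * X}).
Variables (E : 'I_D.+1 -> 'M[R]_#|X|) (q : 'I_D.+1 -> 'I_D.+1 -> 'I_D.+1 -> R).
Hypothesis schemeP : association_scheme R Rel.
Hypothesis E_ordering : idempotent_ordering Rel E.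
Hypothesis kreinP : krein_parameters E q.
Hypothesis polyP : Q_polynomial q.
Hypothesis arrayP : krein_array q = (map (@of_Q R) b, map (@of_Q R) c).
Hypothesis spectrumP : check_spectrum b c S.
Local Notation one := (inord 1 : 'I_D.+1).
Local Notation F := (scaled_idempotent E).
Local Notation sc := (sc_real R S).

Lemma of_Q0 : of_Q R Q0 = 0. Proof. by rewrite of_QE mul0r. Qed.

Lemma krein_b i : (i < D)%N -> q one (inord i.+1) (inord i) = of_Q R (nth Q0 b i).
Proof.
move=> lt_iD; have [/(congr1 (fun s => nth 0 s i)) e _] := arrayP.
by move: e; rewrite nth_map_iota // (nth_map Q0).
Qed.

Lemma krein_c i : (i < D)%N -> q one (inord i) (inord i.+1) = of_Q R (nth Q0 c i).
Proof.
move=> lt_iD; have [_ ec] := arrayP.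
have sz_c : size c = D by have := congr1 size ec; rewrite !size_map size_iota.
move/(congr1 (fun s => nth 0 s i)): ec.
by rewrite (nth_map 0%N) ?size_iota // nth_iota // (nth_map Q0) ?sz_c // add1n.
Qed.

Lemma krein_b0 : q one one ord0 = of_Q R (nth Q0 b 0).
Proof.
have D0 : (0 < D)%N by case/and5P: spectrumP.
by rewrite -krein_b //; congr (q _ _ _); apply: val_inj; rewrite /= inordK.
Qed.

(** Off the diagonal the entry is read from the array or vanishes by tridiagonality. The diagonal
    entry is what the other two possible entries with the same upper index l leave of [b_0], by
    [sum_krein]. *)
Lemma krein_entryE (j l : 'I_D.+1) : q one j l = of_Q R (krein_entry b c j l).
Proof.
have off (j' l' : 'I_D.+1) : j' != l' ->
    q one j' l' = of_Q R (krein_entry b c j' l').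
  move=> ne_jl; rewrite /krein_entry -[eqn j' l']/(j' == l') (negPf ne_jl).
  case: ifP => [/eqP jE|/eqP nj].
    rewrite -krein_b; last by rewrite -ltnS -jE.
    by rewrite -jE !inord_val.
  case: ifP => [/eqP lE|/eqP nl].
    rewrite -krein_c; last by rewrite -ltnS -lE.
    by rewrite -lE !inord_val.
  rewrite of_Q0; have [-> //] := polyP l' j'.
  by move: ne_jl; rewrite -val_eqE /=; lia.
have [jl|] := eqVneq j l; last exact: off.
rewrite jl {j jl}; have := sum_krein schemeP E_ordering kreinP one l.
rewrite krein_b0 (bigD1 l) //= => /(canRL (addrK _)) ->.
rewrite /krein_entry -[eqn l l]/(l == l) eqxx /Qminus !of_QD !of_QN -addrA.
congr (_ + _); rewrite -opprD; congr (- _).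
have bP : of_Q R (nth Q0 b l) =
    \sum_(i : 'I_D.+1 | i == l.+1 :> nat) q one i l.
  have [lt_lD|ge_lD] := ltnP l D.
    rewrite (big_pred1 (inord l.+1)) => [|i].
      by rewrite -krein_b // inord_val.
    by rewrite /= -val_eqE /= inordK.
  (* For l = D the default value 0 plays the role of [b_D], and there is no index l+1. *)
  rewrite nth_default // of_Q0 big_pred0 // => i.
  by apply/negbTE; have := ltn_ord i; lia.
have cP : of_Q R (if nat_of_ord l is l'.+1 then nth Q0 c l' else Q0) =
    \sum_(i : 'I_D.+1 | i.+1 == l :> nat) q one i l.
  case: l {bP} => -[|l'] lt_l /=; first by rewrite of_Q0 big_pred0.
  rewrite (big_pred1 (inord l')) => [|i].
    by rewrite -krein_c //; congr (q _ _ _); apply: val_inj; rewrite /= inordK.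
  by rewrite /= -val_eqE /= inordK ?eqSS // ltnW.
rewrite bP cP (bigID (fun i : 'I_D.+1 => i == l.+1 :> nat)) /=; congr (_ + _).
  by apply: eq_bigl => i; rewrite -val_eqE /=; lia.
rewrite (bigID (fun i : 'I_D.+1 => i.+1 == l :> nat)) /= addrC big1 ?add0r.
  by apply: eq_bigl => i; rewrite -val_eqE /=; lia.
move=> i; rewrite -val_eqE /= => ne; have [-> //] := polyP l i.
by move: ne; lia.
Qed.

Lemma sc_neq0 (i : 'I_D.+1) : sc i != 0. Proof. by rewrite /sc_real zr_pos_neq0. Qed.

(** Evaluated at (x, y), the expansion of the entrywise products of [F one] with the [F j] says that
    the vector of the [sc j * F j x y] is an eigenvector whose eigenvalue is its own entry at [one];
    its entry at [ord0] is 1. The boolean quantifier makes the row available to [xchoose]. *)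
Lemma scheme_relation_ex (x y : 'I_#|X|) : exists r : 'I_D.+1,
  [forall j, sc j * F j x y == q_real R S r j].
Proof.
have gramP := spectrum_gram spectrumP.
suff [r rP] : exists r, forall j, sc j * F j x y = q_real R S r j.
  by exists r; apply/forallP => j; apply/eqP.
apply: (eigen_row_ex (q_real_orthogonal R gramP) (g_real_neq0 R gramP)
  (spectrum_eigen R spectrumP) (q_real0 R gramP) (spectrum_inj spectrumP)
  (v := fun j => sc j * F j x y)).
  by rewrite (sc_real0 R gramP) mul1r (scaled_idempotent0 schemeP E_ordering).
move=> j; rewrite mulrACA (scaled_idempotent_hadamard schemeP kreinP) mulr_sumr.
have one1 : one = 1%N :> nat by rewrite inordK //; case/and5P: spectrumP.
have scE (l : 'I_D.+1) : of_Q R (Qmake (Zpos (Pos.mul (sd_sc S 1) (sd_sc S j)))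
    (sd_sc S l)) = sc one * sc j / sc l.
  rewrite of_QE -[Qnum _]/(Z.mul (Zpos (sd_sc S 1)) (Zpos (sd_sc S j))) zrM.
  by rewrite /sc_real one1.
apply: eq_bigr => l _; rewrite krein_entryE of_QM scE; field.
exact: sc_neq0.
Qed.

Definition scheme_relation x y := xchoose (scheme_relation_ex x y).
Local Notation rho := scheme_relation.

Lemma scheme_relationE x y j : q_real R S (rho x y) j = sc j * F j x y.
Proof. by have /forallP/(_ j)/eqP-> := xchooseP (scheme_relation_ex x y). Qed.

Lemma scheme_relation_inj r x y :
  q_real R S r one = sc one * F one x y -> rho x y = r.
Proof. by rewrite -scheme_relationE => /(spectrum_inj spectrumP). Qed.

Lemma scheme_relation_sym x y : rho x y = rho y x.
Proof.
apply: scheme_relation_inj; rewrite scheme_relationE.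
by rewrite (scaled_idempotent_sym schemeP E_ordering).
Qed.

(** The value of [F one] on the diagonal is [q_{11}^0 = b_0], the unscaled eigenvalue of row 0. *)
Lemma scheme_relation_diag x : rho x x = ord0.
Proof.
apply: scheme_relation_inj; rewrite (spectrum_theta0 R spectrumP).
by rewrite (scaled_idempotent_diag schemeP E_ordering kreinP) krein_b0.
Qed.

(** A diagonal entry of the sum of all [F j] is [|X|], while row 0 of Q expresses it by the entries
    of the certificate. *)
Lemma scheme_card (x : 'I_#|X|) : zr R (sd_card S) = #|X|%:R.
Proof.
rewrite (spectrum_card R spectrumP) -(scheme_relation_diag x).
under eq_bigr do rewrite scheme_relationE mulrAC mulfV ?sc_neq0 // mul1r.
have := sum_scaled_idempotent schemeP E_ordering.
by move=> /matrixP/(_ x x); rewrite summxE => ->; rewrite mxE eqxx.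
Qed.

Lemma scheme_relation_conv x y i j :
  \sum_z q_real R S (rho x z) i * q_real R S (rho z y) j =
  if i == j then zr R (sd_card S) * sc i * q_real R S (rho x y) i else 0.
Proof.
under eq_bigr do rewrite !scheme_relationE mulrACA.
rewrite -mulr_sumr (sum_scaled_idempotent_mul schemeP E_ordering).
case: eqP => [<-|_]; last by rewrite mulr0.
by rewrite scheme_relationE (scheme_card x); ring.
Qed.

Lemma check_argument_scheme a : check_argument S D.+1 a -> False.
Proof.
have y0 : 'I_#|X| by exact: Ordinal (card_scheme_gt0 schemeP).
exact: (check_argument_sound y0 (spectrum_gram spectrumP) scheme_relation_sym
  scheme_relation_diag scheme_relation_conv).
Qed.

End Model.

Definition check_certificate (bc : seq Q * seq Q)
    (cert : scheme_data * argument) : bool :=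
  check_spectrum bc.1 bc.2 cert.1 &&
  check_argument cert.1 (size bc.1).+1 cert.2.

Lemma check_certificate_sound (R : realType) (X : finType) (D : nat)
    (Rel : 'I_D.+1 -> {set X * X}) b c cert :
  check_certificate (b, c) cert ->
  ~ Q_polynomial_scheme_with_array Rel (map (@of_Q R) b, map (@of_Q R) c).
Proof.
case/andP=> spectrumP argP [schemeP [E [q [ordP kreinP polyP arrayP]]]].
have sz_b : size b = D.
  by case: arrayP => /(congr1 size); rewrite !size_map size_iota.
(* The first half of the Krein array has D entries. Replacing D by [size b] makes the index types of
   the scheme and of the checker coincide. *)
case: _ / sz_b Rel schemeP E q ordP kreinP polyP arrayP => Rel schemeP E q.
move=> ordP kreinP polyP arrayP.
exact: (check_argument_scheme schemeP ordP kreinP polyP arrayP spectrumP argP).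
Qed.

(** * The certificates of the excluded arrays *)

(** A single cut with [no_comb] subtracted and target 0 is a divisibility argument: the test then
    says that the modulus divides all coefficients at possible triples but not the right-hand side.
    At the other extreme, an empty list of cuts with target 0 is a Farkas certificate: the final
    combination has nonnegative coefficients there and a negative right-hand side. *)
Definition no_comb := Comb [::] [::] [::] [::].
Definition Mu (i j l : nat) (x y : Z) := (i, j, l, (x, y)).

Local Open Scope Z_scope.

Definition certificates_three : seq (scheme_data * argument) := [::
  (SchemeData 0 91 [:: 1; 5; 4; 20]%positive
   [:: [:: 1; 60; 260; 260]; [:: 1; 21; 0; -104]; [:: 1; 8; -26; 78]; [:: 1; -18; 13; -13]]
   [::]
   [:: 1; 20; 30; 40]
   [:: 12168000; 676; 45; 9] 1107288000,
   ByTriple 3 3 3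
   (Bound [:: (3, 1076530, Comb [:: [:: 0; 0; 0; 866710]; [:: 0; 762580; 173290; 892970]; [:: 0;
    328640; 251420; 1025180]; [:: 1055340; 843050; 370370; 258570]] [:: [::]; [:: 0; 630825;
    547950]; [:: 0; 259870; 375570]; [:: 305370; 854750; 1024530]] [:: [::]; [:: 0; 960765;
    1030900]; [:: 0; 285610; 655720]] [:: Mu 1 1 3 190 0; Mu 1 3 1 183 0; Mu 3 1 1 17 0]); (3,
    1076530, Comb [:: [:: 0; 0; 0; 304330]; [:: 0; 179725; 636480; 995800]; [:: 0; 868270; 293280;
    931450]; [:: 47060; 652860; 486850; 937430]] [:: [::]; [:: 0; 575770; 526110]; [:: 0; 56940;
    365560]; [:: 677560; 521690; 789750]] [:: [::]; [:: 0; 617695; 829790]; [:: 0; 498550;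
    218010]] [:: Mu 1 1 3 15 0; Mu 1 3 1 22 0; Mu 3 1 1 3 0]); (7, 307580, Comb [:: [:: 0; 0; 0;
    213460]; [:: 0; 177905; 238160; 290420]; [:: 0; 77740; 260520; 72800]; [:: 219180; 195000;
    279760; 156260]] [:: [::]; [:: 0; 195065; 255320]; [:: 0; 4940; 187720]; [:: 62920; 38740;
    123500]] [:: [::]; [:: 0; 158015; 30420]; [:: 0; 30420; 209560]] [:: Mu 1 1 3 (-123) 0; Mu 1 3
    1 (-123) 0; Mu 3 1 1 (-9) 0]); (1, 1076530, Comb [:: [:: 0; 0; 0; 140790]; [:: 0; 1058785;
    477880; 500890]; [:: 0; 195130; 61230; 552370]; [:: 1054170; 321490; 856830; 450580]]
    [:: [::]; [:: 0; 647985; 998920]; [:: 0; 753610; 564590]; [:: 743990; 870220; 453050]]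
    [:: [::]; [:: 0; 704730; 446160]; [:: 0; 659100; 628680]] [:: Mu 1 1 3 85 0; Mu 1 3 1 87 0; Mu
    3 1 1 8 0])] (Comb [:: [:: 0; 0; 0; 1825200]; [:: 0; 1060605; 3900; -561600]; [:: 0; -440700;
    -320320; 510120]; [:: 1123200; -175500; 276120; 2005640]] [:: [::]; [:: 0; 1532115; 620100];
    [:: 0; -985140; -809640]; [:: -1022840; -2103920; -1776320]] [:: [::]; [:: 0; 2799485;
    1838720]; [:: 0; 1625780; 1304680]] [:: Mu 1 1 3 (-7) 0; Mu 1 3 1 (-9) 0; Mu 3 1 1 (-19) 0]) 0
    1));
  (SchemeData 33 225 [:: 1; 22; 1; 22]%positive
   [:: [:: 1; 528; 176; 528]; [:: 1; 33; -4; 33]; [:: 1; 33; -4; 33]; [:: 1; -132; 11; -132]]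
   [:: [:: 0; 0; 0; 0]; [:: 0; 15; 0; -15]; [:: 0; -15; 0; 15]; [:: 0; 0; 0; 0]]
   [:: 1; 88; 88; 48]
   [:: 6133248; 1; 198; 1] 1379980800,
   ByHandshake 3 3 3 1 1
   (Bound [:: (1, 323433000, Comb [:: [:: 0; 0; 0; 283758552]; [:: 0; 188884872; 20699712;
    119885832]; [:: 0; 89698752; 309633192; 171635112]; [:: 283758552; 89698752; 309633192;
    171635112]] [:: [::]; [:: 0; 224246880; 68999040]; [:: 0; 137998080; 241496640];
    [:: 112123440; 137998080; 241496640]] [:: [::]; [:: 0; 150935400; 215622000]; [:: 0;
    150935400; 150935400]] [:: Mu 1 1 3 (-33) (-7); Mu 1 3 1 0 (-4); Mu 3 1 3 0 4; Mu 3 3 1 (-33)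
    7])] (Comb [:: [::]; [:: 0; 8624880; 8624880; 73311480]; [:: 0; -8624880; -8624880; 34499520]]
    [:: [::]; [:: 0; -73311480; -56061720]; [:: 0; -51749280; -34499520]; [:: 0; -73311480;
    -34499520]] [:: [::]; [:: 0; 64686600; 43124400]; [:: 0; 64686600; 43124400]] [:: Mu 1 1 3 0
    1; Mu 1 3 3 0 1; Mu 3 1 1 0 (-1); Mu 3 3 1 0 (-1)]) 107811000 107811000)
   (Bound [:: (1, 323433000, Comb [:: [:: 0; 0; 0; 12074832]; [:: 0; 115573392; 12074832;
    68136552]; [:: 0; 7762392; 227696832; 68136552]; [:: 12074832; 76761432; 167322672;
    158697792]] [:: [::]; [:: 0; 86248800; 228559320]; [:: 0; 237184200; 185434920];
    [:: 176810040; 215622000; 34499520]] [:: [::]; [:: 0; 21562200; 21562200]; [:: 0; 86248800;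
    215622000]] [:: Mu 1 1 3 (-594) (-119); Mu 1 3 1 33 (-62); Mu 1 3 3 33 6; Mu 3 1 1 33 (-6); Mu
    3 1 3 33 62; Mu 3 3 1 (-594) 119])] (Comb [:: [::]; [:: 0; -8624880; -8624880; 34499520];
    [:: 0; 8624880; 8624880; 73311480]; [:: 0; 0; 0; 107811000]] [:: [::]; [:: 0; -34499520;
    -51749280]; [:: 0; -56061720; -73311480]; [:: -107811000; -34499520; -73311480]] [:: [::];
    [:: 0; 43124400; 64686600]; [:: 0; 43124400; 64686600]] [:: Mu 1 1 3 0 (-1); Mu 1 3 3 0 (-1);
    Mu 3 1 1 0 1; Mu 3 3 1 0 1]) (-107811000) (-107811000)));
  (SchemeData 0 324 [:: 1; 1; 1; 1]%positive
   [:: [:: 1; 17; 136; 170]; [:: 1; 5; 4; -10]; [:: 1; -1; -8; 8]; [:: 1; -7; 16; -10]]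
   [::]
   [:: 1; 102; 170; 51]
   [:: 462400; 1600; 25; 16] 149817600,
   ByTriple 1 1 2
   (Bound [:: (1, 1296, Comb [:: [:: 0; 35]; [:: 935; 275; 1241; 911]; [:: 0; 1241; 11; 77];
    [:: 0; 911; 77; 539]] [:: [::]; [:: 756; 1260]; [:: 0; 1044]; [:: 0; 828]] [:: [::]; [:: 0;
    432]; [:: 0; 216]] [:: Mu 1 1 1 3 0; Mu 1 1 3 (-1) 0])] no_comb 0 1));
  (SchemeData 0 324 [:: 1; 1; 1; 1]%positive
   [:: [:: 1; 19; 152; 152]; [:: 1; 7; 2; -10]; [:: 1; -1; -8; 8]; [:: 1; -5; 14; -10]]
   [::]
   [:: 1; 76; 171; 76]
   [:: 23104; 64; 1; 1] 7485696,
   ByTriple 1 1 3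
   (Bound [::] (Comb [:: [:: 0; 7296]; [:: 14250; 630; 2098; 5262]; [:: 0; -320; -20; 1264];
    [:: 0; 150; -350; 750]] [:: [::]; [:: 8988; -4632; -3164]; [:: 0; -1584; -1284]; [:: 0; -600;
    -1100]] [:: [::]; [:: 0; 5472; 1680]; [:: 0; 1680; 1280]] [:: Mu 1 1 3 2 0; Mu 1 3 1 2 0; Mu 3
    1 1 (-1) 0]) 0 1));
  (SchemeData 0 441 [:: 1; 5; 5; 1]%positive
   [:: [:: 1; 100; 900; 240]; [:: 1; 37; 18; -12]; [:: 1; -5; -45; 9]; [:: 1; -26; 81; -12]]
   [::]
   [:: 1; 100; 240; 100]
   [:: 64800000; 1296; 16; 1125] 28576800000,
   ByTriple 1 1 3
   (Bound [::] (Comb [:: [:: 0; 331524]; [:: 581760; 21312; 66882; 167976]; [:: 0; -9978; -570;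
    40107]; [:: 0; 4680; -10608; 24336]] [:: [::]; [:: 413784; -146664; -101094]; [:: 0; -50085;
    -40677]; [:: 0; -19656; -34944]] [:: [::]; [:: 0; 174636; 52920]; [:: 0; 52920; 40572]] [:: Mu
    1 1 3 2 0; Mu 1 3 1 2 0; Mu 3 1 1 (-1) 0]) 0 1));
  (SchemeData 0 540 [:: 1; 1; 1; 1]%positive
   [:: [:: 1; 33; 275; 231]; [:: 1; 15; 5; -21]; [:: 1; 3; -25; 21]; [:: 1; -3; 5; -3]]
   [::]
   [:: 1; 55; 99; 385]
   [:: 33350625; 30625; 441; 625] 18009337500,
   ByTriple 1 1 3
   (Bound [::] (Comb [:: [:: 0; -46359]; [:: 21681; -1485; 1971; 9369]; [:: 0; 837; 621; -297];
    [:: 0; -27; -459; 135]] [:: [::]; [:: 12312; -10854; -7398]; [:: 0; 1134; 918]; [:: 0; -162;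
    -594]] [:: [::]; [:: 0; 35964; 2268]; [:: 0; 2268; 1836]] [:: Mu 1 1 3 2 0; Mu 1 3 1 2 0; Mu 3
    1 1 1 0]) 0 1));
  (SchemeData 0 540 [:: 1; 2; 1; 2]%positive
   [:: [:: 1; 70; 315; 378]; [:: 1; 25; 0; -27]; [:: 1; -2; -9; 18]; [:: 1; -11; 18; -27]]
   [::]
   [:: 1; 84; 315; 140]
   [:: 7144200; 729; 72; 25] 3857868000,
   ByTriple 1 1 3
   (Bound [::] (Comb [:: [:: 0; -477144]; [:: 109620; -5400; 4788; 20844]; [:: 0; 9144; -1080;
    11412]; [:: 0; 10152; -396; 13068]] [:: [::]; [:: 88776; -26244; -16056]; [:: 0; -2268;
    -12492]; [:: 0; -2916; -13464]] [:: [::]; [:: 0; 99144; 6156]; [:: 0; 6156; 13284]] [:: Mu 1 1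
    3 1 0; Mu 1 3 1 1 0; Mu 3 1 1 2 0]) 0 1));
  (SchemeData 0 576 [:: 1; 5; 5; 1]%positive
   [:: [:: 1; 115; 1035; 345]; [:: 1; 43; 27; -15]; [:: 1; -5; -45; 9]; [:: 1; -29; 99; -15]]
   [::]
   [:: 1; 115; 345; 115]
   [:: 5356125; 81; 1; 45] 3085128000,
   ByTriple 1 1 3
   (Bound [::] (Comb [:: [:: 0; -650259]; [:: 454365; -9675; 10173; 58149]; [:: 0; 10173; -2235;
    38253]; [:: 0; 16677; -3219; 37845]] [:: [::]; [:: 396216; -67824; -47976]; [:: 0; -28080;
    -40488]; [:: 0; -21168; -41064]] [:: [::]; [:: 0; 160704; 34560]; [:: 0; 34560; 42048]] [:: Mu
    1 1 3 1 0; Mu 1 3 1 1 0; Mu 3 1 1 1 0]) 0 1));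
  (SchemeData 0 729 [:: 1; 5; 5; 1]%positive
   [:: [:: 1; 130; 1170; 468]; [:: 1; 49; 36; -18]; [:: 1; -5; -45; 9]; [:: 1; -32; 117; -18]]
   [::]
   [:: 1; 130; 468; 130]
   [:: 27378000; 324; 4; 125] 19958562000,
   ByTriple 1 1 3
   (Bound [::] (Comb [:: [:: 0; -1130544]; [:: 773604; -13230; 12582; 80082]; [:: 0; 12582; -2430;
    55593]; [:: 0; 21033; -3456; 55296]] [:: [::]; [:: 693522; -93312; -67500]; [:: 0; -43011;
    -58023]; [:: 0; -34263; -58752]] [:: [::]; [:: 0; 236196; 50301]; [:: 0; 50301; 59778]] [:: Mu
    1 1 3 1 0; Mu 1 3 1 1 0; Mu 3 1 1 1 0]) 0 1));
  (SchemeData 0 1000 [:: 1; 1; 1; 1]%positive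
   [:: [:: 1; 37; 444; 518]; [:: 1; 17; 24; -42]; [:: 1; 7; -36; 28]; [:: 1; -3; 4; -2]]
   [::]
   [:: 1; 74; 148; 777]
   [:: 9659664; 7056; 49; 36] 9659664000,
   ByTriple 1 1 3
   (Bound [::] (Comb [:: [:: 0; 176138]; [:: 32338; 578; 2548; 15418]; [:: 0; -2072; 98; 168];
    [:: 0; 378; -252; 18]] [:: [::]; [:: 16920; -14840; -12870]; [:: 0; -2240; -70]; [:: 0; 360;
    -270]] [:: [::]; [:: 0; 26400; 4200]; [:: 0; 4200; 1600]] [:: Mu 1 1 3 1 0; Mu 1 3 1 1 0; Mu 3
    1 1 (-1) 0]) 0 1));
  (SchemeData 0 1015 [:: 1; 26; 12; 156]%positive
   [:: [:: 1; 728; 4524; 95004]; [:: 1; 322; 261; -5481]; [:: 1; 119; -348; 3654]; [:: 1; -84; 58;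
    -406]]
   [::]
   [:: 1; 104; 208; 702]
   [:: 2816037124992; 204363; 11466; 2] 2858277681866880,
   ByTriple 1 1 3
   (Bound [::] (Comb [:: [:: 0; 11118229409]; [:: 3000015200; 42095704; 169178576; 817732923];
    [:: 0; -138064360; 5749366; 17665872]; [:: 0; 38673936; -25782624; 2864736]] [:: [::];
    [:: 2182282277; -775637219; -648554347]; [:: 0; -155730232; -11916506]; [:: 0; 35809200;
    -28647360]] [:: [::]; [:: 0; 1301833519; 227597307]; [:: 0; 227597307; 121731386]] [:: Mu 1 1
    3 1 0; Mu 1 3 1 1 0; Mu 3 1 1 (-1) 0]) 0 1));
  (SchemeData 0 1080 [:: 1; 1; 1; 1]%positive
   [:: [:: 1; 83; 747; 249]; [:: 1; 29; -9; -21]; [:: 1; -1; -9; 9]; [:: 1; -7; 27; -21]]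
   [::]
   [:: 1; 83; 747; 249]
   [:: 558009; 81; 1; 9] 602649720,
   ByTriple 1 1 2
   (Bound [::] (Comb [:: [:: 0; 22467]; [:: -21663; -9729; -999]; [:: 0; -609; 21; 1227]; [:: 0;
    0; 147; 1029]] [:: [::]; [:: 8220; -690]; [:: 0; -1080; -1290]; [:: 0; 0; -1470]] [:: [::];
    [:: 0; 28080; 2160]; [:: 0; 1080; 1260]] [:: Mu 1 1 3 1 0]) 0 1));
  (SchemeData 0 1134 [:: 1; 5; 1; 5]%positive
   [:: [:: 1; 245; 900; 920]; [:: 1; 35; 0; -40]; [:: 1; -7; -18; 92]; [:: 1; -49; 18; -46]]
   [::]
   [:: 1; 483; 350; 300]
   [:: 4115217960000; 13711680; 5080516; 972405] 4666657166640000,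
   ByTriple 1 2 2
   (Bound [:: (1, 3333960, Comb [:: [:: 0; 234955]; [:: 234955; 986125; 3136735; 1953385]; [:: 0;
    3136735; 39445; 276115]; [:: 0; 1953385; 276115; 1932805]] [:: [::]; [:: 0; 3241350]; [:: 0;
    2685690]; [:: 0; 2130030]] [:: [::]; [:: 0; 1111320]; [:: 0; 555660]] [:: Mu 1 1 1 23 0; Mu 1
    1 3 (-7) 0])] no_comb 0 1));
  (SchemeData 0 1189 [:: 1; 14; 10; 35]%positive
   [:: [:: 1; 560; 6560; 17220]; [:: 1; 232; 0; -615]; [:: 1; -14; -164; 574]; [:: 1; -55; 205;
    -615]]
   [::]
   [:: 1; 140; 600; 448]
   [:: 1328447232000; 302580; 3087; 128] 1579523758848000,
   ByTriple 1 1 2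
   (Bound [::] (Comb [:: [:: 0; -4755711401]; [:: -28856989; -13982640; 7694470; 21589001]; [:: 0;
    35097230; -2531340; 6256313]; [:: 0; 24730790; 1104950; 13022625]] [:: [::]; [:: -50445990;
    -35571641; -13894531]; [:: 0; 28840917; -8787653]; [:: 0; 11708165; -11917675]] [:: [::];
    [:: 0; 281266601; -15002925]; [:: 0; -15002925; 10531465]] [:: Mu 1 1 3 1 0; Mu 1 3 1 1 0; Mu
    3 1 1 5 0]) 0 1));
  (SchemeData 0 1470 [:: 1; 1; 1; 1]%positive
   [:: [:: 1; 104; 1040; 325]; [:: 1; 34; -10; -25]; [:: 1; -1; -10; 10]; [:: 1; -8; 32; -25]]
   [::]
   [:: 1; 104; 1040; 325]
   [:: 27040000; 2500; 25; 256] 39748800000,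
   (* The first bound is [121] >= 17 for triples of type 111. The second is [111] <= 6 for type 112,
      since [p^2_{11} = 7] and u is itself one of the common neighbours of v and w. With
      [p^1_{11} = 33] and [p^1_{12} = 70] there would be at least 561 and at most 420 edges. *)
   ByDoubleCounting 1 1 1 1 2 1
   (Bound [::] (Comb [:: [:: 0; -89870]; [:: -46470; 11560; -95]; [:: 0; -620; -25; -200]; [:: 0;
    0; -200; 115]] [:: [::]; [:: 364140; -41930]; [:: 0; 0; 280]; [:: 0; 0; 525]] [:: [::]; [:: 0;
    1470]; [:: 0; 0; -245]] [:: Mu 1 1 3 (-1) 0]) 42875 728875)
   (Bound [::] (Comb [:: [:: 0; -1]] [::] [:: [::]; [:: 0; 1]] [::]) (-1) (-6)));
  (SchemeData 0 1548 [:: 1; 2; 5; 10]%positive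
   [:: [:: 1; 70; 2835; 9450]; [:: 1; 25; 45; -225]; [:: 1; -2; -81; 162]; [:: 1; -11; 135; -225]]
   [::]
   [:: 1; 252; 875; 420]
   [:: 8037225000; 820125; 200; 9] 12441624300000,
   ByTriple 1 1 3
   (Bound [:: (3, 501552, Comb [:: [:: 0; 71424]; [:: 65448; 202500; 359964; 412452]; [:: 0;
    445752; 4464; 24552]] [:: [::]; [:: 353340; 89100; 128700]; [:: 0; 437400; 477000]; [:: 0;
    465264; 477000]] [:: [::]; [:: 0; 209952; 80352]; [:: 0; 52488; 20088]] [:: Mu 1 1 3 1 0; Mu 3
    1 1 (-1) 0]); (2, 752328, Comb [:: [:: 0; 431208]; [:: 733968; 392328; 741528; 498276]; [:: 0;
    28800; 864; 607140]; [:: 0; 659952; 4752; 643428]] [:: [::]; [:: 339660; 299052; 131652];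
    [:: 0; 141588; 154980]; [:: 0; 89100; 162756]] [:: [::]; [:: 0; 250776; 543348]; [:: 0;
    599076; 599076]] [:: Mu 1 1 3 (-3) 0; Mu 1 3 1 (-1) 0])] (Comb [:: [:: 0; -17627904];
    [:: 5859000; 112500; 446364; 775404]; [:: 0; 109800; -15120; 216720]; [:: 0; 184752; -9504;
    217800]] [:: [::]; [:: 7288596; -865404; -649404]; [:: 0; -90720; -236304]; [:: 0; -69336;
    -251856]] [:: [::]; [:: 0; 1877904; 176904]; [:: 0; 149040; 246240]] [:: Mu 1 1 3 3 0; Mu 1 3
    1 2 0; Mu 3 1 1 3 0]) 0 1));
  (SchemeData 0 1680 [:: 1; 1; 1; 1]%positive
   [:: [:: 1; 69; 1449; 161]; [:: 1; 27; -21; -7]; [:: 1; -1; -21; 21]; [:: 1; -3; 9; -7]]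
   [::]
   [:: 1; 138; 414; 1127]
   [:: 2099601; 441; 1; 81] 3527329680,
   ByTriple 1 1 2
   (Bound [::] (Comb [:: [:: 0; -123669]; [:: -441; -567; 21; 63]; [:: 0; 1701; -63; -189]; [:: 0;
    -567; 21; 63]] [:: [::]; [:: -504; -630; -42]; [:: 0; 1890; 126]; [:: 0; -630; -42]] [:: [::];
    [:: 0; 6300; 420]; [:: 0; 420; 28]] [:: Mu 3 1 1 1 0]) 0 1));
  (SchemeData 0 1702 [:: 1; 4; 10; 20]%positive
   [:: [:: 1; 180; 6210; 20700]; [:: 1; 65; 115; -575]; [:: 1; -4; -138; 276]; [:: 1; -27; 345;
    -575]]
   [::]
   [:: 1; 216; 1125; 360]
   [:: 77128200000; 595125; 200; 9] 131272196400000,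
   ByTriple 1 1 3
   (Bound [::] (Comb [:: [:: 0; -174795032]; [:: 37467000; -598000; 459080; 2421532]; [:: 0;
    881360; -80224; 1522508]; [:: 0; 993232; -14904; 1676700]] [:: [::]; [:: 35045468; -3019532;
    -1962452]; [:: 0; -641148; -1602732]; [:: 0; -683468; -1691604]] [:: [::]; [:: 0; 13335032;
    945852]; [:: 0; 945852; 1665292]] [:: Mu 1 1 3 1 0; Mu 1 3 1 1 0; Mu 3 1 1 2 0]) 0 1));
  (SchemeData 0 1944 [:: 1; 1; 1; 1]%positive
   [:: [:: 1; 29; 319; 1595]; [:: 1; 11; 13; -25]; [:: 1; -1; -11; 11]; [:: 1; -7; 31; -25]]
   [::]
   [:: 1; 319; 1305; 319]
   [:: 2544025; 3025; 25; 1] 4945584600,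
   ByTriple 1 1 3
   (Bound [::] (Comb [:: [:: 0; -192921]; [:: 125715; -825; 747; 5151]; [:: 0; 747; -129; 3699];
    [:: 0; 1263; -189; 3675]] [:: [::]; [:: 120564; -5976; -4404]; [:: 0; -2952; -3828]; [:: 0;
    -2412; -3864]] [:: [::]; [:: 0; 15876; 3348]; [:: 0; 3348; 3924]] [:: Mu 1 1 3 1 0; Mu 1 3 1 1
    0; Mu 3 1 1 1 0]) 0 1));
  (SchemeData 0 2016 [:: 1; 1; 1; 1]%positive
   [:: [:: 1; 195; 1560; 260]; [:: 1; 35; -8; -28]; [:: 1; -1; -8; 8]; [:: 1; -21; 48; -28]]
   [::]
   [:: 1; 195; 1560; 260]
   [:: 2433600; 64; 1; 36] 4906137600,
   ByTriple 1 3 3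
   (Bound [:: (36, 201600, Comb [:: [:: 0; 168000]; [:: 184800; 47936; 84980]; [:: 0; 15680; 3332;
    168672]; [:: 0; 0; 69972; 114912]] [:: [::]; [:: 0; 0; 141260]; [:: 0; 39200; 37436];
    [:: 56448; 16800; 181356]] [:: [::]; [:: 0; 0; 139104]; [:: 0; 151200; 161280]] [:: Mu 1 1 3
    (-31) 0; Mu 1 3 1 (-25) 0])] (Comb [:: [:: 0; -1146600]; [:: -2675400; 84504; -20580]; [:: 0;
    5880; 588; -8232]; [:: 0; 0; 12348; 28728]] [:: [::]; [:: 0; 0; 26740]; [:: 0; 7840; 9604];
    [:: 1576512; -36960; 84]] [:: [::]; [:: 0; 0; -18144]; [:: 0; -10080; -10080]] [:: Mu 1 1 3
    (-9) 0; Mu 1 3 1 (-5) 0]) 0 1));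
  (SchemeData 0 2106 [:: 1; 5; 1; 5]%positive
   [:: [:: 1; 325; 1000; 5200]; [:: 1; 91; 64; -416]; [:: 1; 13; -14; 52]; [:: 1; -65; 25; -65]]
   [::]
   [:: 1; 125; 1500; 480]
   [:: 676000000; 1280; 676; 5] 1423656000000,
   ByTriple 1 1 1
   (Bound [:: (1, 7118280, Comb [:: [:: 0; 4097405]; [:: 4295135; 538265; 76895]; [:: 0; 76895;
    10985; 7063355]; [:: 0; 0; 7063355; 274625]] [:: [::]; [:: 6327360; 5734170]; [:: 0; 6920550]]
    [:: [::]; [:: 0; 5931900]] [:: Mu 1 1 1 3 0; Mu 1 1 3 (-2) 0])] no_comb 0 1));
  (SchemeData 0 2185 [:: 1; 26; 18; 117]%positive
   [:: [:: 1; 2964; 21528; 102258]; [:: 1; 1216; 552; -9177]; [:: 1; 342; -1196; 6118]; [:: 1;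
    -95; 115; -437]]
   [::]
   [:: 1; 78; 234; 1872]
   [:: 39149879423616; 171396; 4693; 32] 85542486540600960,
   ByTriple 1 1 3
   (Bound [::] (Comb [:: [:: 0; -1426222509153]; [:: 23994839700; -13781651520; 143558870;
    543472865]; [:: 0; 5168119320; 2584059660; -553727070]; [:: 0; -123050460; -348642970;
    51271025]] [:: [::]; [:: -17499826253; -7499925537; -2499975179]; [:: 0; 7641433566;
    2547144522]; [:: 0; -707540145; -235846715]] [:: [::]; [:: 0; 197686716513; 65895572171];
    [:: 0; 5518813131; 1839604377]] [:: Mu 1 3 1 4 0; Mu 3 1 1 9 0]) 0 1));
  (SchemeData 0 2197 [:: 1; 2; 1; 2]%positive
   [:: [:: 1; 72; 540; 3240]; [:: 1; 33; 20; -75]; [:: 1; 7; -45; 81]; [:: 1; -6; 7; -10]]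
   [::]
   [:: 1; 216; 360; 1620]
   [:: 20995200; 2025; 72; 1] 46126454400,
   ByTriple 1 1 3
   (Bound [::] (Comb [:: [:: 0; -10410270]; [:: 3229200; -64350; 82290; 416715]; [:: 0; 43914;
    29666; -12948]; [:: 0; -2340; -17940; 4680]] [:: [::]; [:: 2812485; -481065; -334425]; [:: 0;
    56862; 42614]; [:: 0; -7020; -22620]] [:: [::]; [:: 0; 1607190; 96330]; [:: 0; 96330; 76050]]
    [:: Mu 1 1 3 5 0; Mu 1 3 1 5 0; Mu 3 1 1 3 0]) 0 1));
  (SchemeData 0 2197 [:: 1; 1; 1; 1]%positive
   [:: [:: 1; 126; 1890; 180]; [:: 1; 35; -21; -15]; [:: 1; 9; -60; 50]; [:: 1; -4; 5; -2]]
   [::]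
   [:: 1; 180; 126; 1890]
   [:: 14288400; 900; 4; 441] 31391614800,
   ByTriple 2 2 3
   (Bound [:: (9, 8788, Comb [:: [:: 0; 0; 2112]; [:: 0; 2450; 0; 8508]; [:: 2268; 0; 162; 8716];
    [:: 0; 8508; 8716; 32]] [:: [::]; [:: 0; 6968]; [:: 6552; 0; 1872]; [:: 0; 208; 7956]]
    [:: [::]; [:: 0; 6760; 8112]; [:: 0; 8112; 2704]] [:: Mu 1 1 3 1 0]); (4, 19773, Comb
    [:: [:: 0; 0; 2367]; [:: 0; 14873; 0; 560]; [:: 15237; 0; 19449; 144]; [:: 0; 560; 144;
    19709]] [:: [::]; [:: 0; 3640]; [:: 6669; 0; 16029]; [:: 0; 19357; 1664]] [:: [::]; [:: 0;
    4056; 3549]; [:: 0; 1352; 12168]] [:: Mu 1 1 3 (-2) 0])] (Comb [:: [:: 0; 0; 50616]; [:: 0;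
    -2450; 0; 280]; [:: -2268; 0; -162; 72]; [:: 0; 280; 72; -32]] [:: [::]; [:: 0; 1820];
    [:: -6552; 0; -1872]; [:: 0; -208; 832]] [:: [::]; [:: 0; 2028; -8112]; [:: 0; 676; 6084]]
    [:: Mu 1 1 3 (-1) 0]) 0 1));
  (SchemeData 0 2304 [:: 1; 1; 1; 1]%positive
   [:: [:: 1; 47; 705; 1551]; [:: 1; 17; 15; -33]; [:: 1; -1; -15; 15]; [:: 1; -7; 39; -33]]
   [::]
   [:: 1; 282; 1551; 470]
   [:: 60140025; 27225; 121; 25] 138562617600,
   ByTriple 1 1 3
   (Bound [::] (Comb [:: [:: 0; -895584]; [:: 189222; -2244; 1686; 9204]; [:: 0; 3240; -282;
    5904]; [:: 0; 3660; -42; 6468]] [:: [::]; [:: 180018; -11448; -7518]; [:: 0; -2664; -6186];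
    [:: 0; -2808; -6510]] [:: [::]; [:: 0; 51840; 3744]; [:: 0; 3744; 6408]] [:: Mu 1 1 3 1 0; Mu
    1 3 1 1 0; Mu 3 1 1 2 0]) 0 1));
  (SchemeData 0 2376 [:: 1; 1; 1; 1]%positive
   [:: [:: 1; 95; 1995; 285]; [:: 1; 32; -21; -12]; [:: 1; -1; -21; 21]; [:: 1; -4; 15; -12]]
   [::]
   [:: 1; 190; 855; 1330]
   [:: 3980025; 441; 1; 49] 9456539400,
   ByTriple 1 1 3
   (Bound [::] (Comb [:: [:: 0; -307392]; [:: -4560; -1536; 48; 192]; [:: 0; 2688; -84; -336];
    [:: 0; -1536; 48; 192]] [:: [::]; [:: -4752; -1728; -144]; [:: 0; 3024; 252]; [:: 0; -1728;
    -144]] [:: [::]; [:: 0; 15552; 1296]; [:: 0; 1296; 108]] [:: Mu 3 1 1 1 0]) 0 1));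
  (SchemeData 0 2401 [:: 1; 2; 2; 1]%positive
   [:: [:: 1; 96; 1920; 1392]; [:: 1; 40; 16; -29]; [:: 1; -2; -40; 20]; [:: 1; -9; 65; -29]]
   [::]
   [:: 1; 240; 1392; 768]
   [:: 6200524800; 336400; 841; 3200] 14887460044800,
   ByTriple 1 1 2
   (Bound [::] (Comb [:: [:: 0; -11295039]; [:: 23709; -16240; 7490; 24479]; [:: 0; 34202; -2044;
    9751]; [:: 0; 23744; 1512; 16443]] [:: [::]; [:: -770; -40719; -16989]; [:: 0; 24451; -11795];
    [:: 0; 7301; -14931]] [:: [::]; [:: 0; 381759; -12691]; [:: 0; -12691; 13279]] [:: Mu 1 1 3 1
    0; Mu 1 3 1 1 0; Mu 3 1 1 5 0]) 0 1));
  (SchemeData 0 2500 [:: 1; 1; 1; 1]%positive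
   [:: [:: 1; 49; 1176; 1274]; [:: 1; 9; 16; -26]; [:: 1; -1; -24; 24]; [:: 1; -11; 36; -26]]
   [::]
   [:: 1; 735; 1274; 490]
   [:: 233722944; 97344; 169; 144] 584307360000,
   ByTriple 1 1 2
   (Bound [:: (1, 10000, Comb [:: [:: 0; 6689]; [:: 2789; 2349; 9739; 7129]; [:: 0; 9739; 29;
    319]; [:: 0; 7129; 319; 3509]] [:: [::]; [:: 1000; 9900]; [:: 0; 8900]; [:: 0; 7900]]
    [:: [::]; [:: 0; 2000]; [:: 0; 1000]] [:: Mu 1 1 1 5 0; Mu 1 1 3 (-1) 0])] no_comb 0 1));
  (SchemeData 0 2640 [:: 1; 1; 1; 1]%positive
   [:: [:: 1; 203; 2030; 406]; [:: 1; 43; -10; -34]; [:: 1; -1; -10; 10]; [:: 1; -17; 50; -34]]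
   [::]
   [:: 1; 203; 2030; 406]
   [:: 4120900; 100; 1; 25] 10879176000,
   ByTriple 1 2 2
   (Bound [:: (1, 425920, Comb [:: [:: 0; 85652]; [:: 161640; 313600; 287508]; [:: 0; 250240;
    13124; 229400]; [:: 0; 0; 223108; 63000]] [:: [::]; [:: 0; 33880; 231572]; [:: 256080; 246840;
    229636]; [:: 0; 363000; 74052]] [:: [::]; [:: 0; 0; 273680]; [:: 0; 106480; 186560]] [:: Mu 1
    1 3 (-219) 0; Mu 1 3 1 (-121) 0]); (1, 425920, Comb [:: [:: 0; 340268]; [:: 264280; 112320;
    138412]; [:: 0; 175680; 412796; 196520]; [:: 0; 0; 202812; 359400]] [:: [::]; [:: 0; 392040;
    194348]; [:: 169840; 179080; 196284]; [:: 0; 62920; 351868]] [:: [::]; [:: 0; 0; 152240];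
    [:: 0; 319440; 239360]] [:: Mu 1 1 3 219 0; Mu 1 3 1 121 0])] (Comb [:: [::]; [::]; [::];
    [:: 0; 0; 0; 3520]] [::] [::] [::]) 0 1))].

(** All but one of these are divisibility arguments with one cut and the same four vanishing
    parameters: [q_{11}^1] and [q_{12}^2], diagonal entries of the Krein matrix that are 0 for these
    arrays, and [q_{11}^4] in two positions, which is 0 by tridiagonality. Up to a common sign the
    multipliers of (1,1,1), (1,1,4), (1,2,2), (1,4,1) are [s^2], [-s t], [t^2], [-s t] for integers
    s and t. The exception is a linear one, for triples of type 333. *)
Definition certificates_four : seq (scheme_data * argument) := [::
  (SchemeData 0 200 [:: 1; 1; 11; 1; 11]%positive
   [:: [:: 1; 12; 825; 88; 264]; [:: 1; 4; 25; -4; -36]; [:: 1; 0; -75; 0; 64]; [:: 1; -4; 25; 4;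
    -36]; [:: 1; -12; 825; -88; 264]]
   [::]
   [:: 1; 66; 66; 66; 1]
   [:: 479160000; 3327500; 64; 61875; 625] 95832000000,
   ByTriple 2 3 3
   (Bound [:: (1, 160000, Comb [:: [:: 0; 0; 105700]; [:: 0; 26300; 130700; 135100]; [::]; [:: 0;
    122500; 18100; 13700]; [:: 0; 0; 60700]] [:: [::]; [:: 0; 62400; 6800; 11200]; [::];
    [:: 97600; 108800; 4400]] [::] [:: Mu 1 1 1 625 0; Mu 1 1 4 (-25) 0; Mu 1 2 2 1 0; Mu 1 4 1
    (-25) 0])] no_comb 0 1));
  (SchemeData 0 462 [:: 1; 1; 5; 1; 5]%positive
   [:: [:: 1; 21; 660; 210; 490]; [:: 1; 7; 44; -7; -49]; [:: 1; 0; -33; 0; 28]; [:: 1; -7; 44; 7;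
    -49]; [:: 1; -21; 660; -210; 490]]
   [::]
   [:: 1; 90; 280; 90; 1]
   [:: 5229378000; 11858000; 2401; 118580; 4356] 2415972636000,
   ByTriple 2 3 3
   (Bound [:: (1, 166012, Comb [:: [:: 0; 0; 151228]; [:: 0; 98560; 65681; 68376]; [::]; [:: 0;
    138061; 4928; 2233]; [:: 0; 0; 90244]] [:: [::]; [:: 0; 125587; 92708; 95403]; [::];
    [:: 87857; 135828; 2695]] [::] [:: Mu 1 1 1 121 0; Mu 1 1 4 (-11) 0; Mu 1 2 2 1 0; Mu 1 4 1
    (-11) 0])] no_comb 0 1));
  (SchemeData 0 486 [:: 1; 1; 1; 1; 1]%positive
   [:: [:: 1; 45; 220; 198; 22]; [:: 1; 9; 4; -9; -5]; [:: 1; 0; -5; 0; 4]; [:: 1; -9; 4; 9; -5];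
    [:: 1; -45; 220; -198; 22]]
   [::]
   [:: 1; 110; 264; 110; 1]
   [:: 3920400; 1936; 81; 100; 8100] 1905314400,
   ByTriple 1 2 3
   (Bound [:: (1, 2916, Comb [:: [:: 0; 2520]; [:: 666; 585; 2772; 2853]; [::]; [:: 0; 2331; 144;
    63; 1116]; [:: 0; 0; 0; 720]] [:: [::]; [:: 0; 648; 2835]; [::]; [:: 0; 2268; 81]] [::] [:: Mu
    1 1 1 1 0; Mu 1 1 4 (-1) 0; Mu 1 2 2 1 0; Mu 1 4 1 (-1) 0])] no_comb 0 1));
  (SchemeData 0 578 [:: 1; 3; 1; 3; 1]%positive
   [:: [:: 1; 51; 144; 816; 144]; [:: 1; 17; 8; -17; -9]; [:: 1; 0; -9; 0; 8]; [:: 1; -17; 8; 17;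
    -9]; [:: 1; -51; 144; -816; 144]]
   [::]
   [:: 1; 144; 288; 144; 1]
   [:: 5992704; 768; 289; 3; 289] 3463782912,
   ByTriple 2 3 3
   (Bound [:: (1, 19652, Comb [:: [:: 0; 0; 16388]; [:: 0; 5270; 357; 646]; [::]; [:: 0; 15827;
    1088; 799]; [:: 0; 0; 9044]] [:: [::]; [:: 0; 3179; 17918; 18207]; [::]; [:: 14161; 15028;
    289]] [::] [:: Mu 1 1 1 1 0; Mu 1 1 4 (-1) 0; Mu 1 2 2 1 0; Mu 1 4 1 (-1) 0])] no_comb 0 1));
  (SchemeData 0 686 [:: 1; 1; 3; 1; 3]%positive
   [:: [:: 1; 28; 756; 315; 270]; [:: 1; 7; 21; -7; -24]; [:: 1; 0; -28; 0; 25]; [:: 1; -7; 21; 7;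
    -24]; [:: 1; -28; 756; -315; 270]]
   [::]
   [:: 1; 180; 324; 180; 1]
   [:: 42865200; 54675; 25; 432; 196] 29405527200,
   ByTriple 1 2 2
   (Bound [:: (1, 67228, Comb [:: [:: 0; 50764]; [:: 49049; 13720; 62769; 63798]; [::]; [:: 0;
    53508; 4459; 3430; 19551]; [:: 0; 0; 0; 17836]] [:: [::]; [:: 0; 17150; 66199]; [::]; [:: 0;
    50078; 1029]] [::] [:: Mu 1 1 1 49 0; Mu 1 1 4 (-7) 0; Mu 1 2 2 1 0; Mu 1 4 1 (-7) 0])]
    no_comb 0 1));
  (SchemeData 0 702 [:: 1; 1; 7; 1; 7]%positive
   [:: [:: 1; 36; 1820; 315; 630]; [:: 1; 9; 65; -9; -72]; [:: 1; 0; -52; 0; 45]; [:: 1; -9; 65;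
    9; -72]; [:: 1; -36; 1820; -315; 630]]
   [::]
   [:: 1; 140; 420; 140; 1]
   [:: 1878130800; 1449175; 81; 18928; 676] 1318447821600,
   ByTriple 1 2 2
   (Bound [:: (1, 492804, Comb [:: [:: 0; 311220]; [:: 63063; 85176; 475839; 483210]; [::]; [:: 0;
    407628; 16965; 9594; 316017]; [:: 0; 0; 0; 67860]] [:: [::]; [:: 0; 94770; 485433]; [::];
    [:: 0; 398034; 7371]] [::] [:: Mu 1 1 1 169 0; Mu 1 1 4 (-13) 0; Mu 1 2 2 1 0; Mu 1 4 1 (-13)
    0])] no_comb 0 1));
  (SchemeData 0 722 [:: 1; 3; 1; 3; 1]%positive
   [:: [:: 1; 57; 162; 1026; 198]; [:: 1; 19; 10; -19; -11]; [:: 1; 0; -9; 0; 8]; [:: 1; -19; 10;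
    19; -11]; [:: 1; -57; 162; -1026; 198]]
   [::]
   [:: 1; 162; 396; 162; 1]
   [:: 1146364164; 117612; 43681; 363; 29241] 827674926408,
   ByTriple 1 2 3
   (Bound [:: (1, 27436, Comb [:: [:: 0; 13794]; [:: 16150; 4959; 26258; 26619]; [::]; [:: 0;
    22477; 1178; 817; 14896]; [:: 0; 0; 0; 3534]] [:: [::]; [:: 0; 5776; 27075]; [::]; [:: 0;
    21660; 361]] [::] [:: Mu 1 1 1 1 0; Mu 1 1 4 (-1) 0; Mu 1 2 2 1 0; Mu 1 4 1 (-1) 0])] no_comb
    0 1));
  (SchemeData 0 882 [:: 1; 1; 1; 1; 1]%positive
   [:: [:: 1; 21; 180; 420; 260]; [:: 1; 7; 12; -7; -13]; [:: 1; 0; -9; 0; 8]; [:: 1; -7; 12; 7;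
    -13]; [:: 1; -21; 180; -420; 260]]
   [::]
   [:: 1; 180; 520; 180; 1]
   [:: 268304400; 608400; 8281; 1521; 3969] 236644480800,
   ByTriple 2 3 3
   (Bound [:: (1, 12348, Comb [:: [:: 0; 0; 11088]; [:: 0; 1050; 10899; 11046]; [::]; [:: 0;
    10269; 420; 273]; [:: 0; 0; 6552]] [:: [::]; [:: 0; 3381; 882; 1029]; [::]; [:: 147; 9996;
    147]] [::] [:: Mu 1 1 1 9 0; Mu 1 1 4 (-3) 0; Mu 1 2 2 1 0; Mu 1 4 1 (-3) 0])] no_comb 0 1));
  (SchemeData 0 990 [:: 1; 1; 13; 1; 13]%positive
   [:: [:: 1; 66; 5850; 429; 572]; [:: 1; 11; 75; -11; -88]; [:: 1; 0; -90; 0; 77]; [:: 1; -11;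
    75; 11; -88]; [:: 1; -66; 5850; -429; 572]]
   [::]
   [:: 1; 234; 520; 234; 1]
   [:: 215327970000; 49432500; 484; 1170000; 50625] 213174690300000,
   ByTriple 1 2 2
   (Bound [:: (1, 1197900, Comb [:: [:: 0; 86130]; [:: 664125; 237600; 1132395; 1155990]; [::];
    [:: 0; 960300; 65505; 41910; 1012935]; [:: 0; 0; 0; 393030]] [:: [::]; [:: 0; 279510;
    1174305]; [::]; [:: 0; 918390; 23595]] [::] [:: Mu 1 1 1 225 0; Mu 1 1 4 (-15) 0; Mu 1 2 2 1
    0; Mu 1 4 1 (-15) 0])] no_comb 0 1));
  (SchemeData 0 1014 [:: 1; 1; 1; 1; 1]%positive
   [:: [:: 1; 78; 462; 429; 44]; [:: 1; 13; 7; -13; -8]; [:: 1; 0; -6; 0; 5]; [:: 1; -13; 7; 13;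
    -8]; [:: 1; -78; 462; -429; 44]]
   [::]
   [:: 1; 198; 616; 198; 1]
   [:: 144288144; 23716; 676; 784; 74529] 146308178016,
   ByTriple 1 2 2
   (Bound [:: (1, 8788, Comb [:: [:: 0; 442]; [:: 2665; 7228; 299; 130]; [::]; [:: 0; 1560; 8489;
    8658; 4771]; [:: 0; 0; 0; 6994]] [:: [::]; [:: 0; 7098; 169]; [::]; [:: 0; 1690; 8619]] [::]
    [:: Mu 1 1 1 (-1) 0; Mu 1 1 4 1 0; Mu 1 2 2 (-1) 0; Mu 1 4 1 1 0])] no_comb 0 1));
  (SchemeData 0 1058 [:: 1; 3; 1; 3; 1]%positive
   [:: [:: 1; 69; 198; 1518; 330]; [:: 1; 23; 14; -23; -15]; [:: 1; 0; -9; 0; 8]; [:: 1; -23; 14;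
    23; -15]; [:: 1; -69; 198; -1518; 330]]
   [::]
   [:: 1; 198; 660; 198; 1]
   [:: 518472900; 36300; 13225; 75; 4761] 548544328200,
   ByTriple 1 2 3
   (Bound [:: (1, 48668, Comb [:: [:: 0; 21390]; [:: 17710; 7659; 47334; 47863]; [::]; [:: 0;
    41009; 1334; 805; 32016]; [:: 0; 0; 0; 4002]] [:: [::]; [:: 0; 8464; 48139]; [::]; [:: 0;
    40204; 529]] [::] [:: Mu 1 1 1 1 0; Mu 1 1 4 (-1) 0; Mu 1 2 2 1 0; Mu 1 4 1 (-1) 0])] no_comb
    0 1));
  (SchemeData 0 1250 [:: 1; 3; 1; 3; 1]%positive
   [:: [:: 1; 75; 216; 1800; 408]; [:: 1; 25; 16; -25; -17]; [:: 1; 0; -9; 0; 8]; [:: 1; -25; 16;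
    25; -17]; [:: 1; -75; 216; -1800; 408]]
   [::]
   [:: 1; 216; 816; 216; 1]
   [:: 8427240000; 499392; 180625; 867; 50625] 10534050000000,
   ByTriple 1 2 3
   (Bound [:: (1, 62500, Comb [:: [:: 0; 25800]; [:: 48600; 9225; 61100; 61725]; [::]; [:: 0;
    53275; 1400; 775; 12650]; [:: 0; 0; 0; 4200]] [:: [::]; [:: 0; 10000; 61875]; [::]; [:: 0;
    52500; 625]] [::] [:: Mu 1 1 1 1 0; Mu 1 1 4 (-1) 0; Mu 1 2 2 1 0; Mu 1 4 1 (-1) 0])] no_comb
    0 1));
  (SchemeData 0 1458 [:: 1; 1; 1; 1; 1]%positive
   [:: [:: 1; 27; 234; 702; 494]; [:: 1; 9; 18; -9; -19]; [:: 1; 0; -9; 0; 8]; [:: 1; -9; 18; 9;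
    -19]; [:: 1; -27; 234; -702; 494]]
   [::]
   [:: 1; 234; 988; 234; 1]
   [:: 177902244; 244036; 3249; 361; 729] 259381471752,
   ByTriple 1 2 3
   (Bound [:: (1, 26244, Comb [:: [:: 0; 10206]; [:: 5346; 3645; 25758; 26001]; [::]; [:: 0;
    22599; 486; 243; 19440]; [:: 0; 0; 0; 1458]] [:: [::]; [:: 0; 3888; 26001]; [::]; [:: 0;
    22356; 243]] [::] [:: Mu 1 1 1 9 0; Mu 1 1 4 (-3) 0; Mu 1 2 2 1 0; Mu 1 4 1 (-3) 0])] no_comb
    0 1));
  (SchemeData 0 1458 [:: 1; 1; 1; 1; 1]%positive
   [:: [:: 1; 36; 420; 693; 308]; [:: 1; 9; 15; -9; -16]; [:: 1; 0; -12; 0; 11]; [:: 1; -9; 15; 9;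
    -16]; [:: 1; -36; 420; -693; 308]]
   [::]
   [:: 1; 308; 840; 308; 1]
   [:: 192099600; 148225; 1089; 400; 2025] 280081216800,
   ByTriple 1 2 2
   (Bound [:: (1, 26244, Comb [:: [:: 0; 17172]; [:: 3807; 4536; 25191; 25434]; [::]; [:: 0;
    21708; 1053; 810; 17577]; [:: 0; 0; 0; 4212]] [:: [::]; [:: 0; 5346; 26001]; [::]; [:: 0;
    20898; 243]] [::] [:: Mu 1 1 1 9 0; Mu 1 1 4 (-3) 0; Mu 1 2 2 1 0; Mu 1 4 1 (-3) 0])] no_comb
    0 1));
  (SchemeData 0 1482 [:: 1; 3; 37; 3; 37]%positive
   [:: [:: 1; 114; 25974; 2109; 1406]; [:: 1; 19; 39; -19; -76]; [:: 1; 0; -702; 0; 665]; [:: 1;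
    -19; 39; 19; -76]; [:: 1; -114; 25974; -2109; 1406]]
   [::]
   [:: 1; 666; 148; 666; 1]
   [:: 9011282365332; 231129639; 361; 675324; 123201] 13354720465422024,
   ByTriple 1 2 2
   (Bound [:: (1, 41730156, Comb [:: [:: 0; 17566146]; [:: 27565941; 10403640; 32887803;
    33408726]; [::]; [:: 0; 31326516; 8842353; 8321430; 1324167]; [:: 0; 0; 0; 11323962]]
    [:: [::]; [:: 0; 18725070; 41209233]; [::]; [:: 0; 23005086; 520923]] [::] [:: Mu 1 1 1 1521
    0; Mu 1 1 4 (-39) 0; Mu 1 2 2 1 0; Mu 1 4 1 (-39) 0])] no_comb 0 1));
  (SchemeData 0 1674 [:: 1; 1; 11; 1; 11]%positive
   [:: [:: 1; 45; 6820; 792; 2376]; [:: 1; 9; 124; -9; -135]; [:: 1; 0; -155; 0; 144]; [:: 1; -9;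
    124; 9; -135]; [:: 1; -45; 6820; -792; 2376]]
   [::]
   [:: 1; 440; 792; 440; 1]
   [:: 1491931742400; 736756416; 2916; 2378475; 24025] 2497493736777600,
   ByTriple 1 2 3
   (Bound [:: (1, 2802276, Comb [:: [:: 0; 129456]; [:: 560232; 2240091; 188604; 160983]; [::];
    [:: 0; 562185; 2613672; 2641293; 27342]; [:: 0; 0; 0; 1859256]] [:: [::]; [:: 0; 2079108;
    27621]; [::]; [:: 0; 723168; 2774655]] [::] [:: Mu 1 1 1 (-961) 0; Mu 1 1 4 31 0; Mu 1 2 2
    (-1) 0; Mu 1 4 1 31 0])] no_comb 0 1));
  (SchemeData 0 1682 [:: 1; 3; 1; 3; 1]%positive
   [:: [:: 1; 87; 252; 2436; 588]; [:: 1; 29; 20; -29; -21]; [:: 1; 0; -9; 0; 8]; [:: 1; -29; 20;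
    29; -21]; [:: 1; -87; 252; -2436; 588]]
   [::]
   [:: 1; 252; 1176; 252; 1]
   [:: 2616936336; 115248; 41209; 147; 7569] 4401686917152,
   ByTriple 3 3 3
   (Bound [::] (Comb [:: [:: 0; 0; 0; -620484]; [:: 0; -213933; -325786; -324945; -786654]; [:: 0;
    11948; -2349; -1508]; [:: -620484; 12789; -1508; -667]; [:: 0; -447586]] [:: [::]; [:: 0;
    312156; 324945; 337734]; [:: 0; 3016; 1508]; [:: 2668; 1334; 667]] [:: [::]; [:: 0; -26912;
    -13456]; [:: 0; 1682; 841]] [:: Mu 1 1 1 (-1) 0; Mu 1 4 1 1 0; Mu 2 2 1 (-1) 0; Mu 4 1 1 1 0])
    0 1));
  (SchemeData 0 1694 [:: 1; 1; 3; 1; 3]%positive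
   [:: [:: 1; 55; 1890; 792; 648]; [:: 1; 11; 42; -11; -45]; [:: 1; 0; -35; 0; 32]; [:: 1; -11;
    42; 11; -45]; [:: 1; -55; 1890; -792; 648]]
   [::]
   [:: 1; 360; 972; 360; 1]
   [:: 186720811200; 61725888; 17424; 297675; 148225] 316305054172800,
   ByTriple 1 2 3
   (Bound [:: (1, 260876, Comb [:: [:: 0; 216370]; [:: 17864; 45815; 249942; 252483]; [::]; [:: 0;
    215061; 10934; 8393; 122738]; [:: 0; 0; 0; 54670]] [:: [::]; [:: 0; 54208; 258335]; [::];
    [:: 0; 206668; 2541]] [::] [:: Mu 1 1 1 49 0; Mu 1 1 4 (-7) 0; Mu 1 2 2 1 0; Mu 1 4 1 (-7)
    0])] no_comb 0 1));
  (SchemeData 0 1862 [:: 1; 1; 5; 1; 5]%positive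
   [:: [:: 1; 21; 1140; 910; 3510]; [:: 1; 7; 76; -7; -81]; [:: 1; 0; -57; 0; 52]; [:: 1; -7; 76;
    7; -81]; [:: 1; -21; 1140; -910; 3510]]
   [::]
   [:: 1; 390; 1080; 390; 1]
   [:: 4358604978000; 9883458000; 670761; 5263380; 70756] 8115722469036000,
   ByTriple 1 2 3
   (Bound [:: (1, 495292, Comb [:: [:: 0; 236208]; [:: 233282; 83391; 477204; 481859]; [::];
    [:: 0; 411901; 18088; 13433; 304836]; [:: 0; 0; 0; 54264]] [:: [::]; [:: 0; 96824; 490637];
    [::]; [:: 0; 398468; 4655]] [::] [:: Mu 1 1 1 361 0; Mu 1 1 4 (-19) 0; Mu 1 2 2 1 0; Mu 1 4 1
    (-19) 0])] no_comb 0 1));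
  (SchemeData 0 2058 [:: 1; 5; 5; 5; 5]%positive
   [:: [:: 1; 245; 3600; 4900; 1540]; [:: 1; 49; 72; -49; -77]; [:: 1; 0; -75; 0; 70]; [:: 1; -49;
    72; 49; -77]; [:: 1; -245; 3600; -4900; 1540]]
   [::]
   [:: 1; 500; 1056; 500; 1]
   [:: 18825760800000; 62726400; 290521; 156816; 1587600] 38743415726400000,
   ByTriple 1 2 3
   (Bound [:: (1, 4235364, Comb [:: [:: 0; 391314]; [:: 95550; 3430539; 239610; 203595]; [::];
    [:: 0; 804825; 3995754; 4031769; 1215396]; [:: 0; 0; 0; 3037314]] [:: [::]; [:: 0; 3226944;
    36015]; [::]; [:: 0; 1008420; 4199349]] [::] [:: Mu 1 1 1 (-9) 0; Mu 1 1 4 3 0; Mu 1 2 2 (-1)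
    0; Mu 1 4 1 3 0])] no_comb 0 1));
  (SchemeData 0 2060 [:: 1; 1; 7; 1; 7]%positive
   [:: [:: 1; 50; 5047; 980; 2156]; [:: 1; 10; 103; -10; -110]; [:: 1; 0; -103; 0; 96]; [:: 1;
    -10; 103; 10; -110]; [:: 1; -50; 5047; -980; 2156]]
   [::]
   [:: 1; 490; 1078; 490; 1]
   [:: 215749610230000; 86299844092; 1210000; 224645575; 6630625] 444444197073800000,
   ByTriple 1 2 3
   (Bound [:: (1, 42436000, Comb [:: [:: 0; 4454750]; [:: 4094250; 34479250; 2291750; 1931250];
    [::]; [:: 0; 7956750; 40144250; 40504750; 10119750]; [:: 0; 0; 0; 30977250]] [:: [::]; [:: 0;
    32548000; 360500]; [::]; [:: 0; 9888000; 42075500]] [::] [:: Mu 1 1 1 (-10609) 0; Mu 1 1 4 515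
    0; Mu 1 2 2 (-25) 0; Mu 1 4 1 515 0])] no_comb 0 1));
  (SchemeData 0 2394 [:: 1; 1; 13; 1; 13]%positive
   [:: [:: 1; 27; 3458; 1170; 12090]; [:: 1; 9; 266; -9; -279]; [:: 1; 0; -133; 0; 120]; [:: 1;
    -9; 266; 9; -279]; [:: 1; -27; 3458; -1170; 12090]]
   [::]
   [:: 1; 390; 1612; 390; 1]
   [:: 2722602599507700; 3734708641300; 17514225; 1988898093; 1432809] 6517910623221433800,
   ByTriple 1 2 3
   (Bound [:: (1, 51581124, Comb [:: [:: 0; 20231694]; [:: 10622178; 7164045; 50568462; 50988609];
    [::]; [:: 0; 44417079; 1012662; 592515; 38438064]; [:: 0; 0; 0; 3037986]] [:: [::]; [:: 0;
    7756560; 51160977]; [::]; [:: 0; 43824564; 420147]] [::] [:: Mu 1 1 1 17689 0; Mu 1 1 4 (-399)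
    0; Mu 1 2 2 9 0; Mu 1 4 1 (-399) 0])] no_comb 0 1));
  (SchemeData 0 2466 [:: 1; 1; 35; 1; 35]%positive
   [:: [:: 1; 36; 19180; 1197; 23940]; [:: 1; 9; 685; -9; -720]; [:: 1; 0; -548; 0; 513]; [:: 1;
    -9; 685; 9; -720]; [:: 1; -36; 19180; -1197; 23940]]
   [::]
   [:: 1; 532; 1400; 532; 1]
   [:: 376493489694000; 290504235875; 29241; 262766000; 18769] 928432945585404000,
   ByTriple 1 2 2
   (Bound [:: (1, 54730404, Comb [:: [:: 0; 36284724]; [:: 8294391; 9459576; 52416063; 52804458];
    [::]; [:: 0; 45270828; 2314341; 1925946; 37247697]; [:: 0; 0; 0; 9257364]] [:: [::]; [:: 0;
    11385522; 54342009]; [::]; [:: 0; 43344882; 388395]] [::] [:: Mu 1 1 1 18769 0; Mu 1 1 4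
    (-137) 0; Mu 1 2 2 1 0; Mu 1 4 1 (-137) 0])] no_comb 0 1));
  (SchemeData 0 2550 [:: 1; 1; 7; 1; 7]%positive
   [:: [:: 1; 85; 6300; 1190; 2618]; [:: 1; 17; 180; -17; -187]; [:: 1; 0; -75; 0; 68]; [:: 1;
    -17; 180; 17; -187]; [:: 1; -85; 6300; -1190; 2618]]
   [::]
   [:: 1; 350; 1848; 350; 1]
   [:: 9715437270000; 1344697200; 34969; 6860700; 202500] 24774365038500000,
   ByTriple 1 2 3
   (Bound [:: (1, 4421700, Comb [:: [:: 0; 2621400]; [:: 1798770; 554625; 4356420; 4386765]; [::];
    [:: 0; 3867075; 65280; 34935; 3359880]; [:: 0; 0; 0; 326400]] [:: [::]; [:: 0; 589560;
    4391355]; [::]; [:: 0; 3832140; 30345]] [::] [:: Mu 1 1 1 225 0; Mu 1 1 4 (-15) 0; Mu 1 2 2 1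
    0; Mu 1 4 1 (-15) 0])] no_comb 0 1));
  (SchemeData 0 2662 [:: 1; 7; 5; 7; 5]%positive
   [:: [:: 1; 847; 5880; 8470; 770]; [:: 1; 121; 72; -121; -77]; [:: 1; 0; -49; 0; 44]; [:: 1;
    -121; 72; 121; -77]; [:: 1; -847; 5880; -8470; 770]]
   [::]
   [:: 1; 490; 1680; 490; 1]
   [:: 2531018952000; 504000; 14641; 5040; 853776] 6737572450224000,
   ByTriple 2 3 3
   (Bound [:: (1, 7086244, Comb [:: [:: 0; 0; 5565032]; [:: 0; 1598168; 236555; 309760]; [::];
    [:: 0; 5941947; 217316; 144111]; [:: 0; 0; 6674844]] [:: [::]; [:: 0; 834537; 6559168;
    6632373]; [::]; [:: 1156639; 5797836; 73205]] [::] [:: Mu 1 1 1 1 0; Mu 1 1 4 (-1) 0; Mu 1 2 2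
    1 0; Mu 1 4 1 (-1) 0])] no_comb 0 1));
  (SchemeData 0 2706 [:: 1; 1; 15; 1; 15]%positive
   [:: [:: 1; 66; 15990; 1287; 4290]; [:: 1; 11; 205; -11; -220]; [:: 1; 0; -246; 0; 231]; [:: 1;
    -11; 205; 11; -220]; [:: 1; -66; 15990; -1287; 4290]]
   [::]
   [:: 1; 702; 1300; 702; 1]
   [:: 1392178144500; 319600125; 363; 840500; 5043] 3767234059017000,
   ByTriple 1 2 2
   (Bound [:: (1, 8949644, Comb [:: [:: 0; 7694962]; [:: 3478563; 7174508; 591261; 516846]; [::];
    [:: 0; 1775136; 8358383; 8432798; 668833]; [:: 0; 0; 0; 5402078]] [:: [::]; [:: 0; 6657662;
    74415]; [::]; [:: 0; 2291982; 8875229]] [::] [:: Mu 1 1 1 (-1681) 0; Mu 1 1 4 41 0; Mu 1 2 2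
    (-1) 0; Mu 1 4 1 41 0])] no_comb 0 1));
  (SchemeData 0 2730 [:: 1; 1; 3; 1; 3]%positive
   [:: [:: 1; 78; 3234; 1287; 858]; [:: 1; 13; 49; -13; -52]; [:: 1; 0; -42; 0; 39]; [:: 1; -13;
    49; 13; -52]; [:: 1; -78; 3234; -1287; 858]]
   [::]
   [:: 1; 594; 1540; 594; 1]
   [:: 15907767876; 2614689; 507; 9604; 7203] 43428206301480,
   ByTriple 1 2 2
   (Bound [:: (1, 430612, Comb [:: [:: 0; 6734]; [:: 323687; 76440; 411229; 414778]; [::]; [:: 0;
    354172; 19383; 15834; 229957]; [:: 0; 0; 0; 116298]] [:: [::]; [:: 0; 92274; 427063]; [::];
    [:: 0; 338338; 3549]] [::] [:: Mu 1 1 1 49 0; Mu 1 1 4 (-7) 0; Mu 1 2 2 1 0; Mu 1 4 1 (-7)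
    0])] no_comb 0 1));
  (SchemeData 0 2750 [:: 1; 3; 9; 3; 9]%positive
   [:: [:: 1; 75; 2376; 4050; 9990]; [:: 1; 25; 176; -25; -185]; [:: 1; 0; -99; 0; 90]; [:: 1;
    -25; 176; 25; -185]; [:: 1; -75; 2376; -4050; 9990]]
   [::]
   [:: 1; 486; 1776; 486; 1]
   [:: 130418770680000; 7728519744; 2566875; 2650384; 145200] 358651619370000000,
   ByTriple 1 2 3
   (Bound [:: (1, 7562500, Comb [:: [:: 0; 3163050]; [:: 5908100; 1116225; 7379350; 7441225];
    [::]; [:: 0; 6446275; 183150; 121275; 1585650]; [:: 0; 0; 0; 549450]] [:: [::]; [:: 0;
    1237500; 7500625]; [::]; [:: 0; 6325000; 61875]] [::] [:: Mu 1 1 1 121 0; Mu 1 1 4 (-11) 0; Mu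
    1 2 2 1 0; Mu 1 4 1 (-11) 0])] no_comb 0 1));
  (SchemeData 0 2862 [:: 1; 5; 13; 5; 13]%positive
   [:: [:: 1; 265; 11700; 6890; 6890]; [:: 1; 53; 252; -53; -265]; [:: 1; 0; -225; 0; 212]; [:: 1;
    -53; 252; 53; -265]; [:: 1; -265; 11700; -6890; 6890]]
   [::]
   [:: 1; 650; 1560; 650; 1]
   [:: 4998812130000; 14236560; 2809; 21060; 8100] 14306600316060000,
   ByTriple 2 3 3
   (Bound [:: (1, 48236148, Comb [:: [:: 0; 0; 36463788]; [:: 0; 15241104; 4193307; 4521960];
    [::]; [:: 0; 39542823; 2354472; 2025819]; [:: 0; 0; 6412788]] [:: [::]; [:: 0; 4171365;
    41359716; 41688369]; [::]; [:: 12210723; 37517004; 328653]] [::] [:: Mu 1 1 1 81 0; Mu 1 1 4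
    (-9) 0; Mu 1 2 2 1 0; Mu 1 4 1 (-9) 0])] no_comb 0 1));
  (SchemeData 0 2890 [:: 1; 1; 1; 1; 1]%positive
   [:: [:: 1; 153; 1368; 1292; 76]; [:: 1; 17; 8; -17; -9]; [:: 1; 0; -9; 0; 8]; [:: 1; -17; 8;
    17; -9]; [:: 1; -153; 1368; -1292; 76]]
   [::]
   [:: 1; 684; 1520; 684; 1]
   [:: 540841536; 23104; 289; 324; 93636] 1563032039040,
   ByTriple 2 3 3
   (Bound [:: (1, 19652, Comb [:: [:: 0; 0; 9860]; [:: 0; 1802; 16541; 16830]; [::]; [:: 0; 15827;
    1088; 799]; [:: 0; 0; 7480]] [:: [::]; [:: 0; 6647; 1734; 2023]; [::]; [:: 9537; 15028; 289]]
    [::] [:: Mu 1 1 1 1 0; Mu 1 1 4 (-1) 0; Mu 1 2 2 1 0; Mu 1 4 1 (-1) 0])] no_comb 0 1));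
  (SchemeData 0 2926 [:: 1; 1; 85; 1; 85]%positive
   [:: [:: 1; 171; 117810; 1292; 6460]; [:: 1; 19; 770; -19; -855]; [:: 1; 0; -693; 0; 608];
    [:: 1; -19; 770; 19; -855]; [:: 1; -171; 117810; -1292; 6460]]
   [::]
   [:: 1; 612; 1700; 612; 1]
   [:: 1703532529314000; 58258354000; 1444; 1020529125; 480249] 4984536180772764000,
   ByTriple 1 2 3
   (Bound [:: (1, 162668044, Comb [:: [:: 0; 80684450]; [:: 38324748; 29401911; 155906058;
    158268803]; [::]; [:: 0; 133266133; 6761986; 4399241; 21883554]; [:: 0; 0; 0; 60857874]]
    [:: [::]; [:: 0; 33801152; 160305299]; [::]; [:: 0; 128866892; 2362745]] [::] [:: Mu 1 1 1
    5929 0; Mu 1 1 4 (-77) 0; Mu 1 2 2 1 0; Mu 1 4 1 (-77) 0])] no_comb 0 1));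
  (SchemeData 0 2970 [:: 1; 1; 1; 1; 1]%positive
   [:: [:: 1; 54; 1166; 1431; 318]; [:: 1; 9; 11; -9; -12]; [:: 1; 0; -22; 0; 21]; [:: 1; -9; 11;
    9; -12]; [:: 1; -54; 1166; -1431; 318]]
   [::]
   [:: 1; 954; 1060; 954; 1]
   [:: 991116324; 339889; 729; 484; 9801] 2943615482280,
   ByTriple 1 2 2
   (Bound [:: (1, 352836, Comb [:: [:: 0; 101574]; [:: 300267; 78408; 316305; 318978]; [::];
    [:: 0; 274428; 36531; 33858; 20493]; [:: 0; 0; 0; 219186]] [:: [::]; [:: 0; 112266; 350163];
    [::]; [:: 0; 240570; 2673]] [::] [:: Mu 1 1 1 121 0; Mu 1 1 4 (-33) 0; Mu 1 2 2 9 0; Mu 1 4 1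
    (-33) 0])] no_comb 0 1));
  (SchemeData 0 3042 [:: 1; 1; 1; 1; 1]%positive
   [:: [:: 1; 65; 960; 1456; 560]; [:: 1; 13; 24; -13; -25]; [:: 1; 0; -15; 0; 14]; [:: 1; -13;
    24; 13; -25]; [:: 1; -65; 960; -1456; 560]]
   [::]
   [:: 1; 560; 1920; 560; 1]
   [:: 7631769600; 1806336; 8281; 3600; 24336] 23215843123200,
   ByTriple 1 2 3
   (Bound [:: (1, 79092, Comb [:: [:: 0; 58890]; [:: 5694; 12285; 76674; 77181]; [::]; [:: 0;
    66807; 2418; 1911; 25740]; [:: 0; 0; 0; 12090]] [:: [::]; [:: 0; 14196; 78585]; [::]; [:: 0;
    64896; 507]] [::] [:: Mu 1 1 1 9 0; Mu 1 1 4 (-3) 0; Mu 1 2 2 1 0; Mu 1 4 1 (-3) 0])] no_comb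
    0 1));
  (SchemeData 0 3074 [:: 1; 3; 45; 3; 45]%positive
   [:: [:: 1; 318; 54810; 4293; 14310]; [:: 1; 53; 1015; -53; -1060]; [:: 1; 0; -522; 0; 477];
    [:: 1; -53; 1015; 53; -1060]; [:: 1; -318; 54810; -4293; 14310]]
   [::]
   [:: 1; 486; 2100; 486; 1]
   [:: 1139213471161500; 3755170125; 8427; 20604500; 123627] 3501942210350451000,
   ByTriple 1 2 2
   (Bound [:: (1, 500822228, Comb [:: [:: 0; 401627322]; [:: 250713903; 70603632; 490046321;
    493712066]; [::]; [:: 0; 430218596; 10775907; 7110162; 215568861]; [:: 0; 0; 0; 64655442]]
    [:: [::]; [:: 0; 77713794; 497156483]; [::]; [:: 0; 423108434; 3665745]] [::] [:: Mu 1 1 1 841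
    0; Mu 1 1 4 (-29) 0; Mu 1 2 2 1 0; Mu 1 4 1 (-29) 0])] no_comb 0 1));
  (SchemeData 0 3174 [:: 1; 1; 1; 1; 1]%positive
   [:: [:: 1; 184; 1464; 1403; 122]; [:: 1; 23; 15; -23; -16]; [:: 1; 0; -8; 0; 7]; [:: 1; -23;
    15; 23; -16]; [:: 1; -184; 1464; -1403; 122]]
   [::]
   [:: 1; 488; 2196; 488; 1]
   [:: 1133803584; 33489; 529; 576; 76176] 3598692575616,
   ByTriple 1 2 2
   (Bound [:: (1, 48668, Comb [:: [:: 0; 3036]; [:: 7521; 6992; 47725; 48254]; [::]; [:: 0; 41676;
    943; 414; 3059]; [:: 0; 0; 0; 7544]] [:: [::]; [:: 0; 7406; 48139]; [::]; [:: 0; 41262; 529]]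
    [::] [:: Mu 1 1 1 1 0; Mu 1 1 4 (-1) 0; Mu 1 2 2 1 0; Mu 1 4 1 (-1) 0])] no_comb 0 1));
  (SchemeData 0 3250 [:: 1; 3; 9; 3; 9]%positive
   [:: [:: 1; 150; 11466; 4725; 3150]; [:: 1; 25; 91; -25; -100]; [:: 1; 0; -234; 0; 225]; [:: 1;
    -25; 91; 25; -100]; [:: 1; -150; 11466; -4725; 3150]]
   [::]
   [:: 1; 1134; 980; 1134; 1]
   [:: 2218542007500; 32867289; 1875; 33124; 24843] 7210261524375000,
   ByTriple 1 2 2
   (Bound [:: (1, 10562500, Comb [:: [:: 0; 3600350]; [:: 4180475; 2433600; 9266725; 9339850];
    [::]; [:: 0; 8128900; 1295775; 1222650; 7194525]; [:: 0; 0; 0; 7774650]] [:: [::]; [:: 0;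
    3656250; 10489375]; [::]; [:: 0; 6906250; 73125]] [::] [:: Mu 1 1 1 169 0; Mu 1 1 4 (-13) 0;
    Mu 1 2 2 1 0; Mu 1 4 1 (-13) 0])] no_comb 0 1));
  (SchemeData 0 3402 [:: 1; 1; 5; 1; 5]%positive
   [:: [:: 1; 126; 6750; 1575; 1750]; [:: 1; 21; 135; -21; -140]; [:: 1; 0; -54; 0; 49]; [:: 1;
    -21; 135; 21; -140]; [:: 1; -126; 6750; -1575; 1750]]
   [::]
   [:: 1; 450; 2500; 450; 1]
   [:: 11162812500; 703125; 49; 4500; 729] 37975888125000,
   ByTriple 1 2 2
   (Bound [:: (1, 3000564, Comb [:: [:: 0; 915138]; [:: 160461; 2633148; 41391; 21546]; [::];
    [:: 0; 367416; 2959173; 2979018; 506331]; [:: 0; 0; 0; 2752218]] [:: [::]; [:: 0; 2611602;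
    19845]; [::]; [:: 0; 388962; 2980719]] [::] [:: Mu 1 1 1 (-81) 0; Mu 1 1 4 9 0; Mu 1 2 2 (-1)
    0; Mu 1 4 1 9 0])] no_comb 0 1));
  (SchemeData 0 3498 [:: 1; 1; 19; 1; 19]%positive
   [:: [:: 1; 77; 28196; 1672; 5016]; [:: 1; 11; 212; -11; -231]; [:: 1; 0; -371; 0; 352]; [:: 1;
    -11; 212; 11; -231]; [:: 1; -77; 28196; -1672; 5016]]
   [::]
   [:: 1; 1064; 1368; 1064; 1]
   [:: 65798573125824; 11097752256; 4356; 23536611; 137641] 230163408794132352,
   ByTriple 2 3 3
   (Bound [:: (1, 14955116, Comb [:: [:: 0; 0; 5209688]; [:: 0; 2955810; 13274327; 13396174];
    [::]; [:: 0; 11710721; 1392204; 1270357]; [:: 0; 0; 8052396]] [:: [::]; [:: 0; 4803337;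
    166738; 288585]; [::]; [:: 6073111; 10440364; 121847]] [::] [:: Mu 1 1 1 2809 0; Mu 1 1 4
    (-53) 0; Mu 1 2 2 1 0; Mu 1 4 1 (-53) 0])] no_comb 0 1));
  (SchemeData 0 3610 [:: 1; 1; 3; 1; 3]%positive
   [:: [:: 1; 133; 4620; 1672; 792]; [:: 1; 19; 60; -19; -63]; [:: 1; 0; -35; 0; 32]; [:: 1; -19;
    60; 19; -63]; [:: 1; -133; 4620; -1672; 792]]
   [::]
   [:: 1; 616; 2376; 616; 1]
   [:: 832175467200; 47044800; 12996; 297675; 442225] 3004153436592000,
   ByTriple 2 3 3
   (Bound [:: (1, 685900, Comb [:: [:: 0; 0; 560880]; [:: 0; 216790; 95855; 101270]; [::]; [:: 0;
    582825; 17860; 12445]; [:: 0; 0; 2280]] [:: [::]; [:: 0; 1805; 566770; 572185]; [::];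
    [:: 106495; 570380; 5415]] [::] [:: Mu 1 1 1 25 0; Mu 1 1 4 (-5) 0; Mu 1 2 2 1 0; Mu 1 4 1
    (-5) 0])] no_comb 0 1));
  (SchemeData 0 3726 [:: 1; 1; 5; 1; 5]%positive
   [:: [:: 1; 36; 3220; 1827; 6090]; [:: 1; 9; 115; -9; -120]; [:: 1; 0; -92; 0; 87]; [:: 1; -9;
    115; 9; -120]; [:: 1; -36; 3220; -1827; 6090]]
   [::]
   [:: 1; 812; 2100; 812; 1]
   [:: 3531528882000; 2724945125; 68121; 1058000; 19044] 13158476614332000,
   ByTriple 1 2 2
   (Bound [:: (1, 1542564, Comb [:: [:: 0; 1029204]; [:: 238671; 266616; 1475703; 1485018]; [::];
    [:: 0; 1275948; 66861; 57546; 1057977]; [:: 0; 0; 0; 267444]] [:: [::]; [:: 0; 324162;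
    1533249]; [::]; [:: 0; 1218402; 9315]] [::] [:: Mu 1 1 1 529 0; Mu 1 1 4 (-23) 0; Mu 1 2 2 1
    0; Mu 1 4 1 (-23) 0])] no_comb 0 1));
  (SchemeData 0 4070 [:: 1; 1; 9; 1; 9]%positive
   [:: [:: 1; 55; 9990; 1980; 8316]; [:: 1; 11; 222; -11; -231]; [:: 1; 0; -185; 0; 176]; [:: 1;
    -11; 222; 11; -231]; [:: 1; -55; 9990; -1980; 8316]]
   [::]
   [:: 1; 900; 2268; 900; 1]
   [:: 21301732544400; 7041895056; 23716; 5433561; 34225] 86698051455708000,
   ByTriple 1 2 3
   (Bound [:: (1, 7288556, Comb [:: [:: 0; 6198610]; [:: 621896; 1280015; 6952374; 6992667]; [::];
    [:: 0; 6008541; 336182; 295889; 3613346]; [:: 0; 0; 0; 1680910]] [:: [::]; [:: 0; 1575904;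
    7248263]; [::]; [:: 0; 5712652; 40293]] [::] [:: Mu 1 1 1 1369 0; Mu 1 1 4 (-37) 0; Mu 1 2 2 1
    0; Mu 1 4 1 (-37) 0])] no_comb 0 1));
  (SchemeData 0 4250 [:: 1; 1; 59; 1; 59]%positive
   [:: [:: 1; 119; 103250; 2006; 22066]; [:: 1; 17; 1250; -17; -1309]; [:: 1; 0; -875; 0; 816];
    [:: 1; -17; 1250; 17; -1309]; [:: 1; -119; 103250; -2006; 22066]]
   [::]
   [:: 1; 826; 2596; 826; 1]
   [:: 21994563393687500; 1553178687500; 34969; 5465796875; 765625] 93476894423171875000,
   ByTriple 2 3 3
   (Bound [:: (1, 307062500, Comb [:: [:: 0; 0; 230872750]; [:: 0; 85569500; 24482125; 26613500];
    [::]; [:: 0; 256859375; 10884250; 8752875]; [:: 0; 0; 277622750]] [:: [::]; [:: 0; 23589625;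
    269564750; 271696125]; [::]; [:: 12535375; 248106500; 2131375]] [::] [:: Mu 1 1 1 15625 0; Mu
    1 1 4 (-125) 0; Mu 1 2 2 1 0; Mu 1 4 1 (-125) 0])] no_comb 0 1));
  (SchemeData 0 4370 [:: 1; 1; 21; 1; 21]%positive
   [:: [:: 1; 190; 43470; 1995; 2394]; [:: 1; 19; 207; -19; -228]; [:: 1; 0; -230; 0; 209]; [:: 1;
    -19; 207; 19; -228]; [:: 1; -190; 43470; -1995; 2394]]
   [::]
   [:: 1; 1050; 2268; 1050; 1]
   [:: 14325367662900; 396824589; 361; 3599316; 119025] 62601856686873000,
   ByTriple 1 2 2
   (Bound [:: (1, 14513644, Comb [:: [:: 0; 11885526]; [:: 4300517; 2814280; 13682907; 13857270];
    [::]; [:: 0; 11699364; 830737; 656374; 1378735]; [:: 0; 0; 0; 8307370]] [:: [::]; [:: 0;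
    3470654; 14339281]; [::]; [:: 0; 11042990; 174363]] [::] [:: Mu 1 1 1 529 0; Mu 1 1 4 (-23) 0;
    Mu 1 2 2 1 0; Mu 1 4 1 (-23) 0])] no_comb 0 1));
  (SchemeData 0 4410 [:: 1; 1; 1; 1; 1]%positive
   [:: [:: 1; 210; 2090; 1995; 114]; [:: 1; 21; 11; -21; -12]; [:: 1; 0; -10; 0; 9]; [:: 1; -21;
    11; 21; -12]; [:: 1; -210; 2090; -1995; 114]]
   [::]
   [:: 1; 950; 2508; 950; 1]
   [:: 1926332100; 43681; 441; 484; 148225] 8495124561000,
   ByTriple 1 2 2
   (Bound [:: (1, 37044, Comb [:: [:: 0; 25746]; [:: 34503; 6720; 35385; 35826]; [::]; [:: 0;
    30324; 1659; 1218; 7833]; [:: 0; 0; 0; 16590]] [:: [::]; [:: 0; 7938; 36603]; [::]; [:: 0;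
    29106; 441]] [::] [:: Mu 1 1 1 1 0; Mu 1 1 4 (-1) 0; Mu 1 2 2 1 0; Mu 1 4 1 (-1) 0])] no_comb
    0 1));
  (SchemeData 0 4464 [:: 1; 1; 23; 1; 23]%positive
   [:: [:: 1; 24; 6417; 2208; 44896]; [:: 1; 8; 465; -8; -488]; [:: 1; 0; -279; 0; 256]; [:: 1;
    -8; 465; 8; -488]; [:: 1; -24; 6417; -2208; 44896]]
   [::]
   [:: 1; 828; 2806; 828; 1]
   [:: 3608706328869888; 6265115154288; 3810304; 740207367; 77841] 16109265052075180032,
   ByTriple 1 2 3
   (Bound [:: (1, 17713152, Comb [:: [:: 0; 7684776]; [:: 14602488; 2698488; 17227320; 17364216];
    [::]; [:: 0; 15014664; 485832; 348936; 3396360]; [:: 0; 0; 0; 1457496]] [:: [::]; [:: 0;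
    3047424; 17576256]; [::]; [:: 0; 14665728; 136896]] [::] [:: Mu 1 1 1 8649 0; Mu 1 1 4 (-93)
    0; Mu 1 2 2 1 0; Mu 1 4 1 (-93) 0])] no_comb 0 1));
  (SchemeData 0 4526 [:: 1; 5; 45; 5; 45]%positive
   [:: [:: 1; 365; 55800; 10950; 45990]; [:: 1; 73; 1488; -73; -1533]; [:: 1; 0; -775; 0; 730];
    [:: 1; -73; 1488; 73; -1533]; [:: 1; -365; 55800; -10950; 45990]]
   [::]
   [:: 1; 750; 3024; 750; 1]
   [:: 36586655569800000; 54924609600; 261121; 61027344; 384400] 165591203108914800000,
   ByTriple 2 3 3
   (Bound [:: (1, 1495381348, Comb [:: [:: 0; 0; 1313322998]; [:: 0; 185615786; 1432372639;
    1439806594]; [::]; [:: 0; 1283168523; 36411670; 28977715]; [:: 0; 0; 471486998]] [:: [::];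
    [:: 0; 267787579; 19163084; 26597039]; [::]; [:: 1063716361; 1254190808; 7433955]] [::] [:: Mu
    1 1 1 961 0; Mu 1 1 4 (-31) 0; Mu 1 2 2 1 0; Mu 1 4 1 (-31) 0])] no_comb 0 1));
  (SchemeData 0 4558 [:: 1; 3; 51; 3; 51]%positive
   [:: [:: 1; 258; 81090; 6579; 35088]; [:: 1; 43; 1325; -43; -1376]; [:: 1; 0; -954; 0; 903];
    [:: 1; -43; 1325; 43; -1376]; [:: 1; -258; 81090; -6579; 35088]]
   [::]
   [:: 1; 918; 2720; 918; 1]
   [:: 39684568463481600; 198728884800; 118336; 305619200; 632025] 180882263056549132800,
   ByTriple 1 2 2
   (Bound [:: (1, 893340652, Comb [:: [:: 0; 36268006]; [:: 604283687; 745497364; 34137141;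
    29139294]; [::]; [:: 0; 147843288; 859203511; 864201358; 120502125]; [:: 0; 0; 0; 688517806]]
    [:: [::]; [:: 0; 716358070; 4997847]; [::]; [:: 0; 176982582; 888342805]] [::] [:: Mu 1 1 1
    (-2809) 0; Mu 1 1 4 53 0; Mu 1 2 2 (-1) 0; Mu 1 4 1 53 0])] no_comb 0 1));
  (SchemeData 0 4590 [:: 1; 1; 1; 1; 1]%positive
   [:: [:: 1; 75; 1258; 2220; 1036]; [:: 1; 15; 34; -15; -35]; [:: 1; 0; -17; 0; 16]; [:: 1; -15;
    34; 15; -35]; [:: 1; -75; 1258; -2220; 1036]]
   [::]
   [:: 1; 740; 3108; 740; 1]
   [:: 1744776810000; 310182544; 1102500; 354025; 1625625] 8008525557900000,
   ByTriple 1 2 3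
   (Bound [:: (1, 3901500, Comb [:: [:: 0; 2613750]; [:: 790500; 541875; 3812250; 3831375]; [::];
    [:: 0; 3359625; 89250; 70125; 318750]; [:: 0; 0; 0; 446250]] [:: [::]; [:: 0; 612000;
    3882375]; [::]; [:: 0; 3289500; 19125]] [::] [:: Mu 1 1 1 289 0; Mu 1 1 4 (-85) 0; Mu 1 2 2 25
    0; Mu 1 4 1 (-85) 0])] no_comb 0 1));
  (SchemeData 0 4758 [:: 1; 1; 29; 1; 29]%positive
   [:: [:: 1; 117; 63684; 2262; 5278]; [:: 1; 13; 244; -13; -273]; [:: 1; 0; -549; 0; 520]; [:: 1;
    -13; 244; 13; -273]; [:: 1; -117; 63684; -2262; 5278]]
   [::]
   [:: 1; 1566; 1624; 1566; 1]
   [:: 973960737566544; 71149151696; 8281; 190351476; 1205604] 4634105189341616352,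
   ByTriple 2 3 3
   (Bound [:: (1, 32700148, Comb [:: [:: 0; 0; 126880]; [:: 0; 16710096; 5689775; 5988736]; [::];
    [:: 0; 25299079; 3619252; 3320291]; [:: 0; 0; 1481324]] [:: [::]; [:: 0; 1412333; 23092160;
    23391121]; [::]; [:: 8649251; 21978788; 298961]] [::] [:: Mu 1 1 1 3721 0; Mu 1 1 4 (-61) 0;
    Mu 1 2 2 1 0; Mu 1 4 1 (-61) 0])] no_comb 0 1));
  (SchemeData 0 4802 [:: 1; 5; 1; 5; 1]%positive
   [:: [:: 1; 245; 1200; 11760; 1200]; [:: 1; 49; 24; -49; -25]; [:: 1; 0; -25; 0; 24]; [:: 1;
    -49; 24; 49; -25]; [:: 1; -245; 1200; -11760; 1200]]
   [::]
   [:: 1; 1200; 2400; 1200; 1]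
   [:: 3457440000; 11520; 2401; 5; 2401] 16602626880000,
   ByTriple 2 3 3
   (Bound [:: (1, 470596, Comb [:: [:: 0; 0; 329476]; [:: 0; 5390; 358337; 360738]; [::]; [:: 0;
    381171; 28224; 25823]; [:: 0; 0; 35476]] [:: [::]; [:: 0; 199283; 81634; 84035]; [::];
    [:: 213689; 355348; 2401]] [::] [:: Mu 1 1 1 1 0; Mu 1 1 4 (-1) 0; Mu 1 2 2 1 0; Mu 1 4 1 (-1)
    0])] no_comb 0 1));
  (SchemeData 0 5046 [:: 1; 1; 1; 1; 1]%positive
   [:: [:: 1; 261; 2340; 2262; 182]; [:: 1; 29; 20; -29; -21]; [:: 1; 0; -9; 0; 8]; [:: 1; -29;
    20; 29; -21]; [:: 1; -261; 2340; -2262; 182]]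
   [::]
   [:: 1; 702; 3640; 702; 1]
   [:: 225644000400; 3312400; 41209; 44100; 6812100] 1138599626018400,
   ByTriple 1 2 3
   (Bound [:: (1, 97556, Comb [:: [:: 0; 9976]; [:: 13630; 12789; 96048; 96889]; [::]; [:: 0;
    84767; 1508; 667; 58696]; [:: 0; 0; 0; 13572]] [:: [::]; [:: 0; 13456; 96715]; [::]; [:: 0;
    84100; 841]] [::] [:: Mu 1 1 1 1 0; Mu 1 1 4 (-1) 0; Mu 1 2 2 1 0; Mu 1 4 1 (-1) 0])] no_comb
    0 1));
  (SchemeData 0 5202 [:: 1; 5; 1; 5; 1]%positive
   [:: [:: 1; 255; 1250; 12750; 1350]; [:: 1; 51; 26; -51; -27]; [:: 1; 0; -25; 0; 24]; [:: 1;
    -51; 26; 51; -27]; [:: 1; -255; 1250; -12750; 1350]]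
   [::]
   [:: 1; 1250; 2700; 1250; 1]
   [:: 329189062500; 1012500; 210681; 405; 180625] 1712441503125000,
   ByTriple 2 3 3
   (Bound [:: (1, 530604, Comb [:: [:: 0; 0; 384234]; [:: 0; 215220; 87771; 90372]; [::]; [:: 0;
    432429; 29274; 26673]; [:: 0; 0; 52734]] [:: [::]; [:: 0; 7803; 410958; 413559]; [::];
    [:: 54621; 405756; 2601]] [::] [:: Mu 1 1 1 1 0; Mu 1 1 4 (-1) 0; Mu 1 2 2 1 0; Mu 1 4 1 (-1)
    0])] no_comb 0 1));
  (SchemeData 0 5480 [:: 1; 1; 9; 1; 9]%positive
   [:: [:: 1; 100; 13563; 2640; 11088]; [:: 1; 20; 411; -20; -420]; [:: 1; 0; -137; 0; 128];
    [:: 1; -20; 411; 20; -420]; [:: 1; -100; 13563; -2640; 11088]]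
   [::]
   [:: 1; 660; 4158; 660; 1]
   [:: 12979862612640000; 1297986261264; 7840000; 1862354025; 11730625] 71129647117267200000,
   ByTriple 1 2 3
   (Bound [:: (1, 600608000, Comb [:: [:: 0; 316127500]; [:: 356131500; 65691500; 593689500;
    596155500]; [::]; [:: 0; 534916500; 6918500; 4452500; 294892500]; [:: 0; 0; 0; 34592500]]
    [:: [::]; [:: 0; 70144000; 598142000]; [::]; [:: 0; 530464000; 2466000]] [::] [:: Mu 1 1 1
    18769 0; Mu 1 1 4 (-685) 0; Mu 1 2 2 25 0; Mu 1 4 1 (-685) 0])] no_comb 0 1));
  (SchemeData 0 5566 [:: 1; 1; 5; 1; 5]%positive
   [:: [:: 1; 66; 8970; 2717; 4940]; [:: 1; 11; 115; -11; -120]; [:: 1; 0; -138; 0; 133]; [:: 1;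
    -11; 115; 11; -120]; [:: 1; -66; 8970; -2717; 4940]]
   [::]
   [:: 1; 1482; 2600; 1482; 1]
   [:: 70292251458000; 16136880500; 174724; 9522000; 576081] 391246671615228000,
   ByTriple 1 2 2
   (Bound [:: (1, 2816396, Comb [:: [:: 0; 451858]; [:: 1769229; 558624; 2620827; 2634742]; [::];
    [:: 0; 2257772; 195569; 181654; 2672439]; [:: 0; 0; 0; 1173414]] [:: [::]; [:: 0; 740278;
    2802481]; [::]; [:: 0; 2076118; 13915]] [::] [:: Mu 1 1 1 529 0; Mu 1 1 4 (-23) 0; Mu 1 2 2 1
    0; Mu 1 4 1 (-23) 0])] no_comb 0 1));
  (SchemeData 0 5590 [:: 1; 1; 11; 1; 11]%positive
   [:: [:: 1; 78; 19866; 2717; 10868]; [:: 1; 13; 301; -13; -312]; [:: 1; 0; -258; 0; 247]; [:: 1;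
    -13; 301; 13; -312]; [:: 1; -78; 19866; -2717; 10868]]
   [::]
   [:: 1; 1254; 3080; 1254; 1]
   [:: 1059418238454576; 174131860364; 244036; 143511984; 815409] 5922147952961079840,
   ByTriple 1 2 2
   (Bound [:: (1, 16249012, Comb [:: [:: 0; 578006]; [:: 12484147; 2884440; 15463617; 15543554];
    [::]; [:: 0; 13364572; 785395; 705458; 9055241]; [:: 0; 0; 0; 4712370]] [:: [::]; [:: 0;
    3589898; 16169075]; [::]; [:: 0; 12659114; 79937]] [::] [:: Mu 1 1 1 1849 0; Mu 1 1 4 (-43) 0;
    Mu 1 2 2 1 0; Mu 1 4 1 (-43) 0])] no_comb 0 1));
  (SchemeData 0 5618 [:: 1; 5; 1; 5; 1]%positive
   [:: [:: 1; 265; 1300; 13780; 1508]; [:: 1; 53; 28; -53; -29]; [:: 1; 0; -25; 0; 24]; [:: 1;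
    -53; 28; 53; -29]; [:: 1; -265; 1300; -13780; 1508]]
   [::]
   [:: 1; 1300; 3016; 1300; 1]
   [:: 3992403610000; 11370320; 2362369; 4205; 1755625] 22429323480980000,
   ByTriple 1 2 3
   (Bound [:: (1, 595508, Comb [:: [:: 0; 72928]; [:: 468520; 488183; 30316; 27507]; [::]; [:: 0;
    107325; 565192; 568001; 346090]; [:: 0; 0; 0; 443928]] [:: [::]; [:: 0; 460676; 2809]; [::];
    [:: 0; 134832; 592699]] [::] [:: Mu 1 1 1 (-1) 0; Mu 1 1 4 1 0; Mu 1 2 2 (-1) 0; Mu 1 4 1 1
    0])] no_comb 0 1));
  (SchemeData 0 5618 [:: 1; 3; 1; 3; 1]%positive
   [:: [:: 1; 318; 1890; 8109; 918]; [:: 1; 53; 35; -53; -36]; [:: 1; 0; -18; 0; 17]; [:: 1; -53;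
    35; 53; -36]; [:: 1; -318; 1890; -8109; 918]]
   [::]
   [:: 1; 918; 3780; 918; 1]
   [:: 2899834352100; 9558675; 811801; 14700; 3441025] 16291269390097800,
   ByTriple 1 2 2
   (Bound [:: (1, 595508, Comb [:: [:: 0; 486858]; [:: 305863; 83952; 581145; 583954]; [::];
    [:: 0; 511556; 14363; 11554; 267173]; [:: 0; 0; 0; 86178]] [:: [::]; [:: 0; 95506; 592699];
    [::]; [:: 0; 500002; 2809]] [::] [:: Mu 1 1 1 1 0; Mu 1 1 4 (-1) 0; Mu 1 2 2 1 0; Mu 1 4 1
    (-1) 0])] no_comb 0 1));
  (SchemeData 0 5642 [:: 1; 1; 9; 1; 9]%positive
   [:: [:: 1; 91; 19530; 2730; 5850]; [:: 1; 13; 186; -13; -195]; [:: 1; 0; -217; 0; 208]; [:: 1;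
    -13; 186; 13; -195]; [:: 1; -91; 19530; -2730; 5850]]
   [::]
   [:: 1; 1470; 2700; 1470; 1]
   [:: 14503529722500; 1751422500; 4225; 1946025; 47089] 81828914694345000,
   ByTriple 1 2 3
   (Bound [:: (1, 8445268, Comb [:: [:: 0; 2855658]; [:: 5763706; 1661569; 7880262; 7927413];
    [::]; [:: 0; 6783699; 565006; 517855; 5269628]; [:: 0; 0; 0; 3955042]] [:: [::]; [:: 0;
    2179424; 8398117]; [::]; [:: 0; 6265844; 47151]] [::] [:: Mu 1 1 1 961 0; Mu 1 1 4 (-31) 0; Mu
    1 2 2 1 0; Mu 1 4 1 (-31) 0])] no_comb 0 1));
  (SchemeData 0 5670 [:: 1; 1; 1; 1; 1]%positive
   [:: [:: 1; 105; 1560; 2730; 1274]; [:: 1; 21; 48; -21; -49]; [:: 1; 0; -15; 0; 14]; [:: 1; -21;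
    48; 21; -49]; [:: 1; -105; 1560; -2730; 1274]]
   [::]
   [:: 1; 650; 4368; 650; 1]
   [:: 5843073600; 529984; 2401; 784; 3600] 33130227312000,
   ByTriple 1 2 3
   (Bound [:: (1, 333396, Comb [:: [:: 0; 168210]; [:: 168588; 34965; 329994; 331317]; [::];
    [:: 0; 298431; 3402; 2079; 183330]; [:: 0; 0; 0; 17010]] [:: [::]; [:: 0; 37044; 332073];
    [::]; [:: 0; 296352; 1323]] [::] [:: Mu 1 1 1 9 0; Mu 1 1 4 (-3) 0; Mu 1 2 2 1 0; Mu 1 4 1
    (-3) 0])] no_comb 0 1));
  (SchemeData 0 5670 [:: 1; 1; 1; 1; 1]%positive
   [:: [:: 1; 105; 2184; 2730; 650]; [:: 1; 15; 24; -15; -25]; [:: 1; 0; -21; 0; 20]; [:: 1; -15;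
    24; 15; -25]; [:: 1; -105; 2184; -2730; 650]]
   [::]
   [:: 1; 1274; 3120; 1274; 1]
   [:: 2981160000; 270400; 625; 400; 7056] 16903177200000,
   ByTriple 2 3 3
   (Bound [:: (1, 121500, Comb [:: [:: 0; 0; 79920]; [:: 0; 104760; 77085; 77760]; [::]; [:: 0;
    99765; 5940; 5265]; [:: 0; 0; 95580]] [:: [::]; [:: 0; 65475; 37800; 38475]; [::]; [:: 31725;
    94500; 675]] [::] [:: Mu 1 1 1 9 0; Mu 1 1 4 (-3) 0; Mu 1 2 2 1 0; Mu 1 4 1 (-3) 0])] no_comb
    0 1));
  (SchemeData 0 6050 [:: 1; 1; 1; 1; 1]%positive
   [:: [:: 1; 55; 1350; 2970; 1674]; [:: 1; 11; 30; -11; -31]; [:: 1; 0; -25; 0; 24]; [:: 1; -11;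
    30; 11; -31]; [:: 1; -55; 1350; -2970; 1674]]
   [::]
   [:: 1; 1350; 3348; 1350; 1]
   [:: 211922122500; 70056900; 116281; 24025; 75625] 1282128841125000,
   ByTriple 1 2 3
   (Bound [:: (1, 133100, Comb [:: [:: 0; 113850]; [:: 78430; 23375; 126830; 127435]; [::]; [:: 0;
    109725; 6270; 5665; 220]; [:: 0; 0; 0; 31350]] [:: [::]; [:: 0; 29040; 132495]; [::]; [:: 0;
    104060; 605]] [::] [:: Mu 1 1 1 25 0; Mu 1 1 4 (-5) 0; Mu 1 2 2 1 0; Mu 1 4 1 (-5) 0])]
    no_comb 0 1));
  (SchemeData 0 6278 [:: 1; 7; 63; 7; 63]%positive
   [:: [:: 1; 511; 151704; 21462; 45990]; [:: 1; 73; 1032; -73; -1095]; [:: 1; 0; -2107; 0; 2044];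
    [:: 1; -73; 1032; 73; -1095]; [:: 1; -511; 151704; -21462; 45990]]
   [::]
   [:: 1; 2058; 2160; 2058; 1]
   [:: 193161399117220800; 105677006400; 133225; 59907600; 1449616] 1212667263657912182400,
   ByTriple 2 3 3
   (Bound [:: (1, 2877169732, Comb [:: [:: 0; 0; 709665120]; [:: 0; 146817308; 2072797843;
    2087234104]; [::]; [:: 0; 2235624051; 309643516; 295207255]; [:: 0; 0; 1364573524]] [:: [::];
    [:: 0; 1431481309; 480292112; 494728373]; [::]; [:: 1130382151; 1940416796; 14436261]] [::]
    [:: Mu 1 1 1 1849 0; Mu 1 1 4 (-43) 0; Mu 1 2 2 1 0; Mu 1 4 1 (-43) 0])] no_comb 0 1));
  (SchemeData 0 6358 [:: 1; 1; 3; 1; 3]%positive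
   [:: [:: 1; 85; 4620; 3094; 4914]; [:: 1; 17; 132; -17; -135]; [:: 1; 0; -55; 0; 52]; [:: 1;
    -17; 132; 17; -135]; [:: 1; -85; 4620; -3094; 4914]]
   [::]
   [:: 1; 910; 4536; 910; 1]
   [:: 253323087217200; 35062018992; 3956121; 26462700; 3496900] 1610628188526957600,
   ByTriple 1 2 3
   (Bound [:: (1, 2377892, Comb [:: [:: 0; 1443640]; [:: 994466; 298265; 2336004; 2345541]; [::];
    [:: 0; 2079627; 41888; 32351; 1847560]; [:: 0; 0; 0; 209440]] [:: [::]; [:: 0; 330616;
    2368355]; [::]; [:: 0; 2047276; 9537]] [::] [:: Mu 1 1 1 121 0; Mu 1 1 4 (-11) 0; Mu 1 2 2 1
    0; Mu 1 4 1 (-11) 0])] no_comb 0 1));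
  (SchemeData 0 6422 [:: 1; 1; 5; 1; 5]%positive
   [:: [:: 1; 91; 11970; 3120; 4080]; [:: 1; 13; 114; -13; -119]; [:: 1; 0; -133; 0; 128]; [:: 1;
    -13; 114; 13; -119]; [:: 1; -91; 11970; -3120; 4080]]
   [::]
   [:: 1; 1680; 3060; 1680; 1]
   [:: 2239354379808000; 270420768000; 3125824; 230045445; 26904969] 14381133827126976000,
   ByTriple 1 2 3
   (Bound [:: (1, 3172468, Comb [:: [:: 0; 1084330]; [:: 588848; 624169; 2958566; 2974621]; [::];
    [:: 0; 2548299; 213902; 197847; 406562]; [:: 0; 0; 0; 1497314]] [:: [::]; [:: 0; 822016;
    3156413]; [::]; [:: 0; 2350452; 16055]] [::] [:: Mu 1 1 1 361 0; Mu 1 1 4 (-19) 0; Mu 1 2 2 1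
    0; Mu 1 4 1 (-19) 0])] no_comb 0 1));
  (SchemeData 0 6426 [:: 1; 1; 1; 1; 1]%positive
   [:: [:: 1; 147; 2482; 3066; 730]; [:: 1; 21; 34; -21; -35]; [:: 1; 0; -17; 0; 16]; [:: 1; -21;
    34; 21; -35]; [:: 1; -147; 2482; -3066; 730]]
   [::]
   [:: 1; 1022; 4380; 1022; 1]
   [:: 3327961032900; 154008100; 540225; 354025; 6245001] 21385477597415400,
   ByTriple 2 3 3
   (Bound [:: (1, 10705716, Comb [:: [:: 0; 0; 8991402]; [:: 0; 4478208; 2746401; 2798880]; [::];
    [:: 0; 9218811; 244902; 192423]; [:: 0; 0; 664734]] [:: [::]; [:: 0; 9393741; 7661934;
    7714413]; [::]; [:: 1311975; 9026388; 52479]] [::] [:: Mu 1 1 1 289 0; Mu 1 1 4 (-119) 0; Mu 1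
    2 2 49 0; Mu 1 4 1 (-119) 0])] no_comb 0 1));
  (SchemeData 0 6450 [:: 1; 1; 13; 1; 13]%positive
   [:: [:: 1; 105; 31304; 3120; 10608]; [:: 1; 15; 344; -15; -357]; [:: 1; 0; -301; 0; 288];
    [:: 1; -15; 344; 15; -357]; [:: 1; -105; 31304; -3120; 10608]]
   [::]
   [:: 1; 1456; 3536; 1456; 1]
   [:: 3313472528620800; 300541725952; 260100; 340387957; 2265025] 21371897809604160000,
   ByTriple 1 2 3
   (Bound [:: (1, 24961500, Comb [:: [:: 0; 5415420]; [:: 4958760; 4465335; 23728260; 23854035];
    [::]; [:: 0; 20496165; 1233240; 1107465; 21570090]; [:: 0; 0; 0; 8632680]] [:: [::]; [:: 0;
    5572800; 24835725]; [::]; [:: 0; 19388700; 125775]] [::] [:: Mu 1 1 1 1849 0; Mu 1 1 4 (-43)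
    0; Mu 1 2 2 1 0; Mu 1 4 1 (-43) 0])] no_comb 0 1));
  (SchemeData 0 6498 [:: 1; 5; 1; 5; 1]%positive
   [:: [:: 1; 285; 1400; 15960; 1848]; [:: 1; 57; 32; -57; -33]; [:: 1; 0; -25; 0; 24]; [:: 1;
    -57; 32; 57; -33]; [:: 1; -285; 1400; -15960; 1848]]
   [::]
   [:: 1; 1400; 3696; 1400; 1]
   [:: 770532840000; 1897280; 393129; 605; 225625] 5006922394320000,
   ByTriple 1 2 3
   (Bound [:: (1, 740772, Comb [:: [:: 0; 122892]; [:: 19380; 613947; 32376; 29127]; [::]; [:: 0;
    126825; 708396; 711645; 312018]; [:: 0; 0; 0; 578892]] [:: [::]; [:: 0; 584820; 3249]; [::];
    [:: 0; 155952; 737523]] [::] [:: Mu 1 1 1 (-1) 0; Mu 1 1 4 1 0; Mu 1 2 2 (-1) 0; Mu 1 4 1 1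
    0])] no_comb 0 1));
  (SchemeData 0 6962 [:: 1; 5; 1; 5; 1]%positive
   [:: [:: 1; 295; 1450; 17110; 2030]; [:: 1; 59; 34; -59; -35]; [:: 1; 0; -25; 0; 24]; [:: 1;
    -59; 34; 59; -35]; [:: 1; -295; 1450; -17110; 2030]]
   [::]
   [:: 1; 1450; 4060; 1450; 1]
   [:: 358621322500; 824180; 170569; 245; 87025] 2496721647245000,
   ByTriple 2 3 3
   (Bound [:: (1, 821516, Comb [:: [:: 0; 0; 654546]; [:: 0; 43188; 694135; 697616]; [::]; [:: 0;
    684341; 33394; 29913]; [:: 0; 0; 153046]] [:: [::]; [:: 0; 261075; 90506; 93987]; [::];
    [:: 490821; 654428; 3481]] [::] [:: Mu 1 1 1 1 0; Mu 1 1 4 (-1) 0; Mu 1 2 2 1 0; Mu 1 4 1 (-1)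
    0])] no_comb 0 1));
  (SchemeData 0 7210 [:: 1; 5; 51; 5; 51]%positive
   [:: [:: 1; 515; 89250; 17510; 94554]; [:: 1; 103; 2730; -103; -2781]; [:: 1; 0; -875; 0; 824];
    [:: 1; -103; 2730; 103; -2781]; [:: 1; -515; 89250; -17510; 94554]]
   [::]
   [:: 1; 850; 5508; 850; 1]
   [:: 349096981735687500; 263245909500; 859329; 227721375; 765625] 2516989238314306875000,
   ByTriple 1 2 3
   (Bound [:: (1, 5354362300, Comb [:: [:: 0; 2760024050]; [:: 222277090; 570941875; 5294439990;
    5313377055]; [::]; [:: 0; 4783420425; 59922310; 40985245; 160177360]; [:: 0; 0; 0; 299611550]]
    [:: [::]; [:: 0; 611927120; 5335425235]; [::]; [:: 0; 4742435180; 18937065]] [::] [:: Mu 1 1 1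
    1225 0; Mu 1 1 4 (-35) 0; Mu 1 2 2 1 0; Mu 1 4 1 (-35) 0])] no_comb 0 1));
  (SchemeData 0 7442 [:: 1; 5; 1; 5; 1]%positive
   [:: [:: 1; 305; 1500; 18300; 2220]; [:: 1; 61; 36; -61; -37]; [:: 1; 0; -25; 0; 24]; [:: 1;
    -61; 36; 61; -37]; [:: 1; -305; 1500; -18300; 2220]]
   [::]
   [:: 1; 1500; 4440; 1500; 1]
   [:: 11461610250000; 24642000; 5094049; 6845; 2325625] 85297303480500000,
   ByTriple 1 2 3
   (Bound [:: (1, 907924, Comb [:: [:: 0; 721020]; [:: 694912; 147925; 873520; 877241]; [::];
    [:: 0; 759999; 34404; 30683; 652090]; [:: 0; 0; 0; 172020]] [:: [::]; [:: 0; 178608; 904203];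
    [::]; [:: 0; 729316; 3721]] [::] [:: Mu 1 1 1 1 0; Mu 1 1 4 (-1) 0; Mu 1 2 2 1 0; Mu 1 4 1
    (-1) 0])] no_comb 0 1));
  (SchemeData 0 7854 [:: 1; 1; 3; 1; 3]%positive
   [:: [:: 1; 66; 6630; 3861; 5148]; [:: 1; 11; 85; -11; -88]; [:: 1; 0; -102; 0; 99]; [:: 1; -11;
    85; 11; -88]; [:: 1; -66; 6630; -3861; 5148]]
   [::]
   [:: 1; 2106; 3640; 2106; 1]
   [:: 1723286307600; 395612100; 13068; 115600; 21675] 13534690659890400,
   ByTriple 1 2 2
   (Bound [:: (1, 1538636, Comb [:: [:: 0; 1283194]; [:: 564927; 1233452; 108273; 102102]; [::];
    [:: 0; 305184; 1430363; 1436534; 68629]; [:: 0; 0; 0; 888998]] [:: [::]; [:: 0; 1131350;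
    6171]; [::]; [:: 0; 407286; 1532465]] [::] [:: Mu 1 1 1 (-289) 0; Mu 1 1 4 17 0; Mu 1 2 2 (-1)
    0; Mu 1 4 1 17 0])] no_comb 0 1));
  (SchemeData 0 7878 [:: 1; 1; 21; 1; 21]%positive
   [:: [:: 1; 78; 46662; 3861; 36036]; [:: 1; 13; 707; -13; -728]; [:: 1; 0; -606; 0; 585]; [:: 1;
    -13; 707; 13; -728]; [:: 1; -78; 46662; -3861; 36036]]
   [::]
   [:: 1; 1782; 4312; 1782; 1]
   [:: 834557863387248; 137172561372; 18252; 55983088; 30603] 6574646847764739744,
   ByTriple 1 2 2
   (Bound [:: (1, 89646388, Comb [:: [:: 0; 3684278]; [:: 69288323; 15913560; 85230769; 85589218];
    [::]; [:: 0; 73732828; 4415619; 4057170; 50536057]; [:: 0; 0; 0; 26493714]] [:: [::]; [:: 0;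
    19970730; 89287939]; [::]; [:: 0; 69675658; 358449]] [::] [:: Mu 1 1 1 10201 0; Mu 1 1 4
    (-101) 0; Mu 1 2 2 1 0; Mu 1 4 1 (-101) 0])] no_comb 0 1));
  (SchemeData 0 7906 [:: 1; 3; 57; 3; 57]%positive
   [:: [:: 1; 402; 141246; 11457; 84018]; [:: 1; 67; 2891; -67; -2948]; [:: 1; 0; -1062; 0; 1005];
    [:: 1; -67; 2891; 67; -2948]; [:: 1; -402; 141246; -11457; 84018]]
   [::]
   [:: 1; 1026; 5852; 1026; 1]
   [:: 617678019319142628; 1274056787619; 543169; 1568552524; 1535121] 4883362420737141616968,
   ByTriple 1 2 2
   (Bound [:: (1, 4187824012, Comb [:: [:: 0; 1356535198]; [:: 901106115; 3700846036; 60469041;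
    45372534]; [::]; [:: 0; 486977976; 4127354971; 4142451478; 92614837]; [:: 0; 0; 0;
    3825009766]] [:: [::]; [:: 0; 3655473502; 15096507]; [::]; [:: 0; 532350510; 4172727505]] [::]
    [:: Mu 1 1 1 (-3481) 0; Mu 1 1 4 59 0; Mu 1 2 2 (-1) 0; Mu 1 4 1 59 0])] no_comb 0 1));
  (SchemeData 0 7938 [:: 1; 5; 1; 5; 1]%positive
   [:: [:: 1; 315; 1550; 19530; 2418]; [:: 1; 63; 38; -63; -39]; [:: 1; 0; -25; 0; 24]; [:: 1;
    -63; 38; 63; -39]; [:: 1; -315; 1550; -19530; 2418]]
   [::]
   [:: 1; 1550; 4836; 1550; 1]
   [:: 1611503302500; 3248180; 670761; 845; 275625] 12792113215245000,
   ByTriple 1 2 3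
   (Bound [:: (1, 1000188, Comb [:: [:: 0; 775530]; [:: 170982; 159075; 964782; 968751]; [::];
    [:: 0; 841113; 35406; 31437; 281484]; [:: 0; 0; 0; 177030]] [:: [::]; [:: 0; 190512; 996219];
    [::]; [:: 0; 809676; 3969]] [::] [:: Mu 1 1 1 1 0; Mu 1 1 4 (-1) 0; Mu 1 2 2 1 0; Mu 1 4 1
    (-1) 0])] no_comb 0 1));
  (SchemeData 0 8120 [:: 1; 1; 11; 1; 11]%positive
   [:: [:: 1; 100; 20097; 3960; 24552]; [:: 1; 20; 609; -20; -620]; [:: 1; 0; -203; 0; 192];
    [:: 1; -20; 609; 20; -620]; [:: 1; -100; 20097; -3960; 24552]]
   [::]
   [:: 1; 990; 6138; 990; 1]
   [:: 170780597701560000; 17078059770156; 38440000; 10890508475; 25755625]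
    1386738453336667200000,
   ByTriple 2 3 3
   (Bound [:: (1, 1318688000, Comb [:: [:: 0; 0; 1237995500]; [:: 0; 162095500; 1725500; 6191500];
    [::]; [:: 0; 1174456500; 16138500; 11672500]; [:: 0; 0; 619860500]] [:: [::]; [:: 0;
    138040000; 1296358000; 1300824000]; [::]; [:: 1180648000; 1162784000; 4466000]] [::] [:: Mu 1
    1 1 41209 0; Mu 1 1 4 (-1015) 0; Mu 1 2 2 25 0; Mu 1 4 1 (-1015) 0])] no_comb 0 1));
  (SchemeData 0 8190 [:: 1; 1; 1; 1; 1]%positive
   [:: [:: 1; 90; 2314; 4005; 1780]; [:: 1; 15; 39; -15; -40]; [:: 1; 0; -26; 0; 25]; [:: 1; -15;
    39; 15; -40]; [:: 1; -90; 2314; -4005; 1780]]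
   [::]
   [:: 1; 1602; 4984; 1602; 1]
   [:: 43372227600; 5354596; 8100; 2704; 13689] 355218544044000,
   ByTriple 1 2 2
   (Bound [:: (1, 2281500, Comb [:: [:: 0; 2137590]; [:: 321165; 365040; 2199015; 2207790]; [::];
    [:: 0; 1916460; 82485; 73710; 29835]; [:: 0; 0; 0; 494910]] [:: [::]; [:: 0; 438750; 2272725];
    [::]; [:: 0; 1842750; 8775]] [::] [:: Mu 1 1 1 169 0; Mu 1 1 4 (-39) 0; Mu 1 2 2 9 0; Mu 1 4 1
    (-39) 0])] no_comb 0 1));
  (SchemeData 0 8246 [:: 1; 1; 9; 1; 9]%positive
   [:: [:: 1; 217; 28728; 3906; 8370]; [:: 1; 31; 456; -31; -465]; [:: 1; 0; -133; 0; 124]; [:: 1;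
    -31; 456; 31; -465]; [:: 1; -217; 28728; -3906; 8370]]
   [::]
   [:: 1; 882; 6480; 882; 1]
   [:: 178450056590400; 3789633600; 24025; 11696400; 283024] 1471499166644438400,
   ByTriple 1 2 3
   (Bound [:: (1, 43018204, Comb [:: [:: 0; 29009428]; [:: 16158626; 4308535; 42634176; 42798507];
    [::]; [:: 0; 38709669; 384028; 219697; 37048100]; [:: 0; 0; 0; 2688196]] [:: [::]; [:: 0;
    4528232; 42853873]; [::]; [:: 0; 38489972; 164331]] [::] [:: Mu 1 1 1 361 0; Mu 1 1 4 (-19) 0;
    Mu 1 2 2 1 0; Mu 1 4 1 (-19) 0])] no_comb 0 1));
  (SchemeData 0 8450 [:: 1; 1; 1; 1; 1]%positive
   [:: [:: 1; 65; 1600; 4160; 2624]; [:: 1; 13; 40; -13; -41]; [:: 1; 0; -25; 0; 24]; [:: 1; -13;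
    40; 13; -41]; [:: 1; -65; 1600; -4160; 2624]]
   [::]
   [:: 1; 1600; 5248; 1600; 1]
   [:: 727267840000; 172134400; 284089; 42025; 105625] 6145413248000000,
   ByTriple 1 2 3
   (Bound [:: (1, 219700, Comb [:: [:: 0; 53300]; [:: 91780; 185575; 7280; 6435]; [::]; [:: 0;
    34125; 212420; 213265; 34970]; [:: 0; 0; 0; 183300]] [:: [::]; [:: 0; 179140; 845]; [::];
    [:: 0; 40560; 218855]] [::] [:: Mu 1 1 1 (-25) 0; Mu 1 1 4 5 0; Mu 1 2 2 (-1) 0; Mu 1 4 1 5
    0])] no_comb 0 1));
  (SchemeData 0 8450 [:: 1; 1; 1; 1; 1]%positive
   [:: [:: 1; 78; 2310; 4147; 1914]; [:: 1; 13; 35; -13; -36]; [:: 1; 0; -30; 0; 29]; [:: 1; -13;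
    35; 13; -36]; [:: 1; -78; 2310; -4147; 1914]]
   [::]
   [:: 1; 1914; 4620; 1914; 1]
   [:: 758414556900; 124657225; 142129; 44100; 207025] 6408603005805000,
   ByTriple 1 2 2
   (Bound [:: (1, 219700, Comb [:: [:: 0; 9230]; [:: 169975; 39000; 208845; 209690]; [::]; [:: 0;
    180700; 10855; 10010; 124085]; [:: 0; 0; 0; 65130]] [:: [::]; [:: 0; 49010; 218855]; [::];
    [:: 0; 170690; 845]] [::] [:: Mu 1 1 1 25 0; Mu 1 1 4 (-5) 0; Mu 1 2 2 1 0; Mu 1 4 1 (-5) 0])]
    no_comb 0 1));
  (SchemeData 0 8470 [:: 1; 1; 1; 1; 1]%positive
   [:: [:: 1; 88; 3480; 4147; 754]; [:: 1; 11; 15; -11; -16]; [:: 1; 0; -40; 0; 39]; [:: 1; -11;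
    15; 11; -16]; [:: 1; -88; 3480; -4147; 754]]
   [::]
   [:: 1; 3016; 2436; 3016; 1]
   [:: 247645569600; 31979025; 20449; 14400; 435600] 2097557974512000,
   ByTriple 1 2 2
   (Bound [:: (1, 133100, Comb [:: [:: 0; 24640]; [:: 9735; 102300; 16995; 16390]; [::]; [:: 0;
    30800; 116105; 116710; 12045]; [:: 0; 0; 0; 130240]] [:: [::]; [:: 0; 85910; 605]; [::];
    [:: 0; 47190; 132495]] [::] [:: Mu 1 1 1 (-25) 0; Mu 1 1 4 5 0; Mu 1 2 2 (-1) 0; Mu 1 4 1 5
    0])] no_comb 0 1));
  (SchemeData 0 8478 [:: 1; 1; 13; 1; 13]%positive
   [:: [:: 1; 27; 4082; 4212; 51012]; [:: 1; 9; 314; -9; -327]; [:: 1; 0; -157; 0; 144]; [:: 1;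
    -9; 314; 9; -327]; [:: 1; -27; 4082; -4212; 51012]]
   [::]
   [:: 1; 1404; 5668; 1404; 1]
   [:: 67541760740505168; 92649877558992; 311804964; 3807111997; 1996569] 572619047558002814304,
   ByTriple 1 2 3
   (Bound [:: (1, 71876484, Comb [:: [:: 0; 28460646]; [:: 50918868; 9982845; 70375878; 70871841];
    [::]; [:: 0; 61893639; 1500606; 1004643; 17981838]; [:: 0; 0; 0; 4501818]] [:: [::]; [:: 0;
    10987488; 71380521]; [::]; [:: 0; 60888996; 495963]] [::] [:: Mu 1 1 1 24649 0; Mu 1 1 4
    (-471) 0; Mu 1 2 2 9 0; Mu 1 4 1 (-471) 0])] no_comb 0 1));
  (SchemeData 0 8750 [:: 1; 1; 1; 1; 1]%positive
   [:: [:: 1; 325; 4212; 4050; 162]; [:: 1; 25; 12; -25; -13]; [:: 1; 0; -13; 0; 12]; [:: 1; -25;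
    12; 25; -13]; [:: 1; -325; 4212; -4050; 162]]
   [::]
   [:: 1; 2106; 4536; 2106; 1]
   [:: 11088090000; 104976; 625; 676; 422500] 97020787500000,
   ByTriple 2 3 3
   (Bound [:: (1, 62500, Comb [:: [:: 0; 0; 15700]; [:: 0; 21400; 5775; 6400]; [::]; [:: 0; 50475;
    3600; 2975]; [:: 0; 0; 39300]] [:: [::]; [:: 0; 5625; 52500; 53125]; [::]; [:: 14375; 47500;
    625]] [::] [:: Mu 1 1 1 1 0; Mu 1 1 4 (-1) 0; Mu 1 2 2 1 0; Mu 1 4 1 (-1) 0])] no_comb 0 1));
  (SchemeData 0 8758 [:: 1; 1; 77; 1; 77]%positive
   [:: [:: 1; 232; 279048; 4147; 58058]; [:: 1; 29; 3171; -29; -3248]; [:: 1; 0; -1208; 0; 1131];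
    [:: 1; -29; 3171; 29; -3248]; [:: 1; -232; 279048; -4147; 58058]]
   [::]
   [:: 1; 1144; 6468; 1144; 1]
   [:: 852179836169293632; 15832710987093; 142129; 49552227648; 3283344] 7463391005170673629056,
   ByTriple 1 2 2
   (Bound [:: (1, 2224374356, Comb [:: [:: 0; 2037706344]; [:: 2036904987; 264491600; 2191834007;
    2201612314]; [::]; [:: 0; 1959882756; 32540349; 22762042; 261124149]; [:: 0; 0; 0; 260322792]]
    [:: [::]; [:: 0; 287253642; 2214596049]; [::]; [:: 0; 1937120714; 9778307]] [::] [:: Mu 1 1 1
    22801 0; Mu 1 1 4 (-151) 0; Mu 1 2 2 1 0; Mu 1 4 1 (-151) 0])] no_comb 0 1));
  (SchemeData 0 8798 [:: 1; 3; 63; 3; 63]%positive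
   [:: [:: 1; 318; 156870; 12879; 120204]; [:: 1; 53; 2905; -53; -2968]; [:: 1; 0; -1494; 0;
    1431]; [:: 1; -53; 2905; 53; -2968]; [:: 1; -318; 156870; -12879; 120204]]
   [::]
   [:: 1; 1458; 5880; 1458; 1]
   [:: 470322588326648400; 1550316404700; 303372; 945170800; 516675] 4137898132097852623200,
   ByTriple 1 2 2
   (Bound [:: (1, 4102454612, Comb [:: [:: 0; 3381942402]; [:: 2130404907; 578345328; 3998844965;
    4013533226]; [::]; [:: 0; 3524109284; 103609647; 88921386; 1873195377]; [:: 0; 0; 0;
    621657882]] [:: [::]; [:: 0; 667266714; 4087766351]; [::]; [:: 0; 3435187898; 14688261]] [::]
    [:: Mu 1 1 1 6889 0; Mu 1 1 4 (-83) 0; Mu 1 2 2 1 0; Mu 1 4 1 (-83) 0])] no_comb 0 1));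
  (SchemeData 0 8802 [:: 1; 1; 175; 1; 175]%positive
   [:: [:: 1; 351; 741650; 4050; 28350]; [:: 1; 27; 2282; -27; -2457]; [:: 1; 0; -2119; 0; 1944];
    [:: 1; -27; 2282; 27; -2457]; [:: 1; -351; 741650; -4050; 28350]]
   [::]
   [:: 1; 1950; 4900; 1950; 1]
   [:: 631547599256437500; 5126156437500; 6561; 38503130575; 4490161] 5558881968655162875000,
   ByTriple 1 2 3
   (Bound [:: (1, 2091830508, Comb [:: [:: 0; 1575214722]; [:: 41501430; 1709476029; 100439622;
    79644897]; [::]; [:: 0; 382354479; 1991390886; 2012185611; 1273913460]; [:: 0; 0; 0;
    786115422]] [:: [::]; [:: 0; 1629831132; 20794725]; [::]; [:: 0; 461999376; 2071035783]] [::]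
    [:: Mu 1 1 1 (-26569) 0; Mu 1 1 4 163 0; Mu 1 2 2 (-1) 0; Mu 1 4 1 163 0])] no_comb 0 1));
  (SchemeData 0 8978 [:: 1; 5; 1; 5; 1]%positive
   [:: [:: 1; 335; 1650; 22110; 2838]; [:: 1; 67; 42; -67; -43]; [:: 1; 0; -25; 0; 24]; [:: 1;
    -67; 42; 67; -43]; [:: 1; -335; 1650; -22110; 2838]]
   [::]
   [:: 1; 1650; 5676; 1650; 1]
   [:: 22597188322500; 40271220; 8300161; 9245; 2805625] 202877556759405000,
   ByTriple 1 2 3
   (Bound [:: (1, 1203052, Comb [:: [:: 0; 312622]; [:: 1474; 1020477; 37386; 32897]; [::]; [:: 0;
    182575; 1165666; 1170155; 725744]; [:: 0; 0; 0; 1016122]] [:: [::]; [:: 0; 987580; 4489];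
    [::]; [:: 0; 215472; 1198563]] [::] [:: Mu 1 1 1 (-1) 0; Mu 1 1 4 1 0; Mu 1 2 2 (-1) 0; Mu 1 4
    1 1 0])] no_comb 0 1));
  (SchemeData 0 9310 [:: 1; 3; 13; 3; 13]%positive
   [:: [:: 1; 315; 53352; 13650; 7150]; [:: 1; 35; 152; -35; -165]; [:: 1; 0; -513; 0; 500];
    [:: 1; -35; 152; 35; -165]; [:: 1; -315; 53352; -13650; 7150]]
   [::]
   [:: 1; 3510; 2288; 3510; 1]
   [:: 137121712607880000; 460642353600; 3705625; 245312496; 206324496] 1276603144379362800000,
   ByTriple 1 2 3
   (Bound [:: (1, 61911500, Comb [:: [:: 0; 5476940]; [:: 25957610; 14669235; 53003160; 53305735];
    [::]; [:: 0; 47242265; 8908340; 8605765; 28738640]; [:: 0; 0; 0; 18263560]] [:: [::]; [:: 0;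
    23275000; 61608925]; [::]; [:: 0; 38636500; 302575]] [::] [:: Mu 1 1 1 361 0; Mu 1 1 4 (-19)
    0; Mu 1 2 2 1 0; Mu 1 4 1 (-19) 0])] no_comb 0 1));
  (SchemeData 0 9350 [:: 1; 1; 19; 1; 19]%positive
   [:: [:: 1; 153; 75240; 4522; 13566]; [:: 1; 17; 440; -17; -459]; [:: 1; 0; -495; 0; 476];
    [:: 1; -17; 440; 17; -459]; [:: 1; -153; 75240; -4522; 13566]]
   [::]
   [:: 1; 2394; 4560; 2394; 1]
   [:: 1523158496798400; 65067217600; 14161; 74487600; 435600] 14241531945065040000,
   ByTriple 1 2 3
   (Bound [:: (1, 59447300, Comb [:: [:: 0; 41970280]; [:: 3035010; 11570625; 55583880; 55885885];
    [::]; [:: 0; 47876675; 3863420; 3561415; 43982400]; [:: 0; 0; 0; 34770780]] [:: [::]; [:: 0;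
    15132040; 59145295]; [::]; [:: 0; 44315260; 302005]] [::] [:: Mu 1 1 1 3025 0; Mu 1 1 4 (-55)
    0; Mu 1 2 2 1 0; Mu 1 4 1 (-55) 0])] no_comb 0 1));
  (SchemeData 0 9386 [:: 1; 1; 5; 1; 5]%positive
   [:: [:: 1; 171; 19890; 4522; 3570]; [:: 1; 19; 130; -19; -135]; [:: 1; 0; -117; 0; 112]; [:: 1;
    -19; 130; 19; -135]; [:: 1; -171; 19890; -4522; 3570]]
   [::]
   [:: 1; 2142; 5100; 2142; 1]
   [:: 34989912184500; 1196604500; 17689; 1711125; 549081] 328415315763717000,
   ByTriple 1 2 3
   (Bound [:: (1, 4636684, Comb [:: [:: 0; 1941914]; [:: 874874; 3798613; 236626; 213161]; [::];
    [:: 0; 838071; 4400058; 4423523; 1255748]; [:: 0; 0; 0; 2507050]] [:: [::]; [:: 0; 3585452;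
    23465]; [::]; [:: 0; 1051232; 4613219]] [::] [:: Mu 1 1 1 (-169) 0; Mu 1 1 4 13 0; Mu 1 2 2
    (-1) 0; Mu 1 4 1 13 0])] no_comb 0 1));
  (SchemeData 0 9522 [:: 1; 5; 1; 5; 1]%positive
   [:: [:: 1; 345; 1700; 23460; 3060]; [:: 1; 69; 44; -69; -45]; [:: 1; 0; -25; 0; 24]; [:: 1;
    -69; 44; 69; -45]; [:: 1; -345; 1700; -23460; 3060]]
   [::]
   [:: 1; 1700; 6120; 1700; 1]
   [:: 123833610000; 208080; 42849; 45; 13225] 1179143634420000,
   ByTriple 2 3 3
   (Bound [:: (1, 1314036, Comb [:: [:: 0; 0; 1122216]; [:: 0; 294906; 61617; 66378]; [::]; [:: 0;
    1119111; 38364; 33603]; [:: 0; 0; 363216]] [:: [::]; [:: 0; 128547; 1209294; 1214055]; [::];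
    [:: 728433; 1085508; 4761]] [::] [:: Mu 1 1 1 1 0; Mu 1 1 4 (-1) 0; Mu 1 2 2 1 0; Mu 1 4 1
    (-1) 0])] no_comb 0 1));
  (SchemeData 0 9522 [:: 1; 1; 1; 1; 1]%positive
   [:: [:: 1; 161; 3360; 4600; 1400]; [:: 1; 23; 48; -23; -49]; [:: 1; 0; -21; 0; 20]; [:: 1; -23;
    48; 23; -49]; [:: 1; -161; 3360; -4600; 1400]]
   [::]
   [:: 1; 1400; 6720; 1400; 1]
   [:: 149304960000; 5760000; 13225; 7056; 76176] 1421681829120000,
   ByTriple 1 2 3
   (Bound [:: (1, 438012, Comb [:: [:: 0; 53544]; [:: 14904; 381501; 8556; 6969]; [::]; [:: 0;
    56511; 429456; 431043; 197754]; [:: 0; 0; 0; 378120]] [:: [::]; [:: 0; 374532; 1587]; [::];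
    [:: 0; 63480; 436425]] [::] [:: Mu 1 1 1 (-9) 0; Mu 1 1 4 3 0; Mu 1 2 2 (-1) 0; Mu 1 4 1 3
    0])] no_comb 0 1));
  (SchemeData 0 9702 [:: 1; 1; 1; 1; 1]%positive
   [:: [:: 1; 126; 2750; 4725; 2100]; [:: 1; 21; 55; -21; -56]; [:: 1; 0; -22; 0; 21]; [:: 1; -21;
    55; 21; -56]; [:: 1; -126; 2750; -4725; 2100]]
   [::]
   [:: 1; 1350; 7000; 1350; 1]
   [:: 1080560250000; 68062500; 142884; 48400; 245025] 10483595545500000,
   ByTriple 1 2 2
   (Bound [:: (1, 4482324, Comb [:: [:: 0; 1276506]; [:: 164241; 3933468; 76923; 62370]; [::];
    [:: 0; 548856; 4405401; 4419954; 650727]; [:: 0; 0; 0; 4020786]] [:: [::]; [:: 0; 3871098;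
    14553]; [::]; [:: 0; 611226; 4467771]] [::] [:: Mu 1 1 1 (-121) 0; Mu 1 1 4 33 0; Mu 1 2 2
    (-9) 0; Mu 1 4 1 33 0])] no_comb 0 1))].

Definition certificates_five : seq (scheme_data * argument) := [::
  (SchemeData 0 576 [:: 1; 1; 1; 7; 1; 7]%positive
   [:: [:: 1; 21; 140; 1680; 147; 189]; [:: 1; 9; 20; 0; -21; -63]; [:: 1; 3; -4; -48; 3; 27];
    [:: 1; -3; -4; 48; 3; -27]; [:: 1; -9; 20; 0; -21; 63]; [:: 1; -21; 140; -1680; 147; -189]]
   [::]
   [:: 1; 42; 245; 245; 42; 1]
   [:: 11202105600; 25401600; 571536; 567; 518400; 44800] 6452412825600,
   ByTriple 4 4 4
   (Bound [:: (1, 3456, Comb [:: [:: 0; 0; 0; 0; 942]; [:: 0; 2826; 0; 2610; 2934; 990]; [:: 0; 0;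
    618; 726; 1122]; [:: 0; 3378; 102; 3450]; [:: 3438; 198; 1602; 0; 90]; [:: 0; 462]] [:: [::];
    [:: 0; 432; 0; 864; 432]; [:: 0; 0; 2736; 2736]; [:: 0; 144]; [:: 1296; 0; 2160]] [::] [:: Mu
    1 1 4 2 0; Mu 1 2 2 1 0])] no_comb 0 1));
  (SchemeData 7 800 [:: 1; 7; 7; 7; 7; 7]%positive
   [:: [:: 1; 175; 1568; 2450; 1225; 175]; [:: 1; 0; 168; 0; -175; 0]; [:: 1; 25; -32; -50; 25;
    25]; [:: 1; -25; -32; 50; 25; -25]; [:: 1; 0; 168; 0; -175; 0]; [:: 1; -175; 1568; -2450;
    1225; -175]]
   [:: [:: 0; 0; 0; 0; 0; 0]; [:: 0; 25; 0; 0; 0; -25]; [:: 0; 0; 0; 0; 0; 0]; [:: 0; 0; 0; 0; 0;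
    0]; [:: 0; -25; 0; 0; 0; 25]; [:: 0; 0; 0; 0; 0; 0]]
   [:: 1; 56; 343; 343; 56; 1]
   [:: 10756480000; 50176; 625; 256; 1024; 50176] 8605184000000,
   (* Columns 1 and 5 of Q are conjugate and column 3 is rational. The equations (1,1,1) and
      (5,5,5), and likewise (1,1,3) and (5,5,3), are therefore conjugate, and equal rational
      multipliers make their sum rational. All six irrational Q with five classes use the
      multipliers [r + 1] and [(3 r + 1) / 2], where r is the common scale 7, 11, 15, 19, 23 or 27
      of the columns 1 to 5. *)
   ByTriple 4 4 4
   (Bound [:: (1, 3500000, Comb [:: [:: 0; 0; 0; 0; 1750000]; [:: 0; 3062500; 0; 1312500; 3062500;
    1312500]; [:: 0; 0; 0; 1312500; 1750000]; [:: 0; 1312500; 0; 3062500]; [:: 1750000; 0;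
    1750000]; [:: 0; 1750000]] [:: [::]; [:: 0; 437500; 0; 2187500; 437500]; [:: 0; 0; 1750000;
    2625000]; [:: 0; 437500; 875000]; [:: 437500; 0; 3062500]] [:: [::]; [:: 0; 0; 0; 2187500];
    [:: 0; 0; 2187500; 437500]] [:: Mu 1 1 1 8 0; Mu 1 1 3 11 0; Mu 5 5 3 11 0; Mu 5 5 5 8 0])]
    no_comb 0 1));
  (SchemeData 0 2000 [:: 1; 9; 3; 9; 3; 3]%positive
   [:: [:: 1; 225; 972; 8100; 2025; 225]; [:: 1; 75; 72; 0; -75; -25]; [:: 1; 25; -28; -100; 25;
    25]; [:: 1; -25; -28; 100; 25; -25]; [:: 1; -75; 72; 0; -75; 25]; [:: 1; -225; 972; -8100;
    2025; -225]]
   [::]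
   [:: 1; 270; 729; 729; 270; 1]
   [:: 1771470000; 3888; 625; 3; 144; 11664] 3542940000000,
   ByTriple 1 4 4
   (Bound [:: (1, 6000000, Comb [:: [:: 0; 4676100]; [:: 700800; 476100; 2401200; 4326300;
    251400]; [:: 0; 386100; 128700; 5871300; 5613900]; [:: 0; 419850; 139950; 5860050; 5580150];
    [:: 0; 453600; 151200; 5848800; 5546400; 4436700]; [:: 0; 0; 0; 0; 168900]] [:: [::]; [:: 0;
    2535000; 828750; 2602500; 2636250]; [:: 0; 5898750; 1192500; 5966250]; [:: 0; 5898750;
    1192500; 5966250]; [:: 3922500; 5898750; 1192500; 5966250]] [:: [::]; [:: 0; 202500; 3615000;
    67500]; [:: 0; 135000; 4410000; 45000]; [:: 0; 67500; 5205000; 22500]] [:: Mu 1 1 3 4 0; Mu 1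
    1 4 (-3) 0; Mu 2 1 2 3 0; Mu 2 1 5 (-9) 0; Mu 3 1 3 1 0; Mu 4 1 1 3 0; Mu 5 1 2 (-3) 0])]
    no_comb 0 1));
  (SchemeData 0 2400 [:: 1; 1; 1; 11; 1; 11]%positive
   [:: [:: 1; 22; 231; 11550; 968; 1408]; [:: 1; 8; 21; 0; -22; -88]; [:: 1; 2; -9; -150; 8; 128];
    [:: 1; -2; -9; 150; 8; -128]; [:: 1; -8; 21; 0; -22; 88]; [:: 1; -22; 231; -11550; 968;
    -1408]]
   [::]
   [:: 1; 352; 847; 847; 352; 1]
   [:: 66116413440000; 136604160000; 1239040000; 45056; 70560000; 3031875] 158679392256000000,
   ByTriple 2 3 4
   (Bound [:: (1, 144000, Comb [:: [:: 0; 0; 82200]; [:: 0; 143200; 9760; 16800; 27360];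
    [:: 14920; 135560; 2120; 9160; 19720]; [:: 0; 117600; 128160; 135200; 1760; 25120]; [:: 0;
    102240; 112800; 119840; 130400]; [:: 0; 0; 0; 13800]] [:: [::]; [:: 0; 89280; 37800; 51480];
    [:: 0; 112280; 13280; 91280; 136280]; [:: 101400; 140480; 33800; 106680]; [:: 0; 27200; 53000;
    118200]] [:: [::]; [:: 0; 56320; 35200; 21120]; [:: 0; 35200; 58000; 121200]; [:: 0; 21120;
    13200; 7920]] [:: Mu 1 3 1 75 0; Mu 1 4 1 (-320) 0; Mu 2 2 1 100 0; Mu 2 5 1 (-20) 0; Mu 3 3 1
    1 0; Mu 4 1 1 220 0; Mu 5 2 1 (-5) 0])] no_comb 0 1));
  (SchemeData 11 2928 [:: 1; 11; 11; 11; 11; 11]%positive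
   [:: [:: 1; 671; 8712; 14762; 7381; 671]; [:: 1; 0; 660; 0; -671; 0]; [:: 1; 61; -72; -122; 61;
    61]; [:: 1; -61; -72; 122; 61; -61]; [:: 1; 0; 660; 0; -671; 0]; [:: 1; -671; 8712; -14762;
    7381; -671]]
   [:: [:: 0; 0; 0; 0; 0; 0]; [:: 0; 61; 0; 0; 0; -61]; [:: 0; 0; 0; 0; 0; 0]; [:: 0; 0; 0; 0; 0;
    0]; [:: 0; -61; 0; 0; 0; 61]; [:: 0; 0; 0; 0; 0; 0]]
   [:: 1; 132; 1331; 1331; 132; 1]
   [:: 3106619676864; 627264; 3721; 1296; 5184; 627264] 9096182413857792,
   ByTriple 1 1 4
   (Bound [:: (1, 79897312, Comb [:: [:: 0; 59922984]; [:: 19974328; 0; 59922984]; [:: 0;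
    29961492; 59922984; 9987164]; [:: 0; 0; 0; 69910148; 59922984]; [:: 0; 49935820; 0; 69910148;
    49935820; 29961492]; [:: 0; 0; 0; 0; 19974328]] [:: [::]; [:: 29961492; 0; 49935820]; [:: 0;
    69910148; 59922984]; [:: 0; 0; 19974328]; [:: 0; 29961492; 0; 9987164; 29961492]] [:: [::];
    [:: 0; 0; 0; 49935820]; [:: 0; 0; 49935820; 9987164]] [:: Mu 1 1 1 12 0; Mu 1 1 3 17 0; Mu 5 5
    3 17 0; Mu 5 5 5 12 0])] no_comb 0 1));
  (SchemeData 15 7232 [:: 1; 15; 15; 15; 15; 15]%positive
   [:: [:: 1; 1695; 28800; 50850; 25425; 1695]; [:: 1; 0; 1680; 0; -1695; 0]; [:: 1; 113; -128;
    -226; 113; 113]; [:: 1; -113; -128; 226; 113; -113]; [:: 1; 0; 1680; 0; -1695; 0]; [:: 1;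
    -1695; 28800; -50850; 25425; -1695]]
   [:: [:: 0; 0; 0; 0; 0; 0]; [:: 0; 113; 0; 0; 0; -113]; [:: 0; 0; 0; 0; 0; 0]; [:: 0; 0; 0; 0;
    0; 0]; [:: 0; -113; 0; 0; 0; 113]; [:: 0; 0; 0; 0; 0; 0]]
   [:: 1; 240; 3375; 3375; 240; 1]
   [:: 158866790400000; 3686400; 12769; 4096; 16384; 3686400] 1148924628172800000,
   ByTriple 4 4 4
   (Bound [:: (1, 692590560, Comb [:: [::]; [:: 0; 606016740; 0; 606016740; 606016740; 606016740];
    [:: 0; 0; 0; 606016740]; [:: 0; 606016740; 346295280; 606016740]] [:: [::]; [:: 0; 86573820;
    0; 86573820; 86573820]; [:: 0; 0; 0; 173147640]; [:: 0; 86573820; 173147640]; [:: 86573820; 0;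
    606016740]] [:: [::]; [:: 0; 0; 0; 86573820]; [:: 0; 0; 86573820; 432869100]] [:: Mu 1 1 1 16
    0; Mu 1 1 3 23 0; Mu 5 5 3 23 0; Mu 5 5 5 16 0])] no_comb 0 1));
  (SchemeData 19 14480 [:: 1; 19; 19; 19; 19; 19]%positive
   [:: [:: 1; 3439; 72200; 130682; 65341; 3439]; [:: 1; 0; 3420; 0; -3439; 0]; [:: 1; 181; -200;
    -362; 181; 181]; [:: 1; -181; -200; 362; 181; -181]; [:: 1; 0; 3420; 0; -3439; 0]; [:: 1;
    -3439; 72200; -130682; 65341; -3439]]
   [:: [:: 0; 0; 0; 0; 0; 0]; [:: 0; 181; 0; 0; 0; -181]; [:: 0; 0; 0; 0; 0; 0]; [:: 0; 0; 0; 0;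
    0; 0]; [:: 0; -181; 0; 0; 0; 181]; [:: 0; 0; 0; 0; 0; 0]]
   [:: 1; 380; 6859; 6859; 380; 1]
   [:: 3244779173560000; 14440000; 32761; 10000; 40000; 14440000] 46984402433148800000,
   ByTriple 1 1 1
   (Bound [:: (1, 3605282528, Comb [:: [:: 0; 901320632]; [:: 901320632; 0; 2703961896]; [:: 0;
    2253301580; 3154622212]; [:: 0; 0; 1351980948; 0; 901320632]; [:: 0; 1351980948; 0;
    2253301580; 1351980948; 450660316]; [:: 0; 0; 0; 0; 2703961896]] [:: [::]; [:: 2253301580; 0;
    3154622212]; [:: 0; 450660316; 3154622212]; [:: 0; 0; 450660316; 2703961896]; [:: 0;
    2253301580; 0; 901320632; 2253301580]] [:: [::]; [:: 0; 0; 1802641264]; [:: 0; 0; 1351980948];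
    [:: 0; 0; 0; 450660316]] [:: Mu 1 1 1 20 0; Mu 1 1 3 29 0; Mu 5 5 3 29 0; Mu 5 5 5 20 0])]
    no_comb 0 1));
  (SchemeData 23 25440 [:: 1; 23; 23; 23; 23; 23]%positive
   [:: [:: 1; 6095; 152352; 280370; 140185; 6095]; [:: 1; 0; 6072; 0; -6095; 0]; [:: 1; 265; -288;
    -530; 265; 265]; [:: 1; -265; -288; 530; 265; -265]; [:: 1; 0; 6072; 0; -6095; 0]; [:: 1;
    -6095; 152352; -280370; 140185; -6095]]
   [:: [:: 0; 0; 0; 0; 0; 0]; [:: 0; 265; 0; 0; 0; -265]; [:: 0; 0; 0; 0; 0; 0]; [:: 0; 0; 0; 0;
    0; 0]; [:: 0; -265; 0; 0; 0; 265]; [:: 0; 0; 0; 0; 0; 0]]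
   [:: 1; 552; 12167; 12167; 552; 1]
   [:: 37490039973043200; 43877376; 70225; 20736; 82944; 43877376] 953746616914219008000,
   ByTriple 4 4 4
   (Bound [:: (1, 13696684000, Comb [:: [:: 0; 0; 0; 0; 6848342000]; [:: 0; 11984598500; 0;
    5136256500; 11984598500; 5136256500]; [:: 0; 0; 0; 5136256500; 6848342000]; [:: 0; 5136256500;
    0; 11984598500]; [:: 6848342000; 0; 6848342000]; [:: 0; 6848342000]] [:: [::]; [:: 0;
    1712085500; 0; 8560427500; 1712085500]; [:: 0; 0; 6848342000; 10272513000]; [:: 0; 1712085500;
    3424171000]; [:: 1712085500; 0; 11984598500]] [:: [::]; [:: 0; 0; 0; 8560427500]; [:: 0; 0;
    8560427500; 1712085500]] [:: Mu 1 1 1 24 0; Mu 1 1 3 35 0; Mu 5 5 3 35 0; Mu 5 5 5 24 0])]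
    no_comb 0 1));
  (SchemeData 0 37752 [:: 1; 25; 5; 25; 5; 5]%positive
   [:: [:: 1; 3025; 18750; 453750; 75625; 3025]; [:: 1; 605; 600; 0; -605; -121]; [:: 1; 121;
    -126; -726; 121; 121]; [:: 1; -121; -126; 726; 121; -121]; [:: 1; -605; 600; 0; -605; 121];
    [:: 1; -3025; 18750; -453750; 75625; -3025]]
   [::]
   [:: 1; 3250; 15625; 15625; 3250; 1]
   [:: 25736132812500; 112500; 14641; 5; 900; 562500] 971590485937500000,
   ByTriple 1 4 4
   (Bound [:: (1, 2551047840, Comb [:: [:: 0; 884460390]; [:: 292368670; 2339190150; 1728135310;
    147083970; 2087076970]; [:: 0; 217709250; 43541850; 2507505990; 2333338590]; [:: 0; 221369500;
    44273900; 2506773940; 2329678340]; [:: 0; 228690000; 45738000; 2505309840; 2322357840;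
    1334392840]; [:: 0; 0; 0; 0; 68668710]] [:: [::]; [:: 0; 319613030; 2155887250; 330593780;
    337914280]; [:: 0; 2532746590; 542449050; 2543727340]; [:: 0; 2532746590; 542449050;
    2543727340]; [:: 1114326510; 2532746590; 542449050; 2543727340]] [:: [::]; [:: 0; 36602500;
    1466149740; 14641000]; [:: 0; 21961500; 1900108980; 8784600]; [:: 0; 14641000; 2117088600;
    5856400]] [:: Mu 1 1 3 6 0; Mu 1 1 4 (-5) 0; Mu 2 1 2 5 0; Mu 2 1 5 (-25) 0; Mu 3 1 3 1 0; Mu
    4 1 1 5 0; Mu 5 1 2 (-5) 0])] no_comb 0 1));
  (SchemeData 3 40880 [:: 1; 27; 27; 27; 27; 27]%positive
   [:: [:: 1; 9855; 285768; 532170; 266085; 9855]; [:: 1; 0; 9828; 0; -9855; 0]; [:: 1; 365; -392;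
    -730; 365; 365]; [:: 1; -365; -392; 730; 365; -365]; [:: 1; 0; 9828; 0; -9855; 0]; [:: 1;
    -9855; 285768; -532170; 266085; -9855]]
   [:: [:: 0; 0; 0; 0; 0; 0]; [:: 0; 1095; 0; 0; 0; -1095]; [:: 0; 0; 0; 0; 0; 0]; [:: 0; 0; 0; 0;
    0; 0]; [:: 0; -1095; 0; 0; 0; 1095]; [:: 0; 0; 0; 0; 0; 0]]
   [:: 1; 756; 19683; 19683; 756; 1]
   [:: 293749194068164800; 112021056; 133225; 38416; 153664; 112021056] 12008467053506577024000,
   ByTriple 1 1 4
   (Bound [:: (1, 42013836000, Comb [:: [:: 0; 31510377000]; [:: 10503459000; 0; 31510377000];
    [:: 0; 15755188500; 31510377000; 5251729500]; [:: 0; 0; 0; 36762106500; 31510377000]; [:: 0;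
    26258647500; 0; 36762106500; 26258647500; 15755188500]; [:: 0; 0; 0; 0; 10503459000]]
    [:: [::]; [:: 15755188500; 0; 26258647500]; [:: 0; 36762106500; 31510377000]; [:: 0; 0;
    10503459000]; [:: 0; 15755188500; 0; 5251729500; 15755188500]] [:: [::]; [:: 0; 0; 0;
    26258647500]; [:: 0; 0; 26258647500; 5251729500]] [:: Mu 1 1 1 28 0; Mu 1 1 3 41 0; Mu 5 5 3
    41 0; Mu 5 5 5 28 0])] no_comb 0 1));
  (SchemeData 0 47040 [:: 1; 1; 1; 29; 1; 29]%positive
   [:: [:: 1; 116; 3335; 653660; 20184; 25056]; [:: 1; 24; 115; 0; -116; -696]; [:: 1; 4; -25;
    -980; 24; 864]; [:: 1; -4; -25; 980; 24; -864]; [:: 1; -24; 115; 0; -116; 696]; [:: 1; -116;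
    3335; -653660; 20184; -25056]]
   [::]
   [:: 1; 4176; 19343; 19343; 4176; 1]
   [:: 16765145130048537600; 1245923389569600; 1507355329536; 1353024; 41152179600; 920843525]
    788632426917483208704000,
   ByTriple 2 3 4
   (Bound [:: (1, 13171200, Comb [:: [:: 0; 0; 570360]; [:: 0; 9518544; 8456784; 8690640;
    10921680]; [:: 2600472; 9570456; 8508696; 8742552; 10973592]; [:: 0; 5209680; 4147920;
    4381776; 6612816; 2935632]; [:: 0; 4483920; 3422160; 3656016; 5887056]; [:: 0; 0; 0; 4039560]]
    [:: [::]; [:: 0; 4499040; 5368440; 12301800]; [:: 0; 8465688; 3791088; 604128; 9100728];
    [:: 1487640; 13116768; 8200248; 4916520]; [:: 0; 1397088; 9046968; 5521320]] [:: [::]; [:: 0;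
    2806272; 4929792; 11047680]; [:: 0; 4929792; 9186912; 8914080]; [:: 0; 4462080; 3974880;
    487200]] [:: Mu 1 1 3 245 0; Mu 1 4 1 (-1512) 0; Mu 2 1 5 (-42) 0; Mu 2 2 1 294 0; Mu 3 1 3 1
    0; Mu 4 1 1 1218 0; Mu 5 2 1 (-7) 0])] no_comb 0 1))].

Local Close Scope Z_scope.

Lemma certificates_three_ok :
  all2 check_certificate krein_arrays_three certificates_three.
Proof. by vm_compute. Qed.

Lemma certificates_four_ok :
  all2 check_certificate krein_arrays_four certificates_four.
Proof. by vm_compute. Qed.

Lemma certificates_five_ok :
  all2 check_certificate krein_arrays_five certificates_five.
Proof. by vm_compute. Qed.

Lemma all2_In (A B : Type) (p : A -> B -> bool) s t x :
  all2 p s t -> List.In x s -> exists y, p x y.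
Proof.
elim: s t => //= a s IHs [//|b t] /andP[pab /IHs{}IHs] [<-|/IHs//].
by exists b.
Qed.

Lemma In_cat (A : Type) (s t : seq A) x :
  List.In x (s ++ t) -> List.In x s \/ List.In x t.
Proof.
by elim: s => [|y s IHs] /=; [right|case=> [->|/IHs[]]; [left; left|left; right|right]].
Qed.

Theorem theorem4p3 (R : realType) (X : finType) (D : nat)
    (Rel : 'I_D.+1 -> {set X * X}) (b c : seq Q) :
  List.In (b, c) excluded_krein_arrays ->
  ~ Q_polynomial_scheme_with_array Rel (map (@of_Q R) b, map (@of_Q R) c).
Proof.
move=> bc_in.
suff [cert certP] : exists cert, check_certificate (b, c) cert.
  exact: check_certificate_sound certP.
have [in3|] := @In_cat _ krein_arrays_three _ _ bc_in.
  exact: (all2_In certificates_three_ok in3).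
move=> /(@In_cat _ krein_arrays_four)[in4|in5].
  exact: (all2_In certificates_four_ok in4).
exact: (all2_In certificates_five_ok in5).
Qed.
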